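(* Let $X$ be a (nonempty) geodesic metric space of finite affine rank. Then $X$ admits a decomposition as a direct product $$X=Y_0\times Y_1\times Y_2\times\dots\times Y_n ,$$ where $n\ge 0$, $Y_0$ is a Euclidean space $\mathbb{R}^k$, $k\ge 0$ (possibly a point), and each $Y_i$, $i=1,\dots,n$, is an irreducible metric space that is isometric neither to the real line nor to a point. This decomposition is unique in the following sense: if $X=Z_0\times Z_1\times\dots\times Z_m$ is another direct product decomposition of this kind (i.e. $Z_0$ is a Euclidean space, possibly a point, and $Z_1,\dots,Z_m$ are irreducible metric spaces isometric neither to the real line nor to a point), then $m=n$ and there exists a permutation $s$ of $\{0,1,\dots,n\}$ such that for each point $x\in X$ and for all $i=1,\dots,n$ the $Y_i$-fiber through $x$ coincides with the $Z_{s(i)}$-fiber through $x$.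
   Context: Direct product: for metric spaces $Y,Z$, $Y\times Z$ is the Cartesian product with metric $d((y,z),(\bar y,\bar z))=\sqrt{d^2(y,\bar y)+d^2(z,\bar z)}$, and similarly for finitely many factors. An equality $X=Y_0\times\dots\times Y_n$ means that a (surjective) isometry $I:X\to Y_0\times\dots\times Y_n$ is fixed; it defines projections $P^{Y_i}:X\to Y_i$. The $Y_i$-fiber through $x\in X$ is the set of all $x'\in X$ with $P^{Y_j}(x')=P^{Y_j}(x)$ for all $j\neq i$. A metric space $X$ is irreducible if for each decomposition $X=Y\times Z$ one of the factors $Y$, $Z$ is a point. A geodesic in a metric space is an isometric embedding of an interval; a metric space is geodesic if each pair of its points is connected by a geodesic. A metric space is affine if it is isometric to a linearly convex subset of a real normed vector space. The affine rank $\operatorname{rank}_{\operatorname{aff}}(X)$ is the supremum of the topological dimensions of affine metric spaces that admit an isometric embedding into $X$. All metric spaces are nonempty. *)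

(* Defs.v *)
From HB Require Import structures.
From mathcomp Require Import all_boot all_order all_algebra all_fingroup.
From mathcomp Require Import all_classical all_reals all_analysis.

Set Implicit Arguments.
Unset Strict Implicit.
Unset Printing Implicit Defensive.

Import Order.TTheory GRing.Theory Num.Theory.
Import numFieldNormedType.Exports.

Local Open Scope classical_set_scope.
Local Open Scope ring_scope.

Section MetricNotions.
Context {R : realType}.

(* [T] is a bare type with an explicit distance [d], because the library puts
   the sup metric, not the l2 metric, on pairs and on row vectors. *)
Definition isometry_onto (X : metricType R) (T : Type) (d : T -> T -> R)
    (f : X -> T) : Prop :=
  (forall x x', d (f x) (f x') = mdist x x') /\ (forall t, exists x, f x = t).

Definition isometric (X Y : metricType R) : Prop :=
  exists f : X -> Y, isometry_onto (fun y y' : Y => mdist y y') f.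

Definition isometric_embedding (X Y : metricType R) (f : X -> Y) : Prop :=
  forall x x', mdist (f x) (f x') = mdist x x'.

Definition is_point (X : metricType R) : Prop :=
  exists x0 : X, forall x : X, x = x0.

Definition pair_dist (Y Z : metricType R) (p q : Y * Z) : R :=
  Num.sqrt (mdist p.1 q.1 ^+ 2 + mdist p.2 q.2 ^+ 2).

Definition prod_dist (I : finType) (Y : I -> metricType R)
    (p q : forall i, Y i) : R :=
  Num.sqrt (\sum_i mdist (p i) (q i) ^+ 2).

Definition euclidean_dist (k : nat) (u v : 'rV[R]_k) : R :=
  Num.sqrt (\sum_i (u ord0 i - v ord0 i) ^+ 2).

Definition is_euclidean (X : metricType R) : Prop :=
  exists (k : nat) (f : X -> 'rV[R]_k), isometry_onto (@euclidean_dist k) f.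

(* The factors of a nonempty product are nonempty, so they need no separate
   nonemptiness hypothesis, here and in [de_rham_decomposition]. *)
Definition irreducible (X : metricType R) : Prop :=
  forall (Y Z : metricType R) (phi : X -> Y * Z),
    isometry_onto (@pair_dist Y Z) phi -> is_point Y \/ is_point Z.

Definition fiber (X : metricType R) (I : finType) (Y : I -> metricType R)
    (phi : X -> forall i, Y i) (i : I) (x : X) : set X :=
  [set x' | forall j, j != i -> phi x' j = phi x j].

Definition geodesic (X : metricType R) (J : interval R) (g : R -> X) : Prop :=
  {in J &, forall s t, mdist (g s) (g t) = `|s - t|}.

Definition geodesic_space (X : metricType R) : Prop :=
  forall x y : X, exists (a b : R) (g : R -> X),
    [/\ a <= b, geodesic `[a, b] g, g a = x & g b = y].

(* Lebesgue covering dimension at most [n]: every finite open cover has a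
   finite open refinement in which no [n + 2] members (counted by index) have
   a common point. *)
Definition covering_dim_le (T : topologicalType) (n : nat) : Prop :=
  forall (p : nat) (U : 'I_p -> set T),
    (forall i, open (U i)) -> \bigcup_i U i = setT ->
    exists (q : nat) (V : 'I_q -> set T),
      [/\ forall j, open (V j),
          \bigcup_j V j = setT,
          forall j, exists i, V j `<=` U i &
          forall J : {set 'I_q},
            (exists x, forall j, j \in J -> V j x) -> (#|J| <= n.+1)%N].

(* The value is +oo if no bound exists; only used for nonempty [T], so the
   convention that the empty space has dimension -1 plays no role. *)
Definition topological_dim (T : topologicalType) : \bar R :=
  ereal_inf [set n%:R%:E | n in [set n | covering_dim_le T n]].

Definition affine (A : metricType R) : Prop :=
  exists (V : normedModType R) (C : set V) (f : A -> V),
    [/\ convex_set (C : set (convex_lmodType V)),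
        forall a b, `|f a - f b| = mdist a b &
        range f = C].

Definition affine_rank (X : metricType R) : \bar R :=
  ereal_sup [set r | exists A : metricType R,
    [/\ [set: A] !=set0, affine A,
        exists f : A -> X, isometric_embedding f &
        r = topological_dim A]].

Definition de_rham_decomposition (X : metricType R) (n : nat)
    (Y : 'I_n.+1 -> metricType R) (phi : X -> forall i, Y i) : Prop :=
  [/\ isometry_onto (@prod_dist _ Y) phi,
      is_euclidean (Y ord0) &
      forall i, i != ord0 ->
        [/\ irreducible (Y i), ~ isometric (Y i) R^o & ~ is_point (Y i)]].

End MetricNotions.

(* Main.v *)
(* Uniqueness. A decomposition is recorded by pseudo-distances on X.  Suppose
   X = Y x Y' = Z x Z'.  A segment in a Y-fiber and one in a Y'-fiber span a flat
   rectangle, on which the Z-distance is linear along every segment.  Such a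
   pseudo-distance is translation invariant: writing g(a, b) for the distance
   between points at heights a and b on two parallel sides, halving the two
   diagonals of a quadrilateral gives
     g(a, b) <= (g(a, b + h) + g(a + h, b)) / 2,
   and a random walk argument makes g(a, a) constant.  Moving the Z- and the
   Z'-component of a rectangle independently yields a four-parameter family of
   points to which the same applies; comparing the two Pythagorean identities on
   it shows that the squared Z-distance is a quadratic form on the rectangle.
   For a, a' in Y', moving a point of Y towards a' and projecting to Z and
   back to Y therefore defines a map T of Y with
     d(p, T q)^2 = d(p, q)^2 + c^2 + b(p, q),  b antisymmetric.
   If c > 0, letting the iterates of T go to infinity shows that b is additive,
   the maps T extend to a flow of translations, and Y splits off a line.  So if Y
   is irreducible and not a line, then b = 0, the projections to Y and Z commute,
   the Y-fibers split along Z and Z', and hence lie in fibers of Z or of Z'.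

   Existence. A product with n nontrivial geodesic factors contains a Euclidean
   n-box, whose covering dimension is at least n by Kuhn's cubical form of
   Sperner's lemma.  So n is bounded, and a decomposition with the maximal number
   of factors has irreducible factors; the lines among them form Y_0. *)

Require Import Defs.
From mathcomp Require Import all_boot all_order all_algebra all_fingroup.
From mathcomp Require Import all_classical all_reals all_analysis.
From HB Require Import structures.
From mathcomp Require Import ring lra.

Import Order.TTheory GRing.Theory Num.Theory.
Import numFieldNormedType.Exports.

Local Open Scope classical_set_scope.
Local Open Scope ring_scope.

Set Implicit Arguments.
Unset Strict Implicit.
Unset Printing Implicit Defensive.

(** * Affine pseudo-distances are restrictions of seminorms *)

(** A general geodesic space has neither angles nor unique geodesics, so flatness has to be
    extracted from the triangle inequality alone; this is why averaging arguments take the place of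
    local geometry. Inner products are available only indirectly, as polarisations of squared
    distances: [bform] below is the mixed term of the squared [Z]-distance. Two symmetries of this
    term carry the argument. It is antisymmetric in the points of [Y] because opposite sides of a
    rectangle agree, and it changes sign when [Z] is replaced by [Z'] because the sides of the
    rectangle are orthogonal in [X]. The second symmetry makes the motion built from [Z'] the
    inverse of the one built from [Z], so that a one-sided construction yields a flow in both time
    directions. Pseudo-distances put all factors on the same set [X], where an inclusion of fibers
    is an implication between vanishing distances. *)

Definition pseudo_distance {R : realType} {T : Type} (rho : T -> T -> R) : Prop :=
  [/\ forall x, rho x x = 0, forall x y, rho x y = rho y x &
      forall x y z, rho x z <= rho x y + rho y z].

Definition linear_curve {R : realType} {T : Type} (rho : T -> T -> R)
    (g : R -> T) : Prop :=
  forall s t : R, 0 <= s <= 1 -> 0 <= t <= 1 ->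
    rho (g s) (g t) = `|s - t| * rho (g 0) (g 1).

Section PseudoDistance.
Context {R : realType} {T : Type} (rho : T -> T -> R).
Hypothesis rho_pd : pseudo_distance rho.

Lemma pd_refl x : rho x x = 0. Proof. by case: rho_pd. Qed.
Lemma pd_sym x y : rho x y = rho y x. Proof. by case: rho_pd. Qed.
Lemma pd_triangle y x z : rho x z <= rho x y + rho y z.
Proof. by case: rho_pd. Qed.

Lemma pd_ge0 x y : 0 <= rho x y.
Proof. by have := pd_triangle y x x; rewrite pd_refl (pd_sym y x); lra. Qed.

Lemma pd_congl x x' y : rho x x' = 0 -> rho x y = rho x' y.
Proof.
move=> e; have := pd_triangle x' x y; have := pd_triangle x x' y.
by rewrite (pd_sym x' x) e; lra.
Qed.

Lemma pd_congr x x' y : rho x x' = 0 -> rho y x = rho y x'.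
Proof. by move=> e; rewrite !(pd_sym y); exact: pd_congl. Qed.

End PseudoDistance.

Lemma pd_pullback {R : realType} {S T : Type} (f : S -> T) (rho : T -> T -> R) :
  pseudo_distance rho -> pseudo_distance (fun x y => rho (f x) (f y)).
Proof.
by move=> H; split=> *; [exact: pd_refl|exact: pd_sym|exact: pd_triangle].
Qed.

Lemma pd_mdist {R : realType} (X : metricType R) :
  pseudo_distance (fun x y : X => mdist x y).
Proof.
split=> *; [exact: mdistxx|exact: metric_sym|exact: metric_triangle].
Qed.

Lemma squaresI {R : realType} (x y : R) :
  0 <= x -> 0 <= y -> x ^+ 2 = y ^+ 2 -> x = y.
Proof. by move=> x0 y0 /eqP; rewrite eqrXn2// => /eqP. Qed.

Lemma sq_eq0 {R : realType} (x : R) : x ^+ 2 = 0 -> x = 0.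
Proof. by move=> /eqP; rewrite sqrf_eq0 => /eqP. Qed.

Lemma pd_eq0P {R : realType} {T : Type} {a b d : T -> T -> R} {x y : T} :
  d x y ^+ 2 = a x y ^+ 2 + b x y ^+ 2 -> d x y = 0 -> a x y = 0 /\ b x y = 0.
Proof.
move=> e d0; rewrite d0 expr0n/= in e.
have a2 := sqr_ge0 (a x y); have b2 := sqr_ge0 (b x y).
by split; apply: sq_eq0; lra.
Qed.

Lemma archi_le0 {R : realType} (x C : R) :
  (forall n : nat, n%:R * x <= C) -> x <= 0.
Proof.
move=> H; rewrite leNgt; apply/negP => x0.
have C0 : 0 <= C by have := H 0%N; rewrite mul0r.
have := H (Num.bound (C / x)); have := archi_boundP (divr_ge0 C0 (ltW x0)).
by rewrite ltr_pdivrMr//; lra.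
Qed.

(** * Midpoint inequalities and constancy on the diagonal *)

Section RandomWalk.
Context {R : realType} (g : R -> R -> R) (L : R).
Hypothesis g_mid : forall a b h : R, 0 <= a <= 1 -> 0 <= b <= 1 ->
  0 <= a + h <= 1 -> 0 <= b + h <= 1 -> g a b <= (g a (b + h) + g (a + h) b) / 2.
Hypothesis g_lip : forall a b a' b' : R, 0 <= a <= 1 -> 0 <= b <= 1 ->
  0 <= a' <= 1 -> 0 <= b' <= 1 -> g a b <= g a' b' + L * (`|a - a'| + `|b - b'|).
Hypothesis L_ge0 : 0 <= L.

Lemma absr_le_sq (x c : R) : 0 < c -> `|x| <= x ^+ 2 / (2 * c) + c / 2.
Proof.
move=> c0; have -> : x ^+ 2 / (2 * c) + c / 2 = (x ^+ 2 + c ^+ 2) / (2 * c).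
  by field; lra.
rewrite ler_pdivlMr; last by lra.
have := sqr_ge0 (`|x| - c); rewrite -(real_normK (num_real x)).
by lra.
Qed.

(* The invariant of a simple random walk on the antidiagonal coordinate
   [b - a], whose variance grows by [h ^+ 2] at each step. *)
Lemma walk_bound (c m h : R) (k : nat) (a b : R) : 0 < c ->
  0 <= a <= 1 -> 0 <= b <= 1 ->
  0 <= a + k%:R * h <= 1 -> 0 <= b + k%:R * h <= 1 ->
  a + b + k%:R * h = 2 * m ->
  g a b <= g m m + L * (((b - a) ^+ 2 + k%:R * h ^+ 2) / (2 * c) + c / 2).
Proof.
move=> c0; elim: k a b => [|k IH] a b Ia Ib Iah Ibh.
  rewrite !mul0r !addr0 => abm; apply: (le_trans (g_lip (a' := m) (b' := m) _ _ _ _)); try lra.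
  rewrite lerD2l; apply: ler_wpM2l => //.
  apply: le_trans (absr_le_sq (b - a) c0).
  have -> : m = (a + b) / 2 by lra.
  have -> : a - (a + b) / 2 = - ((b - a) / 2) by field.
  have -> : b - (a + b) / 2 = (b - a) / 2 by field.
  by rewrite normrN normrM (gtr0_norm (x := 2^-1)) ?invr_gt0//; lra.
rewrite -natr1 mulrDl mul1r in Iah Ibh * => abm.
have k0 : 0 <= k%:R :> R by [].
have Ih1 : 0 <= a + h <= 1 by have [h0|h0] := leP 0 h; nra.
have Ih2 : 0 <= b + h <= 1 by have [h0|h0] := leP 0 h; nra.
have Ih3 : 0 <= a + k%:R * h <= 1 by have [h0|h0] := leP 0 h; nra.
have Ih4 : 0 <= b + k%:R * h <= 1 by have [h0|h0] := leP 0 h; nra.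
apply: (le_trans (g_mid Ia Ib Ih1 Ih2)).
have H1 := IH a (b + h) Ia Ih2.
have H2 := IH (a + h) b Ih1 Ib.
have {}H1 := H1 ltac:(lra) ltac:(lra) ltac:(lra).
have {}H2 := H2 ltac:(lra) ltac:(lra) ltac:(lra).
rewrite -natr1.
have -> : ((b - a) ^+ 2 + (k%:R + 1) * h ^+ 2) / (2 * c) + c / 2 =
  (((b + h - a) ^+ 2 + k%:R * h ^+ 2) / (2 * c) + c / 2 +
  (((b - (a + h)) ^+ 2 + k%:R * h ^+ 2) / (2 * c) + c / 2)) / 2.
  by field; lra.
have avg (u v w A B : R) : u <= w + L * A -> v <= w + L * B ->
    (u + v) / 2 <= w + L * ((A + B) / 2).
  move=> ? ?; have -> : L * ((A + B) / 2) = (L * A + L * B) / 2 by field.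
  by lra.
exact: avg.
Qed.

(** A walk of [n] steps of size [2 * D / n] from [(s, s)] ends on the antidiagonal through
    [(s + D, s + D)], and its spread tends to 0 as [n] grows. All steps may fall on one coordinate,
    so the range up to [s + 2 * D] has to lie in the unit interval. *)
Lemma diag_half (s D : R) : 0 <= s <= 1 -> 0 <= s + 2 * D <= 1 ->
  g s s <= g (s + D) (s + D).
Proof.
move=> Is Id; apply/ler_addgt0Pr => e e0.
have L0 := L_ge0; have L1 : 0 < L + 1 by lra.
(* With [n >= 4 * D ^+ 2 / c ^+ 2] each of the two error terms of [walk_bound] is at most [c / 2],
   and [c] is picked so that [L * c <= e]. *)
pose c := e / (L + 1).
have c0 : 0 < c by rewrite divr_gt0.
set n := (Num.bound (4 * D ^+ 2 / c ^+ 2)).+1.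
have n0 : 0 < n%:R :> R by rewrite ltr0n.
have nb : 4 * D ^+ 2 / c ^+ 2 <= n%:R.
  rewrite (le_trans (ltW (archi_boundP _)))//; last by rewrite ler_nat.
  by rewrite divr_ge0 ?sqr_ge0// mulr_ge0 ?sqr_ge0.
have nh : n%:R * (2 * D / n%:R) = 2 * D by field; lra.
have := @walk_bound c (s + D) (2 * D / n%:R) n s s c0 Is Is.
rewrite nh => /(_ Id Id) -/(_ ltac:(lra)) /le_trans; apply.
rewrite lerD2l subrr expr0n/= add0r.
have -> : n%:R * (2 * D / n%:R) ^+ 2 / (2 * c) = 4 * D ^+ 2 / c ^+ 2 / n%:R * (c / 2).
  by field; lra.
have H : 4 * D ^+ 2 / c ^+ 2 / n%:R <= 1 by rewrite ler_pdivrMr// mul1r.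
have : L * (4 * D ^+ 2 / c ^+ 2 / n%:R * (c / 2) + c / 2) <= L * c.
  by apply: ler_wpM2l => //; nra.
have : (L + 1) * c = e by rewrite /c; field; lra.
by lra.
Qed.

(** [diag_half] covers only half of the way to the end of the interval, so it is iterated, and the
    Lipschitz bound closes the remaining gap [D / 2 ^+ k]. Both signs of [D] give both inequalities,
    through the value at [1 / 2]. *)
Lemma diag_const : g 0 0 = g 1 1.
Proof.
have main (s D : R) : 0 <= s <= 1 -> 0 <= s + 2 * D <= 1 ->
    g (s + D) (s + D) <= g (s + 2 * D) (s + 2 * D).
  move=> Is Id.
  have step k : g (s + D) (s + D) <=
      g (s + 2 * D - D / 2 ^+ k) (s + 2 * D - D / 2 ^+ k).
    elim: k => [|k IH]; first by rewrite expr0 divr1; have -> : s + 2 * D - D = s + D by ring.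
    have p0 : 0 < (2 ^+ k)^-1 :> R by rewrite invr_gt0 exprn_gt0.
    have p1 : (2 ^+ k)^-1 <= 1 :> R by rewrite invf_le1 ?exprn_gt0// exprn_ege1// ler1n.
    apply: (le_trans IH).
    have -> : s + 2 * D - D / 2 ^+ k.+1 = s + 2 * D - D / 2 ^+ k + D / 2 ^+ k / 2.
      by rewrite exprS; field; rewrite expf_neq0.
    by apply: diag_half; have [h0|h0] := leP 0 D; nra.
  apply/ler_addgt0Pr => e e0.
  have [k hk] : exists k : nat, 2 * L * `|D| / 2 ^+ k <= e.
    exists (Num.bound (2 * L * `|D| / e)).
    set k := Num.bound _.
    rewrite ler_pdivrMr ?exprn_gt0// -ler_pdivrMl// [e^-1 * _]mulrC.
    have D0 := normr_ge0 D.
    apply: (le_trans (ltW (archi_boundP _))).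
      by apply: divr_ge0; [rewrite !mulr_ge0|exact: ltW].
    have -> : 2 ^+ k = (2 ^ k)%:R :> R by rewrite natrX.
    by rewrite ler_nat ltnW// ltn_expl.
  apply: (le_trans (step k)).
  have p0 : 0 < (2 ^+ k)^-1 :> R by rewrite invr_gt0 exprn_gt0.
  have p1 : (2 ^+ k)^-1 <= 1 :> R by rewrite invf_le1 ?exprn_gt0// exprn_ege1// ler1n.
  have I1 : 0 <= s + 2 * D - D / 2 ^+ k <= 1 by have [h0|h0] := leP 0 D; nra.
  apply: (le_trans (g_lip I1 I1 Id Id)); rewrite lerD2l.
  have -> : s + 2 * D - D / 2 ^+ k - (s + 2 * D) = - (D / 2 ^+ k) by ring.
  rewrite normrN normrM (gtr0_norm p0); apply: le_trans hk.
  by lra.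
have h1 := @diag_half 0 (1 / 2) ltac:(lra) ltac:(lra).
have h2 := @diag_half 1 (- (1 / 2)) ltac:(lra) ltac:(lra).
have h3 := @main 0 (1 / 2) ltac:(lra) ltac:(lra).
have h4 := @main 1 (- (1 / 2)) ltac:(lra) ltac:(lra).
have e1 : 0 + 1 / 2 = 2^-1 :> R by field.
have e2 : 1 - 1 / 2 = 2^-1 :> R by field.
have e3 : 0 + 2 * (1 / 2) = 1 :> R by field.
have e4 : 1 + 2 * - (1 / 2) = 0 :> R by field.
by rewrite ?e1 ?e2 ?e3 ?e4 in h1 h2 h3 h4; apply/eqP; rewrite eq_le; apply/andP; split; lra.
Qed.

End RandomWalk.
Lemma in01_0 {R : realType} : (0 <= 0 :> R) && (0 <= 1 :> R).
Proof. by rewrite lexx ler01. Qed.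

Lemma in01_1 {R : realType} : (0 <= 1 :> R) && (1 <= 1 :> R).
Proof. by rewrite lexx ler01. Qed.

Lemma in01_half {R : realType} : (0 <= 2^-1 :> R) && (2^-1 <= 1 :> R).
Proof. by rewrite invr_ge0 invf_le1 ?ler0n// ler1n. Qed.

Section AffinePseudoDistance.
Context {R : realType} {I : Type} (C : (I -> R) -> Prop)
  (rho : (I -> R) -> (I -> R) -> R).
Implicit Types P Q W v w : I -> R.

Definition lerp P Q (t : R) : I -> R := fun i => P i + t * (Q i - P i).
Definition translate P (t : R) v : I -> R := fun i => P i + t * v i.

Definition convex_domain : Prop :=
  forall P Q t, C P -> C Q -> 0 <= t <= 1 -> C (lerp P Q t).

Definition affine_distance : Prop :=
  forall P Q, C P -> C Q -> linear_curve rho (lerp P Q).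

Lemma lerp0 P Q : lerp P Q 0 = P.
Proof. by apply: funext => i; rewrite /lerp mul0r addr0. Qed.

Lemma lerp1 P Q : lerp P Q 1 = Q.
Proof. by apply: funext => i; rewrite /lerp mul1r addrC subrK. Qed.

Hypothesis rho_pd : pseudo_distance rho.
Hypothesis C_convex : convex_domain.
Hypothesis rho_affine : affine_distance.

Lemma affine_distance_translate P Q W :
  C P -> C Q -> C (translate P 1 W) -> C (translate Q 1 W) ->
  rho P Q = rho (translate P 1 W) (translate Q 1 W).
Proof.
move=> CP CQ CP1 CQ1.
pose p a := lerp P (translate P 1 W) a; pose q b := lerp Q (translate Q 1 W) b.
have Cp (a : R) : 0 <= a <= 1 -> C (p a) by exact: C_convex.
have Cq (b : R) : 0 <= b <= 1 -> C (q b) by exact: C_convex.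
have rp (a a' : R) : 0 <= a <= 1 -> 0 <= a' <= 1 ->
    rho (p a) (p a') = `|a - a'| * rho P (translate P 1 W).
  by move=> Ia Ia'; rewrite (rho_affine CP CP1)// lerp0 lerp1.
have rq (a a' : R) : 0 <= a <= 1 -> 0 <= a' <= 1 ->
    rho (q a) (q a') = `|a - a'| * rho Q (translate Q 1 W).
  by move=> Ia Ia'; rewrite (rho_affine CQ CQ1)// lerp0 lerp1.
pose L := rho P (translate P 1 W) + rho Q (translate Q 1 W).
have r1 := pd_ge0 rho_pd P (translate P 1 W).
have r2 := pd_ge0 rho_pd Q (translate Q 1 W).
suff : rho (p 0) (q 0) = rho (p 1) (q 1) by rewrite /p /q !lerp0 !lerp1.
apply: (@diag_const R (fun a b => rho (p a) (q b)) L) => /=; last by rewrite addr_ge0.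
- move=> a b h Ia Ib Iah Ibh.
  have half := @in01_half R.
  have I0 := @in01_0 R.
  have I1 := @in01_1 R.
  have e : lerp (p a) (q (b + h)) 2^-1 = lerp (p (a + h)) (q b) 2^-1.
    by apply: funext => i; rewrite /p /q /lerp /translate; field.
  have := pd_triangle rho_pd (lerp (p a) (q (b + h)) 2^-1) (p a) (q b).
  have := rho_affine (Cp _ Ia) (Cq _ Ibh) I0 half; rewrite lerp0 lerp1 => ->.
  have := rho_affine (Cp _ Iah) (Cq _ Ib) half I1; rewrite lerp0 lerp1 -e => ->.
  rewrite sub0r normrN (gtr0_norm (x := 2^-1)) ?invr_gt0//.
  have -> : `|2^-1 - 1| = 2^-1 :> R by rewrite distrC ger0_norm; lra.
  by lra.
- move=> a b a' b' Ia Ib Ia' Ib'.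
  have := pd_triangle rho_pd (p a') (p a) (q b).
  have := pd_triangle rho_pd (q b') (p a') (q b).
  rewrite rp// rq// (distrC b').
  have := normr_ge0 (a - a'); have := normr_ge0 (b - b').
  by rewrite /L; nra.
Qed.

Variable c : I -> R.
Hypothesis C_center : forall v, exists2 e : R, 0 < e &
  forall t, `|t| <= e -> C (translate c t v).

Lemma affine_distance_seminorm : exists N : (I -> R) -> R,
  [/\ forall t v, N (fun i => t * v i) = `|t| * N v,
      forall v w, N (fun i => v i + w i) <= N v + N w &
      forall P Q, C P -> C Q -> rho P Q = N (fun i => Q i - P i)].
Proof.
have [r Hr] := choice (fun v => let: ex_intro2 e e0 He := C_center v in
  ex_intro (fun e => 0 < e /\ forall t, `|t| <= e -> C (translate c t v)) e (conj e0 He)).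
have I0 := @in01_0 R.
have I1 := @in01_1 R.
have Cc : C c.
  have [r0] := Hr c; move/(_ 0); rewrite normr0 => /(_ (ltW r0)).
  by congr C; apply: funext => i; rewrite /translate mul0r addr0.
have seg P (t : R) v (s : R) : 0 < t -> 0 <= s <= t -> C P -> C (translate P t v) ->
    C (translate P s v) /\ rho P (translate P s v) = s / t * rho P (translate P t v).
  move=> t0 Is CP CPt.
  have Ist : 0 <= s / t <= 1.
    by rewrite divr_ge0 ?ler_pdivrMr ?mul1r//; lra.
  have e : translate P s v = lerp P (translate P t v) (s / t).
    by apply: funext => i; rewrite /translate /lerp; field; rewrite gt_eqF.
  have := rho_affine CP CPt I0 Ist; rewrite -e lerp0 lerp1 sub0r normrN ger0_norm//; last by lra.
  by move=> ->; split => //; rewrite e; exact: C_convex.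
pose N v := rho c (translate c (r v) v) / r v.
have N1 (t : R) v : 0 < t -> C (translate c t v) -> rho c (translate c t v) = t * N v.
  move=> t0 Ct; have [r0 Cr] := Hr v.
  have {}Cr : C (translate c (r v) v) by apply: Cr; rewrite gtr0_norm.
  rewrite /N; have [tr|rt] := leP t (r v).
    by rewrite (seg _ (r v) _ t _ _ _ Cr).2 ?tr ?ltW//; field; rewrite gt_eqF.
  by rewrite (seg _ t _ (r v) _ _ _ Ct).2 ?(ltW rt) ?ltW//; field; rewrite !gt_eqF.
have N2 P (t : R) v : 0 < t -> C P -> C (translate P t v) -> rho P (translate P t v) = t * N v.
  move=> t0 CP CPt; have [r0 Cr] := Hr v.
  (* The step is shortened so as to stay in [C] both from [P] and from [c], since translation
     invariance compares points of [C] only. *)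
  pose s : R := Num.min t (r v).
  have s0 : 0 < s by rewrite lt_min t0.
  have st : 0 <= s <= t by rewrite ltW// ge_min lexx.
  have Cs : C (translate c s v).
    by apply: Cr; rewrite gtr0_norm// ge_min lexx orbT.
  have [CPs e] := seg _ _ _ _ t0 st CP CPt.
  have := N1 _ _ s0 Cs.
  rewrite (@affine_distance_translate c (translate c s v) (fun i => P i - c i))//.
  - have -> : translate c 1 (fun i => P i - c i) = P.
      by apply: funext => i; rewrite /translate; ring.
    have -> : translate (translate c s v) 1 (fun i => P i - c i) = translate P s v.
      by apply: funext => i; rewrite /translate; ring.
    by rewrite e => e'; apply: (mulfI (lt0r_neq0 s0)); rewrite mulrCA -e'; field; rewrite gt_eqF.
  - by move: CP; congr C; apply: funext => i; rewrite /translate; ring.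
  - by move: CPs; congr C; apply: funext => i; rewrite /translate; ring.
have tr1 P v : translate P 1 v = fun i => P i + v i.
  by apply: funext => i; rewrite /translate mul1r.
have NC P Q : C P -> C Q -> rho P Q = N (fun i => Q i - P i).
  move=> CP CQ.
  have e : translate P 1 (fun i => Q i - P i) = Q.
    by apply: funext => i; rewrite /translate; ring.
  by rewrite -{1}e N2 ?e// mul1r.
exists N; split=> // [t v|v w].
  have [q0 Cq] := Hr (fun i => t * v i).
  pose d : R := r (fun i => t * v i).
  have d0 : 0 < d by [].
  have Cd : C (translate c d (fun i => t * v i)) by apply: Cq; rewrite gtr0_norm.
  have e1 := N1 _ _ d0 Cd.
  apply: (mulfI (lt0r_neq0 d0)); rewrite -e1.
  have e2 : translate c d (fun i => t * v i) = translate c (d * t) v.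
    by apply: funext => i; rewrite /translate; ring.
  have [t0|t0|->] := ltrgt0P t.
  - rewrite e2 N1 ?mulrA// -?e2//; first exact: mulr_gt0.
  (* For [t < 0] the segment is read from its other end, along [v] with the positive length
     [- (d * t)]. *)
  - rewrite (pd_sym rho_pd).
    have e3 : c = translate (translate c (d * t) v) (- (d * t)) v.
      by apply: funext => i; rewrite /translate; ring.
    rewrite e2 {2}e3 N2 -?e3 -?e2//; first by ring.
    by rewrite -mulrN mulr_gt0// oppr_gt0.
  - rewrite mul0r mulr0; have -> : translate c d (fun i => 0 * v i) = c.
      by apply: funext => i; rewrite /translate; ring.
    exact: pd_refl.
have [r1 Cr] := Hr v; have [r2 Cs] := Hr (fun i => v i + w i).
pose d : R := Num.min (r v) (r (fun i => v i + w i)).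
have d0 : 0 < d by rewrite lt_min r1.
have C1 : C (translate c d v) by apply: Cr; rewrite gtr0_norm// ge_min lexx.
have C2 : C (translate c d (fun i => v i + w i)).
  by apply: Cs; rewrite gtr0_norm// ge_min lexx orbT.
have e : translate c d (fun i => v i + w i) = translate (translate c d v) d w.
  by apply: funext => i; rewrite /translate; ring.
have := pd_triangle rho_pd (translate c d v) c (translate c d (fun i => v i + w i)).
rewrite [in X in _ <= X]e !N2 -?e// -mulrDr.
by rewrite ler_pM2l.
Qed.

End AffinePseudoDistance.
Section Seminorm.
Context {R : realType} {I : Type}.
Implicit Types (N : (I -> R) -> R) (v w : I -> R).

Definition seminorm N : Prop :=
  (forall t v, N (fun i => t * v i) = `|t| * N v) /\
  (forall v w, N (fun i => v i + w i) <= N v + N w).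

Lemma seminorm_ge0 N v : seminorm N -> 0 <= N v.
Proof.
move=> [NZ ND]; have := ND v (fun i => (-1) * v i).
have -> : (fun i => v i + -1 * v i) = (fun i => 0 * v i).
  by apply: funext => i; ring.
by rewrite !NZ normr0 normrN1; lra.
Qed.

Lemma seminorm_add0 N v w : seminorm N -> N w = 0 -> N (fun i => v i + w i) = N v.
Proof.
move=> [NZ ND] w0.
have h1 := ND v w.
have := ND (fun i => v i + w i) (fun i => (-1) * w i).
have -> : (fun i => v i + w i + -1 * w i) = v by apply: funext => i; ring.
by rewrite NZ w0 mulr0; lra.
Qed.

End Seminorm.

(** The point [n * s] is within 1 of an integer, and on integers [a] is linear; hence [n] times the
    deviation of [a s] from [s * a 1] is bounded uniformly in [n]. *)
Lemma additive_linear {R : realType} (a : R -> R) (M : R) :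
  (forall s t, a (s + t) = a s + a t) ->
  (forall s, `|s| <= 1 -> `|a s| <= M) -> forall s, a s = s * a 1.
Proof.
move=> aD aM s.
have a0 : a 0 = 0 by have := aD 0 0; rewrite addr0; lra.
have aN x : a (- x) = - a x by have := aD x (- x); rewrite subrr a0; lra.
have an n x : a (n%:R * x) = n%:R * a x.
  elim: n => [|n IH]; first by rewrite !mul0r a0.
  by rewrite -natr1 !mulrDl !mul1r aD IH.
have az (m : int) : a m%:~R = m%:~R * a 1.
  case: m => n; first by rewrite -pmulrn -[n%:R]mulr1 an mulr1.
  by rewrite NegzE mulrNz -pmulrn -[n.+1%:R]mulr1 aN an mulr1 mulNr.
have B0 : 0 <= M + `|a 1|.
  by apply: addr_ge0 => //; apply: le_trans (aM 0 _); rewrite ?normr0.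
suff : `|a s - s * a 1| <= 0 by rewrite normr_le0 subr_eq0 => /eqP.
apply: (@archi_le0 _ _ (M + `|a 1|)) => n.
rewrite -[X in X * _]normr_nat -normrM mulrBr -an mulrA.
have := floor_itv (n%:R * s); set m := Num.floor _; set x := n%:R * s.
rewrite intrD => /andP[m1 m2].
have x1 : `|x - m%:~R| <= 1 by rewrite ger0_norm; lra.
have -> : a x - x * a 1 = a (x - m%:~R) + - ((x - m%:~R) * a 1).
  by rewrite aD aN az; ring.
apply: (le_trans (ler_normD _ _)); apply: lerD; first exact: aM.
by rewrite normrN normrM; apply: ler_piMl.
Qed.

Section QuadraticForm.
Context {R : realType}.
Local Notation I4 := (bool * bool)%type.

(** [(s, t)] locates the [Z]-component in the rectangle and [(s', t')] the [Z']-component; equal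
    pairs describe an actual point of the rectangle. A common shift of [t] and [t'] is invisible in
    [Y], a common shift of [s] and [s'] in [Y']. *)
Definition vec4 (s t s' t' : R) : I4 -> R := fun i =>
  match i with
  | (true, true) => s | (true, false) => t
  | (false, true) => s' | (false, false) => t'
  end.

Ltac vec4_eq := apply: funext => -[[] []]; rewrite /vec4 /=; ring.

Variables NY NY' NZ NZ' : (I4 -> R) -> R.
Hypotheses (NY_semi : seminorm NY) (NY'_semi : seminorm NY')
  (NZ_semi : seminorm NZ) (NZ'_semi : seminorm NZ').
Hypothesis pythagoras : forall v,
  NY v ^+ 2 + NY' v ^+ 2 = NZ v ^+ 2 + NZ' v ^+ 2.
Hypotheses (NY_0 : NY (vec4 0 1 0 1) = 0) (NY'_0 : NY' (vec4 1 0 1 0) = 0).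
Hypotheses (NZ_s : NZ (vec4 0 0 1 0) = 0) (NZ_t : NZ (vec4 0 0 0 1) = 0).
Hypotheses (NZ'_s : NZ' (vec4 1 0 0 0) = 0) (NZ'_t : NZ' (vec4 0 1 0 0) = 0).

Let E s t := NZ (vec4 s t 0 0) ^+ 2.
Let E' s t := NZ' (vec4 0 0 s t) ^+ 2.

Let add_scale (N : (I4 -> R) -> R) (v w : I4 -> R) (r : R) : seminorm N -> N w = 0 ->
  N (fun i => v i + r * w i) = N v.
Proof.
by move=> HN w0; apply: seminorm_add0 => //; rewrite HN.1 w0 mulr0.
Qed.

Let NYE s t s' t' r : NY (vec4 s (t + r) s' (t' + r)) = NY (vec4 s t s' t').
Proof.
rewrite -(add_scale (vec4 s t s' t') r NY_semi NY_0).
by congr NY; vec4_eq.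
Qed.

Let NY'E s t s' t' r : NY' (vec4 (s + r) t (s' + r) t') = NY' (vec4 s t s' t').
Proof.
rewrite -(add_scale (vec4 s t s' t') r NY'_semi NY'_0).
by congr NY'; vec4_eq.
Qed.

Let pyth s t s' t' :
  NY (vec4 s t s' t') ^+ 2 + NY' (vec4 s t s' t') ^+ 2 = E s t + E' s' t'.
Proof.
rewrite pythagoras /E /E'; congr (_ ^+ 2 + _ ^+ 2).
  rewrite -(add_scale (vec4 s t 0 0) s' NZ_semi NZ_s).
  rewrite -[RHS](add_scale _ t' NZ_semi NZ_t).
  by congr NZ; vec4_eq.
rewrite -(add_scale (vec4 0 0 s' t') s NZ'_semi NZ'_s).
rewrite -[RHS](add_scale _ t NZ'_semi NZ'_t).
by congr NZ'; vec4_eq.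
Qed.

Let a t s := E s t - E s 0 - E 0 t.

(* Subtracting the Pythagorean identity at [(s, t, s', t')] and at
   [(s, 0, s', t' - t)] leaves a function of [s - s'] on one side and a sum of
   a function of [s] and a function of [s'] on the other. *)
Let aD t s s' : a t (s + s') = a t s + a t s'.
Proof.
have key x y : E x t - E x 0 + E' y 0 - E' y (- t) =
    NY' (vec4 (x - y) t 0 0) ^+ 2 - NY' (vec4 (x - y) 0 0 (- t)) ^+ 2.
  have h1 := pyth x t y 0; have h2 := pyth x 0 y (- t).
  have := NYE x 0 y (- t) t; rewrite add0r addNr => e; rewrite e in h1.
  have e1 := NY'E (x - y) t 0 0 y; have e2 := NY'E (x - y) 0 0 (- t) y.
  rewrite subrK add0r in e1; rewrite subrK add0r in e2.
  by rewrite e1 in h1; rewrite e2 in h2; lra.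
have h1 := key (s + s') 0; have h2 := key s (- s').
have h3 := key 0 (- s'); have h4 := key s' 0.
have h5 := key 0 0.
rewrite ?subr0 ?opprK ?add0r in h1 h2 h3 h4 h5.
have E00 : E 0 0 = 0.
  rewrite /E (_ : vec4 0 0 0 0 = fun i => 0 * vec4 0 0 0 0 i).
    by rewrite NZ_semi.1 normr0 mul0r expr0n.
  by vec4_eq.
by rewrite /a; lra.
Qed.

Let E_hom r s t : E (r * s) (r * t) = r ^+ 2 * E s t.
Proof.
rewrite /E -(real_normK (num_real r)) -exprMn -NZ_semi.1.
by congr (NZ _ ^+ 2); vec4_eq.
Qed.

(** The mixed term [a t s] is additive in [s] and bounded for bounded [s], hence linear in [s];
    homogeneity of [E] on the diagonal [s = t] settles the dependence on [t]. *)
Lemma NZ_quadratic : exists q : R, forall s t,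
  E s t = s ^+ 2 * E 1 0 + t ^+ 2 * E 0 1 + s * t * q.
Proof.
have a_lin t s : a t s = s * a t 1.
  pose n1 := NZ (vec4 1 0 0 0); pose n2 := NZ (vec4 0 t 0 0).
  apply: (@additive_linear _ (a t) (2 * n1 * n2 + 2 * n2 ^+ 2)) => // x x1.
  have ns : NZ (vec4 x 0 0 0) = `|x| * n1.
    by rewrite -NZ_semi.1; congr NZ; vec4_eq.
  have h1 := NZ_semi.2 (vec4 x 0 0 0) (vec4 0 t 0 0).
  have -> : a t x = NZ (vec4 x t 0 0) ^+ 2 - NZ (vec4 x 0 0 0) ^+ 2 - n2 ^+ 2 by [].
  have h2 := NZ_semi.2 (vec4 x t 0 0) (fun i => (-1) * vec4 0 t 0 0 i).
  rewrite NZ_semi.1 normrN1 mul1r in h2.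
  have e1 : (fun i => vec4 x 0 0 0 i + vec4 0 t 0 0 i) = vec4 x t 0 0 by vec4_eq.
  have e2 : (fun i => vec4 x t 0 0 i + -1 * vec4 0 t 0 0 i) = vec4 x 0 0 0 by vec4_eq.
  rewrite e1 in h1; rewrite e2 in h2.
  have p1 := seminorm_ge0 (vec4 1 0 0 0) NZ_semi.
  have p2 := seminorm_ge0 (vec4 0 t 0 0) NZ_semi.
  have p3 := seminorm_ge0 (vec4 x t 0 0) NZ_semi.
  have p4 := seminorm_ge0 (vec4 x 0 0 0) NZ_semi.
  rewrite -/n1 -/n2 in p1 p2 h1 h2.
  have x2 : NZ (vec4 x 0 0 0) <= n1 by rewrite ns; apply: ler_piMl.
  rewrite ler_norml; apply/andP; split; nra.
have a_t t : a t 1 = t * a 1 1.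
  have [->|t0] := eqVneq t 0.
    by rewrite mul0r; have := a_lin 0 0; rewrite /a subrr sub0r mul0r => h;
       have := aD 0 1 0; rewrite addr0 /a subrr; lra.
  apply: (mulfI t0); rewrite -(a_lin t t) mulrA -expr2 /a.
  have := E_hom t 1 1; have := E_hom t 1 0; have := E_hom t 0 1.
  by rewrite !mulr1 !mulr0 => -> -> ->; ring.
exists (a 1 1) => s t.
have := a_lin t s; rewrite a_t /a.
have := E_hom s 1 0; have := E_hom t 0 1.
rewrite !mulr1 !mulr0 => -> -> h.
have -> : s * t * (E 1 1 - E 1 0 - E 0 1) = s * (t * (E 1 1 - E 1 0 - E 0 1)) by ring.
by rewrite -h; ring.
Qed.

End QuadraticForm.
(** * Splittings and flat rectangles *)

Definition corner {R : realType} {T : Type} (d1 d2 : T -> T -> R)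
    (w x y : T) : Prop := d1 w x = 0 /\ d2 w y = 0.

(* A direct product decomposition of the pseudo-metric space [(T, d)] into two
   factors, encoded by the pullbacks of the two factor distances. *)
Definition splitting {R : realType} {T : Type} (d d1 d2 : T -> T -> R) : Prop :=
  [/\ pseudo_distance d1, pseudo_distance d2,
      forall x y, d x y ^+ 2 = d1 x y ^+ 2 + d2 x y ^+ 2 &
      forall x y, exists w, corner d1 d2 w x y].

Section LinearCurves.
Context {R : realType} {T : Type} (d d1 d2 : T -> T -> R).
Hypotheses (d_pd : pseudo_distance d) (d1_pd : pseudo_distance d1)
  (d2_pd : pseudo_distance d2).
Hypothesis d_sq : forall x y, d x y ^+ 2 = d1 x y ^+ 2 + d2 x y ^+ 2.

Lemma linear_curve_comb (g : R -> T) :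
  linear_curve d1 g -> linear_curve d2 g -> linear_curve d g.
Proof.
move=> l1 l2 s t Is It; apply: squaresI.
- exact: pd_ge0.
- by rewrite mulr_ge0// pd_ge0.
- by rewrite exprMn !d_sq l1// l2// !exprMn; ring.
Qed.

(* Equality case of Minkowski's inequality: with [a], [b] the factor lengths of
   the three subsegments and [A], [B] those of the whole curve, each
   [(a, b)] must be the multiple of [(A, B)] prescribed by its length. *)
Lemma linear_curve_split (g : R -> T) :
  linear_curve d g -> linear_curve d1 g.
Proof.
move=> lin.
have main s t : 0 <= s -> s <= t -> t <= 1 ->
    d1 (g s) (g t) = (t - s) * d1 (g 0) (g 1).
  move=> s0 st t1.
  pose c := d (g 0) (g 1); pose A := d1 (g 0) (g 1); pose B := d2 (g 0) (g 1).
  have cE : c ^+ 2 = A ^+ 2 + B ^+ 2 by exact: d_sq.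
  have piece u v : 0 <= u -> u <= v -> v <= 1 ->
      d1 (g u) (g v) ^+ 2 + d2 (g u) (g v) ^+ 2 = (v - u) ^+ 2 * c ^+ 2.
    move=> u0 uv v1; rewrite -d_sq lin; [|lra|lra].
    by rewrite exprMn real_normK ?num_real// -/c; ring.
  have cs u v : 0 <= u -> u <= v -> v <= 1 ->
      A * d1 (g u) (g v) + B * d2 (g u) (g v) <= (v - u) * c ^+ 2.
    move=> u0 uv v1; have := piece u v u0 uv v1.
    set a := d1 _ _; set b := d2 _ _ => ab.
    have h1 := sqr_ge0 (a - (v - u) * A); have h2 := sqr_ge0 (b - (v - u) * B).
    have [uv0|uv0] := eqVneq (v - u) 0.
      move: ab; rewrite uv0 expr0n/= mul0r => ab.
      have a0 : a = 0 by apply: sq_eq0; have := sqr_ge0 a; have := sqr_ge0 b; lra.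
      have b0 : b = 0 by apply: sq_eq0; have := sqr_ge0 a; have := sqr_ge0 b; lra.
      by rewrite a0 b0 ?mul0r !mulr0 addr0.
    have vu : 0 < v - u by rewrite lt_neqAle eq_sym uv0; lra.
    rewrite -(ler_pM2l vu).
    have e : (v - u) * ((v - u) * c ^+ 2) = (v - u) ^+ 2 * (A ^+ 2 + B ^+ 2).
      by rewrite cE; ring.
    rewrite e; rewrite cE in ab.
    by move: h1 h2 ab; rewrite !sqrrB; nra.
  have A0 : 0 <= A by exact: pd_ge0.
  have B0 : 0 <= B by exact: pd_ge0.
  have tri (rho : T -> T -> R) : pseudo_distance rho ->
      rho (g 0) (g 1) <= rho (g 0) (g s) + rho (g s) (g t) + rho (g t) (g 1).
    move=> rho_pd; have := pd_triangle rho_pd (g t) (g 0) (g 1).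
    by have := pd_triangle rho_pd (g s) (g 0) (g t); lra.
  have t1' := ler_wpM2l A0 (tri _ d1_pd); have t2' := ler_wpM2l B0 (tri _ d2_pd).
  have c1 := cs 0 s ltac:(lra) ltac:(lra) ltac:(lra).
  have c2 := cs s t ltac:(lra) ltac:(lra) ltac:(lra).
  have c3 := cs t 1 ltac:(lra) ltac:(lra) ltac:(lra).
  have p2 := piece s t ltac:(lra) ltac:(lra) ltac:(lra).
  rewrite -/A -/B in t1' t2'; rewrite -/A.
  move: c1 c2 c3 p2 t1' t2'.
  set a := d1 (g s) (g t); set b := d2 (g s) (g t) => c1 c2 c3 p2 t1' t2'.
  (* [c1], [c2], [c3] bound a sum by [c ^+ 2], and the triangle inequality bounds the same sum below
     by [A ^+ 2 + B ^+ 2], which is [c ^+ 2]. So [c2] is an equality. *)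
  have e2 : A * a + B * b = (t - s) * c ^+ 2.
    by apply/eqP; rewrite eq_le c2/=; move: c1 c3 t1' t2'; rewrite cE; lra.
  have : (a - (t - s) * A) ^+ 2 + (b - (t - s) * B) ^+ 2 = 0.
    have -> : (a - (t - s) * A) ^+ 2 + (b - (t - s) * B) ^+ 2 =
      (a ^+ 2 + b ^+ 2) - 2 * (t - s) * (A * a + B * b) +
      (t - s) ^+ 2 * (A ^+ 2 + B ^+ 2) by ring.
    by rewrite p2 e2 -cE; ring.
  have h1 := sqr_ge0 (a - (t - s) * A); have h2 := sqr_ge0 (b - (t - s) * B) => h.
  have : a - (t - s) * A = 0 by apply: sq_eq0; lra.
  by lra.
move=> s t /andP[s0 s1] /andP[t0 t1]; have [st|ts] := leP s t.
  by rewrite main// distrC ger0_norm// subr_ge0.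
by rewrite (pd_sym d1_pd) main// ?(ltW ts)// ger0_norm// subr_ge0 ltW.
Qed.

End LinearCurves.

Definition geodesic_pd {R : realType} {T : Type} (d : T -> T -> R) : Prop :=
  forall x y, exists g : R -> T, [/\ linear_curve d g, g 0 = x & g 1 = y].

Section Splitting.
Context {R : realType} {T : Type} (d : T -> T -> R).
Hypothesis d_pd : pseudo_distance d.

Lemma splittingC d1 d2 : splitting d d1 d2 -> splitting d d2 d1.
Proof.
case=> p1 p2 sq mix; split=> // [x y|x y]; first by rewrite addrC.
by have [w [w1 w2]] := mix y x; exists w.
Qed.

Lemma splitting_linear d1 d2 g : splitting d d1 d2 -> linear_curve d g ->
  linear_curve d1 g /\ linear_curve d2 g.
Proof.
move=> [p1 p2 sq _] lin; split.
  exact: (linear_curve_split p1 p2 sq).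
by apply: (linear_curve_split (d := d) p2 p1) => // x y; rewrite addrC.
Qed.

Lemma splitting_eq0 d1 d2 x y : splitting d d1 d2 -> d x y = 0 ->
  d1 x y = 0 /\ d2 x y = 0.
Proof. by case=> _ _ sq _; exact: pd_eq0P. Qed.

Lemma splitting_0 d1 d2 x y : splitting d d1 d2 ->
  d1 x y = 0 -> d2 x y = 0 -> d x y = 0.
Proof.
by case=> _ _ sq _ e1 e2; apply: sq_eq0; rewrite sq e1 e2 expr0n addr0.
Qed.

Lemma splitting_fun d1 d2 : splitting d d1 d2 ->
  exists m : T -> T -> T, forall x y, corner d1 d2 (m x y) x y.
Proof.
case=> _ _ _ mix; have [f Hf] := choice (fun p => mix p.1 p.2).
by exists (fun x y => f (x, y)) => x y; have := Hf (x, y).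
Qed.

End Splitting.
Section Rectangle.
Context {R : realType} {T : Type} (d dY dY' dZ dZ' : T -> T -> R).
Hypothesis d_pd : pseudo_distance d.
Hypotheses (splitY : splitting d dY dY') (splitZ : splitting d dZ dZ').
Hypothesis d_geo : geodesic_pd d.

Definition cube (v : bool * bool -> R) : Prop := forall i, 0 <= v i <= 1.

Lemma cube_convex : convex_domain cube.
Proof.
move=> P Q t CP CQ It i; rewrite /lerp.
by have := CP i; have := CQ i; move=> *; nra.
Qed.

Lemma cube_center v : exists2 e : R, 0 < e &
  forall t, `|t| <= e -> cube (translate (fun=> 2^-1) t v).
Proof.
pose M := 1 + `|v (true, true)| + `|v (true, false)| + `|v (false, true)| +
  `|v (false, false)|.
have n1 := normr_ge0 (v (true, true)); have n2 := normr_ge0 (v (true, false)).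
have n3 := normr_ge0 (v (false, true)); have n4 := normr_ge0 (v (false, false)).
have M0 : 0 < M by rewrite /M; lra.
exists (2^-1 / M) => [|t]; first by rewrite divr_gt0.
rewrite ler_pdivlMr// => tM i; rewrite /translate.
have vM : `|v i| <= M by rewrite /M; case: i => -[] []; lra.
have : `|t * v i| <= 2^-1.
  by rewrite normrM; apply: le_trans tM; apply: ler_wpM2l.
by rewrite ler_norml => /andP[h1 h2]; lra.
Qed.

Section Grid.
Variables (x x1 x2 : T) (gam eta : R -> T) (mY mZ : T -> T -> T).
Hypotheses (x_x1 : dY' x x1 = 0) (x_x2 : dY x x2 = 0).
Hypotheses (gam_lin : linear_curve d gam) (gam0 : gam 0 = x) (gam1 : gam 1 = x1).
Hypotheses (eta_lin : linear_curve d eta) (eta0 : eta 0 = x) (eta1 : eta 1 = x2).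
Hypotheses (mYP : forall u v, corner dY dY' (mY u v) u v)
  (mZP : forall u v, corner dZ dZ' (mZ u v) u v).

Let Y_pd : pseudo_distance dY. Proof. by case: splitY. Qed.
Let Y'_pd : pseudo_distance dY'. Proof. by case: splitY. Qed.
Let Z_pd : pseudo_distance dZ. Proof. by case: splitZ. Qed.
Let Z'_pd : pseudo_distance dZ'. Proof. by case: splitZ. Qed.

Definition grid (s t : R) : T := mY (gam s) (eta t).

(* The two components of a grid point may be displaced independently; the
   resulting four-parameter family still maps segments to linear curves. *)
Definition grid2 (v : bool * bool -> R) : T :=
  mZ (grid (v (true, true)) (v (true, false))) (grid (v (false, true)) (v (false, false))).

Lemma grid_Y s t s' t' : dY (grid s t) (grid s' t') = dY (gam s) (gam s').
Proof.
by rewrite (pd_congl Y_pd _ (mYP _ _).1) (pd_congr Y_pd _ (mYP _ _).1).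
Qed.

Lemma grid_Y' s t s' t' : dY' (grid s t) (grid s' t') = dY' (eta t) (eta t').
Proof.
by rewrite (pd_congl Y'_pd _ (mYP _ _).2) (pd_congr Y'_pd _ (mYP _ _).2).
Qed.

Lemma grid_Z v w : dZ (grid2 v) (grid2 w) =
  dZ (grid (v (true, true)) (v (true, false))) (grid (w (true, true)) (w (true, false))).
Proof.
by rewrite (pd_congl Z_pd _ (mZP _ _).1) (pd_congr Z_pd _ (mZP _ _).1).
Qed.

Lemma grid_Z' v w : dZ' (grid2 v) (grid2 w) =
  dZ' (grid (v (false, true)) (v (false, false))) (grid (w (false, true)) (w (false, false))).
Proof.
by rewrite (pd_congl Z'_pd _ (mZP _ _).2) (pd_congr Z'_pd _ (mZP _ _).2).
Qed.

(** The indices [i], [j] are free so that the statement serves both the [Z]-pair and the [Z']-pair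
    of parameters. *)
Lemma grid_linear i j P Q : cube P -> cube Q ->
  linear_curve d (fun t => grid (lerp P Q t i) (lerp P Q t j)).
Proof.
move=> CP CQ.
have C t : 0 <= t <= 1 -> cube (lerp P Q t) by exact: cube_convex.
have CPQ0 : cube (lerp P Q 0) by rewrite lerp0.
have CPQ1 : cube (lerp P Q 1) by rewrite lerp1.
have [_ _ sq _] := splitY.
apply: (linear_curve_comb d_pd sq) => s t Is It.
  rewrite !grid_Y; have lin := (splitting_linear splitY gam_lin).1.
  rewrite (lin _ _ (C _ Is i) (C _ It i)) (lin _ _ (CPQ0 i) (CPQ1 i)).
  rewrite mulrA -normrM -[X in _ = X * _]normrN; congr (`|_| * _); rewrite /lerp; ring.
rewrite !grid_Y'; have lin := (splitting_linear splitY eta_lin).2.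
rewrite (lin _ _ (C _ Is j) (C _ It j)) (lin _ _ (CPQ0 j) (CPQ1 j)).
rewrite mulrA -normrM -[X in _ = X * _]normrN; congr (`|_| * _); rewrite /lerp; ring.
Qed.

Lemma grid2_Z_affine : affine_distance cube (fun v w => dZ (grid2 v) (grid2 w)).
Proof.
move=> P Q CP CQ s t Is It; rewrite !grid_Z.
exact: (splitting_linear splitZ (grid_linear (true, true) (true, false) CP CQ)).1.
Qed.

Lemma grid2_Z'_affine : affine_distance cube (fun v w => dZ' (grid2 v) (grid2 w)).
Proof.
move=> P Q CP CQ s t Is It; rewrite !grid_Z'.
exact: (splitting_linear splitZ (grid_linear (false, true) (false, false) CP CQ)).2.
Qed.

Lemma grid2_linear P Q : cube P -> cube Q ->
  linear_curve d (fun t => grid2 (lerp P Q t)).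
Proof.
move=> CP CQ; have [_ _ sq _] := splitZ.
apply: (linear_curve_comb d_pd sq) => s t.
  exact: grid2_Z_affine.
exact: grid2_Z'_affine.
Qed.

Lemma grid2_Y_affine : affine_distance cube (fun v w => dY (grid2 v) (grid2 w)).
Proof.
move=> P Q CP CQ s t Is It.
exact: (splitting_linear splitY (grid2_linear CP CQ)).1.
Qed.

Lemma grid2_Y'_affine : affine_distance cube (fun v w => dY' (grid2 v) (grid2 w)).
Proof.
move=> P Q CP CQ s t Is It.
exact: (splitting_linear splitY (grid2_linear CP CQ)).2.
Qed.

Lemma grid2_diag (s t : R) : d (grid2 (vec4 s t s t)) (grid s t) = 0.
Proof.
by apply: (splitting_0 splitZ); [exact: (mZP _ _).1|exact: (mZP _ _).2].
Qed.

(** [N] belongs to [dZ] and [N'] to [dY']. All four pseudo-distances are affine along [grid2], hence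
    come from seminorms, and these meet the hypotheses of [NZ_quadratic]. *)
Lemma grid_seminorm : exists N N' : (bool * bool -> R) -> R, exists q : R,
  [/\ seminorm N,
      forall s t s' t' : R, 0 <= s <= 1 -> 0 <= t <= 1 -> 0 <= s' <= 1 -> 0 <= t' <= 1 ->
        dZ (grid s t) (grid s' t') = N (vec4 (s' - s) (t' - t) 0 0),
      forall s t : R, N (vec4 s t 0 0) ^+ 2 = s ^+ 2 * N (vec4 1 0 0 0) ^+ 2 +
        t ^+ 2 * N (vec4 0 1 0 0) ^+ 2 + s * t * q,
      N' (vec4 1 0 1 0) = 0 &
      forall P Q, cube P -> cube Q -> dY' (grid2 P) (grid2 Q) = N' (fun i => Q i - P i)].
Proof.
have sem (rho : T -> T -> R) (rho_pd : pseudo_distance rho) aff :=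
  affine_distance_seminorm (pd_pullback grid2 rho_pd) cube_convex aff cube_center.
have [NY [Y1 Y2 YE]] := sem _ Y_pd grid2_Y_affine.
have [NY' [Y'1 Y'2 Y'E]] := sem _ Y'_pd grid2_Y'_affine.
have [NZ [Z1 Z2 ZE]] := sem _ Z_pd grid2_Z_affine.
have [NZ' [Z'1 Z'2 Z'E]] := sem _ Z'_pd grid2_Z'_affine.
have I0 := @in01_0 R; have I1 := @in01_1 R.
have Cv (s t s' t' : R) : 0 <= s <= 1 -> 0 <= t <= 1 -> 0 <= s' <= 1 -> 0 <= t' <= 1 ->
    cube (vec4 s t s' t') by move=> ? ? ? ? [[] []].
have veq (f : bool * bool -> R) s t s' t' : f (true, true) = s ->
    f (true, false) = t -> f (false, true) = s' -> f (false, false) = t' ->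
    f = vec4 s t s' t'.
  by move=> e1 e2 e3 e4; apply: funext => -[[] []].
have [_ _ sqY _] := splitY; have [_ _ sqZ _] := splitZ.
(* A small multiple of any [v] is a difference of two points of the cube, where the identity is
   known; both sides are homogeneous of degree 2. *)
have pyth v : NY v ^+ 2 + NY' v ^+ 2 = NZ v ^+ 2 + NZ' v ^+ 2.
  have [e e0 He] := cube_center v.
  have C0 : cube (fun=> 2^-1) by move=> i; exact: in01_half.
  have C1 : cube (translate (fun=> 2^-1) e v) by apply: He; rewrite gtr0_norm.
  have eq : (fun i => translate (fun=> 2^-1) e v i - 2^-1) = (fun i => e * v i).
    by apply: funext => i; rewrite /translate; ring.
  have := sqY (grid2 (fun=> 2^-1)) (grid2 (translate (fun=> 2^-1) e v)).
  rewrite sqZ YE// Y'E// ZE// Z'E// eq Y1 Y'1 Z1 Z'1 !exprMn -!mulrDr => h.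
  have ne : `|e| ^+ 2 != 0 by rewrite sqrf_eq0 normr_eq0 gt_eqF.
  exact: (mulfI ne (esym h)).
have diag (rho : T -> T -> R) s t s' t' : pseudo_distance rho ->
    (forall a b, d a b = 0 -> rho a b = 0) ->
    rho (grid2 (vec4 s t s t)) (grid2 (vec4 s' t' s' t')) = rho (grid s t) (grid s' t').
  move=> rho_pd d0.
  by rewrite (pd_congl rho_pd _ (d0 _ _ (grid2_diag _ _)))
     (pd_congr rho_pd _ (d0 _ _ (grid2_diag _ _))).
have NY0 : NY (vec4 0 1 0 1) = 0.
  have <- : (fun i => vec4 0 1 0 1 i - vec4 0 0 0 0 i) = vec4 0 1 0 1 :> (_ -> R).
    by apply: veq; rewrite /= ?subr0.
  rewrite -YE; [|exact: Cv|exact: Cv].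
  rewrite diag// ?grid_Y ?pd_refl// => a b /(splitting_eq0 splitY)[]//.
have NY'0 : NY' (vec4 1 0 1 0) = 0.
  have <- : (fun i => vec4 1 0 1 0 i - vec4 0 0 0 0 i) = vec4 1 0 1 0 :> (_ -> R).
    by apply: veq; rewrite /= ?subr0.
  rewrite -Y'E; [|exact: Cv|exact: Cv].
  rewrite diag// ?grid_Y' ?pd_refl// => a b /(splitting_eq0 splitY)[]//.
have ZE' (s t s' t' u v u' v' : R) : 0 <= s <= 1 -> 0 <= t <= 1 -> 0 <= s' <= 1 -> 0 <= t' <= 1 ->
    0 <= u <= 1 -> 0 <= v <= 1 -> 0 <= u' <= 1 -> 0 <= v' <= 1 ->
    dZ (grid s t) (grid s' t') = NZ (vec4 (s' - s) (t' - t) (u' - u) (v' - v)).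
  move=> *; have := ZE (vec4 s t u v) (vec4 s' t' u' v').
  rewrite grid_Z => ->; [|exact: Cv|exact: Cv].
  by congr NZ; exact: veq.
have Z'E' (s t s' t' u v u' v' : R) : 0 <= s <= 1 -> 0 <= t <= 1 -> 0 <= s' <= 1 -> 0 <= t' <= 1 ->
    0 <= u <= 1 -> 0 <= v <= 1 -> 0 <= u' <= 1 -> 0 <= v' <= 1 ->
    dZ' (grid s t) (grid s' t') = NZ' (vec4 (u' - u) (v' - v) (s' - s) (t' - t)).
  move=> *; have := Z'E (vec4 u v s t) (vec4 u' v' s' t').
  rewrite grid_Z' => ->; [|exact: Cv|exact: Cv].
  by congr NZ'; exact: veq.
have Z_s : NZ (vec4 0 0 1 0) = 0.
  by have := ZE' 0 0 0 0 0 0 1 0 I0 I0 I0 I0 I0 I0 I1 I0; rewrite !subr0 (pd_refl Z_pd).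
have Z_t : NZ (vec4 0 0 0 1) = 0.
  by have := ZE' 0 0 0 0 0 0 0 1 I0 I0 I0 I0 I0 I0 I0 I1; rewrite !subr0 (pd_refl Z_pd).
have Z'_s : NZ' (vec4 1 0 0 0) = 0.
  by have := Z'E' 0 0 0 0 0 0 1 0 I0 I0 I0 I0 I0 I0 I1 I0; rewrite !subr0 (pd_refl Z'_pd).
have Z'_t : NZ' (vec4 0 1 0 0) = 0.
  by have := Z'E' 0 0 0 0 0 0 0 1 I0 I0 I0 I0 I0 I0 I0 I1; rewrite !subr0 (pd_refl Z'_pd).
have [q Hq] := NZ_quadratic (conj Y1 Y2) (conj Y'1 Y'2) (conj Z1 Z2) (conj Z'1 Z'2)
  pyth NY0 NY'0 Z_s Z_t Z'_s Z'_t.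
exists NZ, NY', q; split=> // s t s' t' Is It Is' It'.
by rewrite (ZE' _ _ _ _ 0 0 0 0)// subrr.
Qed.

End Grid.

(* The affine map from a flat rectangle to the product of its projections is
   translation invariant, and its squared components are quadratic forms. *)
Lemma rectangle x x1 x2 x12 : dY' x x1 = 0 -> dY x x2 = 0 ->
  corner dY dY' x12 x1 x2 ->
  [/\ dZ x2 x12 = dZ x x1, dZ x1 x12 = dZ x x2,
      dZ x1 x2 ^+ 2 + dZ x x12 ^+ 2 = 2 * dZ x x1 ^+ 2 + 2 * dZ x x2 ^+ 2,
      forall w w1, corner dZ dZ' w x2 x -> corner dZ dZ' w1 x12 x1 -> dY' w w1 = 0 &
      forall (eta : R -> T) (t : R) y, linear_curve d eta -> eta 0 = x -> eta 1 = x2 ->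
        0 <= t <= 1 -> corner dY dY' y x1 (eta t) ->
        dZ x y ^+ 2 = dZ x x1 ^+ 2 + t ^+ 2 * dZ x x2 ^+ 2 +
          t * (dZ x x12 ^+ 2 - dZ x x1 ^+ 2 - dZ x x2 ^+ 2)].
Proof.
move=> x_x1 x_x2 c12.
have [mY mYP] := splitting_fun splitY; have [mZ mZP] := splitting_fun splitZ.
have [gam [gam_lin gam0 gam1]] := d_geo x x1.
have [_ _ sqY _] := splitY.
have [Y_pd Y'_pd _ _] := splitY; have [Z_pd Z'_pd _ _] := splitZ.
have I0 := @in01_0 R; have I1 := @in01_1 R.
(* [gam] is fixed but [eta] stays arbitrary, because the last claim concerns every linear curve from
   [x] to [x2]. *)
have main (eta : R -> T) : linear_curve d eta -> eta 0 = x -> eta 1 = x2 ->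
  exists N N' : (bool * bool -> R) -> R, exists q : R,
  [/\ seminorm N,
      forall s t : R, N (vec4 s t 0 0) ^+ 2 = s ^+ 2 * N (vec4 1 0 0 0) ^+ 2 +
        t ^+ 2 * N (vec4 0 1 0 0) ^+ 2 + s * t * q,
      dZ x x1 = N (vec4 1 0 0 0) /\ dZ x2 x12 = N (vec4 1 0 0 0),
      dZ x x2 = N (vec4 0 1 0 0) /\ dZ x1 x12 = N (vec4 0 1 0 0) &
      [/\ dZ x1 x2 = N (vec4 (-1) 1 0 0), dZ x x12 = N (vec4 1 1 0 0),
      forall (t : R) y, 0 <= t <= 1 -> corner dY dY' y x1 (eta t) ->
        dZ x y = N (vec4 1 t 0 0) &
      forall w w1, corner dZ dZ' w x2 x -> corner dZ dZ' w1 x12 x1 -> dY' w w1 = 0]].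
  move=> eta_lin eta0 eta1.
  have [N [N' [q [semi NE quad N'0 N'E]]]] := grid_seminorm gam_lin eta_lin mYP mZP.
  have g_eq (s t : R) y : corner dY dY' y (gam s) (eta t) -> d (grid gam eta mY s t) y = 0.
    move=> [e1 e2]; apply: (splitting_0 splitY).
      by rewrite /grid (pd_congl Y_pd _ (mYP _ _).1) (pd_sym Y_pd).
    by rewrite /grid (pd_congl Y'_pd _ (mYP _ _).2) (pd_sym Y'_pd).
  have e00 : d (grid gam eta mY 0 0) x = 0.
    by apply: g_eq; rewrite gam0 eta0; split; exact: pd_refl.
  have e10 : d (grid gam eta mY 1 0) x1 = 0.
    apply: g_eq; rewrite gam1 eta0; split; first exact: pd_refl.
    by rewrite (pd_sym Y'_pd).
  have e01 : d (grid gam eta mY 0 1) x2 = 0.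
    apply: g_eq; rewrite gam0 eta1; split; last exact: pd_refl.
    by rewrite (pd_sym Y_pd).
  have e11 : d (grid gam eta mY 1 1) x12 = 0 by apply: g_eq; rewrite gam1 eta1.
  have Zeq a a' b b' : d a a' = 0 -> d b b' = 0 -> dZ a b = dZ a' b'.
    move=> /(splitting_eq0 splitZ)[ea _] /(splitting_eq0 splitZ)[eb _].
    by rewrite (pd_congl Z_pd _ ea) (pd_congr Z_pd _ eb).
  exists N, N', q; split=> //.
  - split.
      by rewrite -(Zeq _ _ _ _ e00 e10) NE// !subr0.
    by rewrite -(Zeq _ _ _ _ e01 e11) NE// subr0 subrr.
  - split.
      by rewrite -(Zeq _ _ _ _ e00 e01) NE// !subr0.
    by rewrite -(Zeq _ _ _ _ e10 e11) NE// subr0 subrr.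
  split.
  - by rewrite -(Zeq _ _ _ _ e10 e01) NE// subr0 sub0r.
  - by rewrite -(Zeq _ _ _ _ e00 e11) NE// !subr0.
  - move=> t y It Hy; have e := g_eq 1 t y; rewrite gam1 in e.
    by rewrite -(Zeq _ _ _ _ e00 (e Hy)) NE// !subr0.
  move=> w w1 [w_2 w_0] [w1_12 w1_1].
  (* [P] has the [Z]-component of [x2] and the [Z']-component of [x], and [Q] those of [x12] and
     [x1]; [Q - P] is the vector [(1, 0, 1, 0)], on which [N'] vanishes. *)
  pose P : bool * bool -> R := vec4 0 1 0 0; pose Q : bool * bool -> R := vec4 1 1 1 0.
  have eP : d (grid2 gam eta mY mZ P) w = 0.
    apply: (splitting_0 splitZ); rewrite /grid2 /=.
      rewrite (pd_congl Z_pd _ (mZP _ _).1) (pd_congr Z_pd _ w_2).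
      by rewrite (splitting_eq0 splitZ e01).1.
    rewrite (pd_congl Z'_pd _ (mZP _ _).2) (pd_congr Z'_pd _ w_0).
    by rewrite (splitting_eq0 splitZ e00).2.
  have eQ : d (grid2 gam eta mY mZ Q) w1 = 0.
    apply: (splitting_0 splitZ); rewrite /grid2 /=.
      rewrite (pd_congl Z_pd _ (mZP _ _).1) (pd_congr Z_pd _ w1_12).
      by rewrite (splitting_eq0 splitZ e11).1.
    rewrite (pd_congl Z'_pd _ (mZP _ _).2) (pd_congr Z'_pd _ w1_1).
    by rewrite (splitting_eq0 splitZ e10).2.
  rewrite -(pd_congl Y'_pd _ (splitting_eq0 splitY eP).2).
  rewrite -(pd_congr Y'_pd _ (splitting_eq0 splitY eQ).2).
  rewrite N'E; [|by move=> -[[] []]|by move=> -[[] []]].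
  rewrite -[RHS]N'0; congr N'; apply: funext => -[[] []] /=; rewrite ?subr0 ?subrr//.
have [eta [eta_lin eta0 eta1]] := d_geo x x2.
have [N [N' [q [semi quad [h1 h2] [h3 h4] [h5 h6 h7 h8]]]]] := main _ eta_lin eta0 eta1.
split; try congruence.
- by rewrite h5 h6 h1 h3 quad (quad 1 1); ring.
- exact: h8.
move=> {eta eta_lin eta0 eta1 N N' q semi quad h1 h2 h3 h4 h5 h6 h7 h8}.
move=> eta t y eta_lin eta0 eta1 It Hy.
have [N [N' [q [semi quad [h1 h2] [h3 h4] [h5 h6 h7 h8]]]]] := main _ eta_lin eta0 eta1.
by rewrite (h7 t y It Hy) h6 h1 h3 quad (quad 1 1); ring.
Qed.

End Rectangle.
(** * Translations and line factors *)

Section TranslationFlow.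
Context {R : realType} {T : Type} (rho b : T -> T -> R) (c : R).
Hypothesis rho_pd : pseudo_distance rho.
Hypothesis b_anti : forall p q, b p q = - b q p.
Hypothesis c_gt0 : 0 < c.

(** The law of cosines for a motion by [c * t] along a line factor, with [b p q] equal to [2 * c]
    times the difference of the line coordinates of [q] and [p]. *)
Definition translation (t : R) (S : T -> T) : Prop :=
  forall p q, rho p (S q) ^+ 2 = rho p q ^+ 2 + c ^+ 2 * t ^+ 2 + t * b p q.

Hypothesis flow : forall t : R, 0 <= t <= 1 ->
  (exists S, translation t S) /\ (exists S, translation (- t) S).

Let bxx q : b q q = 0.
Proof. by have := b_anti q q; lra. Qed.

(** The definition at [p := q] gives [rho q (S q) ^+ 2]; at [p := S q] its left side is 0. *)
Lemma translation_b t S q : t != 0 -> translation t S -> b q (S q) = 2 * c ^+ 2 * t.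
Proof.
move=> t0 HS; have h1 := HS (S q) q; have h2 := HS q q.
rewrite pd_refl// expr0n/= in h1; rewrite pd_refl// bxx expr0n/= mulr0 add0r addr0 in h2.
rewrite (pd_sym rho_pd) h2 b_anti in h1.
by apply: (mulfI t0); move: h1; lra.
Qed.

Section Iterates.
Variables (S S' : T -> T).
Hypotheses (HS : translation 1 S) (HS' : translation (- 1) S').

Let SK p q : rho p (S' (S q)) = rho p q.
Proof.
have e : rho q (S' (S q)) = 0.
  apply: sq_eq0; rewrite HS' HS (translation_b _ _ HS) ?oner_eq0// pd_refl//.
  by rewrite bxx; ring.
by rewrite -(pd_congr rho_pd _ e).
Qed.

(** [S] and its inverse [S'] change the squared distance to [p] by amounts with opposite [b]-terms.
    Adding them shows that the squared distances along an orbit have constant second difference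
    [2 * c ^+ 2]. *)
Let iter_dist n p q :
  rho p (iter n S q) ^+ 2 = rho p q ^+ 2 + n%:R * b p q + n%:R ^+ 2 * c ^+ 2.
Proof.
suff : rho p (iter n S q) ^+ 2 = rho p q ^+ 2 + n%:R * b p q + n%:R ^+ 2 * c ^+ 2 /\
    rho p (iter n.+1 S q) ^+ 2 = rho p q ^+ 2 + n.+1%:R * b p q + n.+1%:R ^+ 2 * c ^+ 2.
  by case.
elim: n => [|n [IH1 IH2]].
  by split => /=; [ring|rewrite HS; ring].
split=> //; rewrite [in LHS]iterS HS.
have h := HS' p (iter n.+1 S q); rewrite [in X in X = _]iterS SK IH1 in h.
rewrite IH2 in h *; move: h; rewrite -!natr1; set m := n%:R; lra.
Qed.

Let S_isometry p q : rho (S p) (S q) = rho p q.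
Proof.
apply: squaresI; try exact: pd_ge0.
have e : b q (S p) = 2 * c ^+ 2 + b q p.
  have := iter_dist 2 q p; have := HS q (S p); rewrite /= => ->.
  by have := HS q p => ->; lra.
by rewrite HS (pd_sym rho_pd (S p)) HS (b_anti (S p)) e (pd_sym rho_pd q p); ring.
Qed.

Let iter_isometry n p q : rho (iter n S p) (iter n S q) = rho p q.
Proof. by elim: n => //= n <-; rewrite S_isometry. Qed.

(* Compare both sides of [rho p (S^2n q) <= rho p (S^n q') + rho q' (S^n q)]
   up to bounded terms as [n] tends to infinity. *)
Let b_subadditive p q' q : b p q <= b p q' + b q' q.
Proof.
have c0 := c_gt0.
pose r1 := rho p q' ^+ 2; pose r2 := rho q' q ^+ 2.
pose b1 := b p q'; pose b2 := b q' q.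
have r10 : 0 <= r1 by exact: sqr_ge0.
have r20 : 0 <= r2 by exact: sqr_ge0.
suff : 2 * (b p q - (b1 + b2)) <= 0 by rewrite /b1 /b2; lra.
apply: (@archi_le0 _ _ (2 * `|b p q - (b1 + b2)| + 2 * (r1 + r2) + ((`|b1| + `|b2|) / (2 * c) + (r1 + r2) / (2 * c)) ^+ 2)).
case=> [|k].
  rewrite mul0r !addr_ge0// ?sqr_ge0// ?mulr_ge0//.
  exact: addr_ge0.
set n : R := k.+1%:R.
have n1 : 1 <= n by rewrite ler1n.
(* AM-GM for [w] and [n * c]; nothing is lost to first order because [w] grows like [n * c]. *)
have up x y r : rho x (iter k.+1 S y) ^+ 2 = r + n * b x y + n ^+ 2 * c ^+ 2 ->
    rho x (iter k.+1 S y) <= n * c + b x y / (2 * c) + r / (2 * n * c).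
  move=> e; set w := rho _ _ in e *.
  have -> : n * c + b x y / (2 * c) + r / (2 * n * c) = (w ^+ 2 + (n * c) ^+ 2) / (2 * (n * c)).
    by rewrite e; field; apply/andP; split; lra.
  rewrite ler_pdivlMr; last by rewrite !mulr_gt0//; lra.
  by have := sqr_ge0 (w - n * c); rewrite sqrrB; lra.
have tri := pd_triangle rho_pd (iter k.+1 S q') p (iter (k.+1 + k.+1) S q).
rewrite iterD iter_isometry in tri.
have u1 := up _ _ _ (iter_dist k.+1 p q').
have u2 := up _ _ _ (iter_dist k.+1 q' q).
rewrite -/r1 -/b1 in u1; rewrite -/r2 -/b2 in u2.
have {tri u1 u2} le := le_trans tri (lerD u1 u2).
have e := iter_dist (k.+1 + k.+1) p q; rewrite iterD in e.
have w0 : 0 <= rho p (iter k.+1 S (iter k.+1 S q)) by exact: pd_ge0.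
rewrite natrD -/n in e.
set w := rho _ (iter _ _ _) in le w0 e.
pose D := (b1 + b2) / (2 * c) + (r1 + r2) / (2 * n * c).
have leD : w <= 2 * n * c + D.
  by apply: (le_trans le); rewrite /D !mulrDl; lra.
have sqD : w ^+ 2 <= (2 * n * c + D) ^+ 2.
  by rewrite ler_sqr// nnegrE; lra.
have DM : D ^+ 2 <= ((`|b1| + `|b2|) / (2 * c) + (r1 + r2) / (2 * c)) ^+ 2.
  rewrite -(real_normK (num_real D)) ler_sqr ?nnegrE//; last first.
    by rewrite addr_ge0// divr_ge0// ?addr_ge0// mulr_ge0// ltW.
  apply: (le_trans (ler_normD _ _)); apply: lerD.
    rewrite normrM (gtr0_norm (x := (2 * c)^-1)) ?invr_gt0 ?mulr_gt0//.
    by apply: ler_wpM2r; [rewrite invr_ge0 mulr_ge0// ltW|exact: ler_normD].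
  rewrite ger0_norm; last by rewrite divr_ge0 ?addr_ge0// !mulr_ge0// ltW//; lra.
  apply: ler_wpM2l; first exact: addr_ge0.
  rewrite lef_pV2 ?posrE ?mulr_gt0//; try lra.
  by nra.
have cross : 2 * (2 * n * c) * D = 2 * n * (b1 + b2) + 2 * (r1 + r2).
  by rewrite /D; field; apply/andP; split; lra.
have r0 := sqr_ge0 (rho p q).
have := normr_ge0 (b p q - (b1 + b2)).
by move: sqD; rewrite e sqrrD; move: cross DM; nra.
Qed.

Lemma b_additive p q' q : b p q = b p q' + b q' q.
Proof.
apply/eqP; rewrite eq_le b_subadditive/=.
have := b_subadditive q q' p; rewrite (b_anti q p) (b_anti q q') (b_anti q' p).
by lra.
Qed.

End Iterates.

Let b_add p q' q : b p q = b p q' + b q' q.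
Proof. by have [[S HS] [S' HS']] := flow in01_1; exact: (b_additive HS HS'). Qed.

Let has_translation (t : R) := exists2 S, translation t S &
  forall q, b q (S q) = 2 * c ^+ 2 * t.

Let has_id : has_translation 0.
Proof. by exists id => [p q|q]; rewrite ?bxx; ring. Qed.

Let has_small t : 0 <= t <= 1 -> has_translation t /\ has_translation (- t).
Proof.
move=> It; have [[S HS] [S' HS']] := flow It.
(* [translation_b] divides by [t], so for [t = 0] the identity serves instead. *)
have [t0|t0] := eqVneq t 0; first by rewrite t0 oppr0.
by split; [exists S|exists S'] => // q; apply: translation_b; rewrite ?oppr_eq0.
Qed.

Let has_add s t : has_translation s -> has_translation t -> has_translation (s + t).
Proof.
move=> [S HS bS] [S' HS' bS']; exists (S \o S') => [p q|q] /=.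
  by rewrite HS HS' (b_add p q (S' q)) bS'; ring.
by rewrite (b_add q (S' q)) bS bS'; ring.
Qed.

Lemma translation_flow t : has_translation t.
Proof.
pose n := (Num.bound `|t|).+1.
have n0 : 0 < n%:R :> R by rewrite ltr0n.
have tn : `|t| <= n%:R.
  by rewrite (le_trans (ltW (archi_boundP _)))// ler_nat.
have h : has_translation (t / n%:R).
  have I : 0 <= `|t| / n%:R <= 1 by rewrite divr_ge0// ?ler_pdivrMr ?mul1r// ltW.
  have [h1 h2] := has_small I; have [t0|t0] := leP 0 t; first by rewrite ger0_norm in h1.
  by rewrite ltr0_norm// mulNr opprK in h2.
have -> : t = n%:R * (t / n%:R) by field; rewrite gt_eqF.
elim: n {n0 tn} (t / _) h => [|n IH] x h; first by rewrite mul0r; exact: has_id.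
by rewrite -natr1 mulrDl mul1r; apply: has_add => //; exact: IH.
Qed.

(* The line coordinate is the Busemann-type function [b o _ / 2 c]; the second
   factor is obtained by flowing every point to the zero level. *)
Lemma line_factor (o : T) : exists2 beta : T -> R, (forall r, exists x, beta x = r) &
  exists d1, splitting rho d1 (fun x y => `|beta x - beta y|).
Proof.
have c0 := c_gt0.
pose beta q := b o q / (2 * c).
have bE p q : b p q = 2 * c * (beta q - beta p).
  rewrite (b_add p o q) (b_anti p o) /beta; field; lra.
have [S HS] := choice (fun t => let: ex_intro2 f Hf bf := translation_flow t in
  ex_intro (fun f => translation t f /\ forall q, b q (f q) = 2 * c ^+ 2 * t) f (conj Hf bf)).
have betaS t q : beta (S t q) = beta q + c * t.
  by rewrite /beta (b_add o q) (HS t).2; field; lra.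
exists beta => [r|].
  by exists (S ((r - beta o) / c) o); rewrite betaS; field; lra.
have dS s t p q : rho (S s p) (S t q) ^+ 2 =
    rho p q ^+ 2 + c ^+ 2 * (t - s) ^+ 2 + (t - s) * b p q.
  rewrite (HS t).1 (pd_sym rho_pd) (HS s).1 (pd_sym rho_pd q).
  by rewrite (b_anti (S s p)) (b_add q p (S s p)) (HS s).2 (b_anti q p); ring.
pose pr q := S (- beta q / c) q.
exists (fun p q => rho (pr p) (pr q)); split.
- exact: pd_pullback.
- split=> [x|x y|x y z]; first by rewrite subrr normr0.
    by rewrite distrC.
  have -> : beta x - beta z = beta x - beta y + (beta y - beta z) by ring.
  exact: ler_normD.
- by move=> x y; rewrite real_normK ?num_real// dS bE; field; lra.
move=> x y; exists (S ((beta y - beta x) / c) x); split.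
  apply: sq_eq0; rewrite dS betaS.
  set t := (beta y - beta x) / c.
  have e : rho (S t x) x ^+ 2 = c ^+ 2 * t ^+ 2.
    by rewrite (pd_sym rho_pd) (HS t).1 bxx pd_refl//; ring.
  rewrite e (b_anti _ x) (HS t).2 /t; field; lra.
rewrite betaS; have -> : beta x + c * ((beta y - beta x) / c) - beta y = 0.
  by field; lra.
by rewrite normr0.
Qed.

End TranslationFlow.
Definition irreducible_pd {R : realType} {T : Type} (rho : T -> T -> R) : Prop :=
  forall d1 d2, splitting rho d1 d2 ->
    (forall x y, d1 x y = 0) \/ (forall x y, d2 x y = 0).

Definition line_pd {R : realType} {T : Type} (rho : T -> T -> R) : Prop :=
  exists2 beta : T -> R, (forall r, exists x, beta x = r) &
    forall x y, rho x y = `|beta x - beta y|.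

Lemma irreducible_line {R : realType} {T : Type} (rho d1 : T -> T -> R)
    (beta : T -> R) : pseudo_distance rho -> irreducible_pd rho ->
  (forall r, exists x, beta x = r) ->
  splitting rho d1 (fun x y => `|beta x - beta y|) -> line_pd rho.
Proof.
move=> rho_pd irr surj spl; exists beta => // x y.
have [e|e] := irr _ _ spl; last first.
  have [u eu] := surj 0; have [v ev] := surj 1.
  have := e u v; rewrite eu ev sub0r normrN1 => /eqP.
  by rewrite oner_eq0.
have [_ _ sq _] := spl; apply: squaresI => //; first exact: pd_ge0.
by rewrite sq e expr0n add0r.
Qed.

(** * The inner product form of two splittings *)

Section TwoSplittings.
Context {R : realType} {T : Type} (d dY dY' : T -> T -> R).
Hypothesis d_pd : pseudo_distance d.
Hypothesis splitY : splitting d dY dY'.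
Hypothesis d_geo : geodesic_pd d.
Variable mY : T -> T -> T.
Hypothesis mYP : forall u v, corner dY dY' (mY u v) u v.

Let Y_pd : pseudo_distance dY. Proof. by case: splitY. Qed.
Let Y'_pd : pseudo_distance dY'. Proof. by case: splitY. Qed.

(* [bform dZ a a1 p q] is twice the inner product of the [Z]-components of the
   displacements from [p] to [q] in [Y] and from [a] to [a1] in [Y']. *)
Definition bform (dZ : T -> T -> R) (a a1 p q : T) : R :=
  dZ (mY p a) (mY q a1) ^+ 2 - dZ (mY p a) (mY q a) ^+ 2 -
  dZ (mY p a) (mY p a1) ^+ 2.

Let Y_eq p a q a1 : dY (mY p a) (mY q a1) = dY p q.
Proof. by rewrite (pd_congl Y_pd _ (mYP _ _).1) (pd_congr Y_pd _ (mYP _ _).1). Qed.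

Let Y'_eq p a q a1 : dY' (mY p a) (mY q a1) = dY' a a1.
Proof. by rewrite (pd_congl Y'_pd _ (mYP _ _).2) (pd_congr Y'_pd _ (mYP _ _).2). Qed.

Let mY_corner p q a a1 : corner dY dY' (mY q a1) (mY q a) (mY p a1).
Proof. by split; rewrite ?Y_eq ?Y'_eq pd_refl. Qed.

(** This is the parallelogram identity of the flat rectangle, combined with the equality of its
    opposite sides. *)
Lemma bform_anti dZ dZ' a a1 p q : splitting d dZ dZ' ->
  bform dZ a a1 p q = - bform dZ a a1 q p.
Proof.
move=> splitZ; have [Z_pd _ _ _] := splitZ.
have [] := rectangle d_pd splitY splitZ d_geo (x := mY p a) (x1 := mY q a) (x2 := mY p a1)
  (x12 := mY q a1).
- by rewrite Y'_eq pd_refl.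
- by rewrite Y_eq pd_refl.
- exact: mY_corner.
move=> _ e2 e3 _ _.
by rewrite /bform (pd_sym Z_pd (mY q a) (mY p a)) e2; lra.
Qed.

(** The two displacements are orthogonal for [d], so their inner products in [Z] and in [Z']
    cancel. *)
Lemma bform_compl dZ dZ' a a1 p q : splitting d dZ dZ' ->
  bform dZ' a a1 p q = - bform dZ a a1 p q.
Proof.
move=> [_ _ sqZ _]; have [_ _ sqY _] := splitY.
have := sqZ (mY p a) (mY q a1); have := sqZ (mY p a) (mY q a); have := sqZ (mY p a) (mY p a1).
by rewrite !sqY !Y_eq !Y'_eq !pd_refl// /bform => h1 h2 h3; lra.
Qed.

(** The map combines the [Z]-component of [q] at height [eta t] with its [Z']-component at height
    [a]. In the Pythagorean identity for the distance to [p], the [Z]-part expands by [rectangle],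
    and the [Y']-part to be subtracted is the same for all [q] and linear in [t]. *)
Lemma translation_family dZ dZ' (mZ : T -> T -> T) (eta : R -> T) a a1 :
  splitting d dZ dZ' -> (forall u v, corner dZ dZ' (mZ u v) u v) ->
  linear_curve d eta -> eta 0 = a -> eta 1 = a1 -> dY a a1 = 0 ->
  exists2 c : R, 0 <= c &
  forall t : R, 0 <= t <= 1 -> forall p q,
    dY p (mZ (mY q (eta t)) (mY q a)) ^+ 2 =
      dY p q ^+ 2 + c ^+ 2 * t ^+ 2 + t * bform dZ a a1 p q.
Proof.
move=> splitZ mZP eta_lin eta0 eta1 a_a1.
have [Z_pd Z'_pd sqZ _] := splitZ; have [_ _ sqY _] := splitY.
have I0 := @in01_0 R; have I1 := @in01_1 R.
pose S t q := mZ (mY q (eta t)) (mY q a).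
pose k := dZ (mY a a) (mY a a1) ^+ 2.
have rect p q t := rectangle d_pd splitY splitZ d_geo (x := mY p a) (x1 := mY q a)
  (x2 := mY p (eta t)) (x12 := mY q (eta t)).
have etaY t : 0 <= t <= 1 -> dY a (eta t) = 0.
  move=> It; have [lin _] := splitting_linear splitY eta_lin.
  by have := lin 0 t I0 It; rewrite eta0 eta1 a_a1 mulr0.
have kE p : dZ (mY p a) (mY p a1) ^+ 2 = k.
  have [] := rect a p 1; try by [rewrite Y_eq pd_refl|rewrite Y'_eq pd_refl|exact: mY_corner].
  by rewrite eta1 => _ ->.
have S_const t q : dY' a (S t q) = dY' a (S t a).
  have [] := rect a q t; try by [rewrite Y_eq pd_refl|rewrite Y'_eq pd_refl|exact: mY_corner].
  move=> _ _ _ h _; have e := h (S t a) (S t q) (mZP _ _) (mZP _ _).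
  by rewrite (pd_congr Y'_pd _ e).
have S_lin t : 0 <= t <= 1 -> dY' a (S t a) = t * dY' a (S 1 a).
  move=> It.
  have lin : linear_curve d (fun t => S t a).
    apply: (linear_curve_comb d_pd sqZ) => u v Iu Iv; last first.
      rewrite /S !(pd_congl Z'_pd _ (mZP _ _).2) !(pd_congr Z'_pd _ (mZP _ _).2).
      by rewrite !pd_refl// mulr0.
    rewrite /S !(pd_congl Z_pd _ (mZP _ _).1) !(pd_congr Z_pd _ (mZP _ _).1).
    have lin' : linear_curve d (fun t => mY a (eta t)).
      apply: (linear_curve_comb d_pd sqY) => r s Ir Is.
        by rewrite !Y_eq !pd_refl// mulr0.
      by rewrite !Y'_eq; exact: (splitting_linear splitY eta_lin).2.
    exact: (splitting_linear splitZ lin').1.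
  have S0 : dY' (S 0 a) a = 0.
    have e : d (S 0 a) (mY a a) = 0.
      apply: (splitting_0 splitZ); rewrite /S eta0.
        by rewrite (pd_congl Z_pd _ (mZP _ _).1) pd_refl.
      by rewrite (pd_congl Z'_pd _ (mZP _ _).2) pd_refl.
    by rewrite (pd_congl Y'_pd _ (splitting_eq0 splitY e).2); exact: (mYP _ _).2.
  have := (splitting_linear splitY lin).2 0 t I0 It.
  rewrite !(pd_congl Y'_pd _ S0) sub0r normrN ger0_norm//.
  by case/andP: It.
have main (t : R) p q : 0 <= t <= 1 -> dY p (S t q) ^+ 2 =
    dY p q ^+ 2 + t ^+ 2 * (k - dY' a (S 1 a) ^+ 2) + t * bform dZ a a1 p q.
  move=> It.
  have e1 : dZ (mY p a) (mY q (eta t)) ^+ 2 = dZ (mY p a) (mY q a) ^+ 2 +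
      t ^+ 2 * k + t * bform dZ a a1 p q.
    have [] := rect p q 1; try by [rewrite Y_eq pd_refl|rewrite Y'_eq pd_refl|exact: mY_corner].
    rewrite eta1 => _ _ _ _ /(_ (fun t => mY p (eta t)) t (mY q (eta t))).
    rewrite eta0 eta1 kE => -> //.
    - by rewrite /bform kE.
    - apply: (linear_curve_comb d_pd sqY) => r s Ir Is.
        by rewrite !Y_eq !pd_refl// mulr0.
      by rewrite !Y'_eq; exact: (splitting_linear splitY eta_lin).2.
  have e2 : d (mY p a) (S t q) ^+ 2 = dZ (mY p a) (mY q (eta t)) ^+ 2 +
      dZ' (mY p a) (mY q a) ^+ 2.
    by rewrite sqZ /S (pd_congr Z_pd _ (mZP _ _).1) (pd_congr Z'_pd _ (mZP _ _).2).
  have e3 := sqY (mY p a) (S t q).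
  rewrite (pd_congl Y_pd _ (mYP _ _).1) (pd_congl Y'_pd _ (mYP _ _).2) S_const S_lin// in e3.
  have e4 := sqZ (mY p a) (mY q a); rewrite sqY Y_eq Y'_eq pd_refl// in e4.
  by move: e3; rewrite exprMn e2 e1; move: e4; rewrite expr0n/=; lra.
(* [main] at [p = q = a] and [t = 1] shows that the coefficient [k - dY' a (S 1 a) ^+ 2] is the
   square of this distance. *)
exists (dY a (S 1 a)); first exact: pd_ge0.
move=> t It p q; rewrite -/(S t q) (main t p q It) (main 1 a a I1) pd_refl//.
have -> : bform dZ a a1 a a = 0 by rewrite /bform pd_refl//; ring.
by rewrite expr0n/=; ring.
Qed.

(* If the form does not vanish, the translations move points by a positive
   distance and generate a flow splitting a line off [dY]. *)
Lemma bform_eq0 dZ dZ' a a1 p q : splitting d dZ dZ' ->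
  irreducible_pd dY -> ~ line_pd dY -> bform dZ a a1 p q = 0.
Proof.
move=> splitZ irr nline.
(* Only the [Y']-component of [a1] enters the form, so [a1] may be moved into the [Y']-fiber through
   [a]. *)
wlog a_a1 : a1 / dY a a1 = 0.
  move=> /(_ (mY a a1)); rewrite (pd_sym Y_pd) (mYP _ _).1 => /(_ erefl) <-.
  have e r : dZ (mY r a1) (mY r (mY a a1)) = 0.
    apply: (splitting_eq0 splitZ _).1; apply: (splitting_0 splitY).
      by rewrite Y_eq pd_refl.
    by rewrite Y'_eq (pd_sym Y'_pd) (mYP _ _).2.
  have [Z_pd _ _ _] := splitZ.
  by rewrite /bform !(pd_congr Z_pd _ (e _)).
have splitZ' := splittingC splitZ.
have [mZ mZP] := splitting_fun splitZ; have [mZ' mZ'P] := splitting_fun splitZ'.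
have [eta [eta_lin eta0 eta1]] := d_geo a a1.
have [c c_ge0 Hc] := translation_family splitZ mZP eta_lin eta0 eta1 a_a1.
have [c' c'_ge0 Hc'] := translation_family splitZ' mZ'P eta_lin eta0 eta1 a_a1.
have I1 := @in01_1 R.
have anti u v := bform_anti a a1 u v splitZ.
have bxx u : bform dZ a a1 u u = 0 by have := anti u u; lra.
pose S q := mZ (mY q (eta 1)) (mY q a); pose S' q := mZ' (mY q (eta 1)) (mY q a).
have HS u v : dY u (S v) ^+ 2 = dY u v ^+ 2 + c ^+ 2 + bform dZ a a1 u v.
  by rewrite Hc//; ring.
have HS' u v : dY u (S' v) ^+ 2 = dY u v ^+ 2 + c' ^+ 2 - bform dZ a a1 u v.
  by rewrite Hc'// (bform_compl _ _ _ _ splitZ); ring.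
have bS u : bform dZ a a1 u (S u) = 2 * c ^+ 2.
  rewrite anti; have := HS (S u) u; rewrite pd_refl// (pd_sym Y_pd) HS bxx pd_refl//.
  by rewrite expr0n/=; lra.
have bS' u : bform dZ a a1 u (S' u) = - (2 * c' ^+ 2).
  rewrite anti; have := HS' (S' u) u; rewrite pd_refl// (pd_sym Y_pd) HS' bxx pd_refl//.
  by rewrite expr0n/=; lra.
(* The squared distances from [p] to [S (S' p)] and to [S' (S p)] are [c ^+ 2 - c' ^+ 2] and its
   negative, and neither is negative. *)
have cc' : c' = c.
  apply: squaresI => //; apply/eqP; rewrite eq_le; apply/andP; split.
    have := sqr_ge0 (dY p (S (S' p))); rewrite HS bS' HS' bxx pd_refl// expr0n/=; lra.
  have := sqr_ge0 (dY p (S' (S p))); rewrite HS' bS HS bxx pd_refl// expr0n/=; lra.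
have [c0|c_neq0] := eqVneq c 0.
  have e : dY q (S q) = 0.
    by apply: sq_eq0; rewrite HS c0 bxx pd_refl//; ring.
  by have := HS p q; rewrite -(pd_congr Y_pd _ e) c0 expr0n/=; lra.
have c_gt0 : 0 < c by rewrite lt_neqAle eq_sym c_neq0.
(* The maps built from [Z'] carry [bform] with the opposite sign and supply the negative times. *)
have [|beta surj [d1 spl]] := line_factor Y_pd anti c_gt0 _ p.
  move=> t It; split.
    by exists (fun q => mZ (mY q (eta t)) (mY q a)) => u v; exact: Hc.
  exists (fun q => mZ' (mY q (eta t)) (mY q a)) => u v.
  by rewrite Hc'// cc' (bform_compl _ _ _ _ splitZ); ring.
by case: nline; exact: irreducible_line spl.
Qed.

End TwoSplittings.

(** Opposite sides of a flat rectangle; this transports statements about one fiber to all parallel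
    ones. *)
Lemma fiber_dist_level {R : realType} {T : Type} (d dY dY' dZ dZ' : T -> T -> R) x x1 y y1 :
  pseudo_distance d -> splitting d dY dY' -> splitting d dZ dZ' -> geodesic_pd d ->
  dY' x x1 = 0 -> dY' y y1 = 0 -> dY x y = 0 -> dY x1 y1 = 0 -> dZ x x1 = dZ y y1.
Proof.
move=> d_pd splitY splitZ d_geo e1 e2 e3 e4; have [Y_pd Y'_pd _ _] := splitY.
have [] := rectangle d_pd splitY splitZ d_geo (x := x) (x1 := x1) (x2 := y) (x12 := y1) => //.
by split; rewrite pd_sym.
Qed.

Section FiberInclusion.
Context {R : realType} {T : Type} (d dY dY' dZ dZ' : T -> T -> R).
Hypothesis d_pd : pseudo_distance d.
Hypotheses (splitY : splitting d dY dY') (splitZ : splitting d dZ dZ').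
Hypothesis d_geo : geodesic_pd d.

Let Y_pd : pseudo_distance dY. Proof. by case: splitY. Qed.
Let Y'_pd : pseudo_distance dY'. Proof. by case: splitY. Qed.
Let Z_pd : pseudo_distance dZ. Proof. by case: splitZ. Qed.
Let Z'_pd : pseudo_distance dZ'. Proof. by case: splitZ. Qed.

(* The inner product form [bform] is symmetric in the two factors, so its
   vanishing also makes the translations of the other factor trivial. *)
Lemma fiber_projection x x1 w : irreducible_pd dY -> ~ line_pd dY ->
  dY' x x1 = 0 -> corner dZ dZ' w x1 x -> dY' x w = 0.
Proof.
move=> irr nline x_x1 [w1 w2].
have splitY' := splittingC splitY.
have [mY mYP] := splitting_fun splitY.
(* The factors exchange roles: the translations now act on [Y'], while [x] and [x1] differ in [Y]
   only. *)
pose mY' u v := mY v u.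
have mY'P u v : corner dY' dY (mY' u v) u v by have [] := mYP v u.
have [mZ mZP] := splitting_fun splitZ.
have [eta [eta_lin eta0 eta1]] := d_geo x x1.
have [c c_ge0 Hc] := translation_family d_pd splitY' d_geo mY'P splitZ mZP eta_lin eta0 eta1 x_x1.
have I1 := @in01_1 R.
pose S q := mZ (mY' q x1) (mY' q x).
have HS p q : dY' p (S q) ^+ 2 = dY' p q ^+ 2 + c ^+ 2 + bform mY' dZ x x1 p q.
  by have := Hc 1 I1 p q; rewrite eta1 => ->; ring.
have bxx : bform mY' dZ x x1 x x = 0.
  by rewrite /bform pd_refl//; ring.
pose y := mY x (S x).
have e0 : dY' x (S x) = 0.
  have b0 : bform mY' dZ x x1 (S x) x = 0.
    have := bform_eq0 d_pd splitY d_geo mYP (S x) x x x1 splitZ irr nline.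
    by rewrite /bform /mY'; lra.
  apply: sq_eq0; have := HS (S x) x; rewrite b0 pd_refl// (pd_sym Y'_pd) HS bxx.
  by rewrite pd_refl// expr0n/=; have := sqr_ge0 c; lra.
rewrite -e0; apply: (pd_congr Y'_pd).
apply: (splitting_eq0 splitY _).2; apply: (splitting_0 splitZ).
  rewrite (pd_congl Z_pd _ w1) /S (pd_congr Z_pd _ (mZP _ _).1).
  apply: (splitting_eq0 splitZ _).1; apply: (splitting_0 splitY).
    by rewrite pd_sym//; exact: (mYP _ _).1.
  rewrite pd_sym// (pd_congl Y'_pd _ (mYP _ _).2); exact: x_x1.
rewrite (pd_congl Z'_pd _ w2) /S (pd_congr Z'_pd _ (mZP _ _).2).
apply: (splitting_eq0 splitZ _).2; apply: (splitting_0 splitY); rewrite pd_sym//.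
  exact: (mYP _ _).1.
exact: (mYP _ _).2.
Qed.

(* By [fiber_projection] every fiber of [dY] is itself the product of its
   intersections with the fibers of [dZ] and [dZ']. *)
Lemma fiber_inclusion (o : T) : irreducible_pd dY -> ~ line_pd dY ->
  (forall x y, dY' x y = 0 -> dZ x y = 0) \/
  (forall x y, dY' x y = 0 -> dZ' x y = 0).
Proof.
move=> irr nline.
have [mY mYP] := splitting_fun splitY; have [mZ mZP] := splitting_fun splitZ.
pose f x := mY x o.
have fY x y : dY (f x) (f y) = dY x y.
  by rewrite (pd_congl Y_pd _ (mYP _ _).1) (pd_congr Y_pd _ (mYP _ _).1).
have fY' x y : dY' (f x) (f y) = 0.
  by rewrite (pd_congl Y'_pd _ (mYP _ _).2) (pd_congr Y'_pd _ (mYP _ _).2) pd_refl.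
have [_ _ sqY _] := splitY; have [_ _ sqZ _] := splitZ.
have spl : splitting dY (fun x y => dZ (f x) (f y)) (fun x y => dZ' (f x) (f y)).
  split; [exact: pd_pullback|exact: pd_pullback|move=> x y|move=> x y].
    by rewrite -sqZ sqY fY fY' expr0n addr0.
  pose w := mZ (f x) (f y).
  have e1 : dY' (f y) w = 0.
    exact: (fiber_projection irr nline (fY' y x) (mZP _ _)).
  have e2 : d (f w) w = 0.
    apply: (splitting_0 splitY); first exact: (mYP _ _).1.
    by rewrite (pd_congl Y'_pd _ (mYP _ _).2) -e1; apply: (pd_congl Y'_pd); rewrite pd_sym//; exact: (mYP _ _).2.
  exists w; split.
    by rewrite (pd_congl Z_pd _ (splitting_eq0 splitZ e2).1); exact: (mZP _ _).1.
  by rewrite (pd_congl Z'_pd _ (splitting_eq0 splitZ e2).2); exact: (mZP _ _).2.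
have xf x : dY x (f x) = 0 by rewrite pd_sym//; exact: (mYP _ _).1.
case: (irr _ _ spl) => h; [left|right] => x y xy; rewrite -(h x y).
  exact: fiber_dist_level d_pd splitY splitZ d_geo xy (fY' x y) (xf x) (xf y).
exact: fiber_dist_level d_pd splitY (splittingC splitZ) d_geo xy (fY' x y) (xf x) (xf y).
Qed.

End FiberInclusion.
(** * Factors as metric spaces *)

(* The complementary coordinate varies at constant speed along the line, and
   this speed vanishes between two points of the given fiber. *)
Lemma line_inclusion {R : realType} {T : Type} (d dY dY' dZ dZ' : T -> T -> R) (p q : T) :
  pseudo_distance d -> splitting d dY dY' -> splitting d dZ dZ' -> geodesic_pd d ->
  (forall x y, dY' x y = 0 -> dZ' x y = 0) -> dY p q != 0 -> line_pd dZ -> line_pd dY.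
Proof.
move=> d_pd splitY splitZ d_geo incl pq [beta surj betaE].
have [mY mYP] := splitting_fun splitY; have [mZ mZP] := splitting_fun splitZ.
have [Y_pd Y'_pd sqY _] := splitY; have [Z_pd Z'_pd sqZ _] := splitZ.
have [inv invE] := choice surj.
pose o := p; pose o' := mY q p.
pose l r := mZ (inv r) o.
have betal r : beta (l r) = r.
  have := (mZP (inv r) o).1; rewrite betaE invE -/(l r) => /normr0_eq0 h; lra.
have lZ r s : dZ (l r) (l s) = `|r - s| by rewrite betaE !betal.
have lZ' r s : dZ' (l r) (l s) = 0.
  by rewrite (pd_congl Z'_pd _ (mZP _ _).2) (pd_congr Z'_pd _ (mZP _ _).2) pd_refl.
have eY' : dY' o o' = 0 by rewrite pd_sym//; exact: (mYP _ _).2.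
have eY : dY o o' = dY p q by rewrite (pd_congr Y_pd _ (mYP _ _).1).
have l_beta x : dZ' x o = 0 -> d (l (beta x)) x = 0.
  move=> e; apply: (splitting_0 splitZ); first by rewrite betaE betal subrr normr0.
  by rewrite (pd_congl Z'_pd _ (mZP _ _).2) pd_sym.
have lo := l_beta o (pd_refl Z'_pd o).
have lo' : d (l (beta o')) o' = 0.
  by apply: l_beta; rewrite pd_sym//; exact: incl.
have uv : beta o != beta o'.
  apply: contraNneq pq => e; apply/eqP; rewrite -eY.
  apply: (splitting_eq0 splitY _).1; apply: (splitting_0 splitZ); last exact: incl.
  by rewrite betaE e subrr normr0.
have lY' r : dY' (l r) o = 0.
  set u := beta o in uv lo; set v := beta o' in uv lo'.
  (* [linear_curve] speaks of the unit interval, so [g] rescales to it a stretch of the line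
     containing [r], [u] and [v]. *)
  pose M := `|r| + `|u| + `|v| + 1.
  have [r0 u0 v0] := And3 (normr_ge0 r) (normr_ge0 u) (normr_ge0 v).
  have M0 : 0 < M by rewrite /M; lra.
  pose g t := l (2 * M * t - M).
  have lin : linear_curve d g.
    apply: (linear_curve_comb d_pd sqZ) => s t Is It.
      rewrite /g !lZ; have -> : 2 * M * s - M - (2 * M * t - M) = 2 * M * (s - t) by ring.
      have -> : 2 * M * 0 - M - (2 * M * 1 - M) = - (2 * M) by ring.
      by rewrite normrN normrM mulrC.
    by rewrite /g !lZ' mulr0.
  have lin' := (splitting_linear splitY lin).2.
  pose tau x := (x + M) / (2 * M).
  have gtau x : g (tau x) = l x by rewrite /g /tau; congr l; field; lra.
  have Itau x : `|x| <= M -> 0 <= tau x <= 1.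
    rewrite ler_norml => /andP[x1 x2]; rewrite /tau divr_ge0 ?ler_pdivrMr; lra.
  have Ir : 0 <= tau r <= 1 by apply: Itau; rewrite /M; lra.
  have Iu : 0 <= tau u <= 1 by apply: Itau; rewrite /M; lra.
  have Iv : 0 <= tau v <= 1 by apply: Itau; rewrite /M; lra.
  have euv := lin' _ _ Iu Iv; rewrite !gtau in euv.
  rewrite (pd_congl Y'_pd _ (splitting_eq0 splitY lo).2) in euv.
  rewrite (pd_congr Y'_pd _ (splitting_eq0 splitY lo').2) eY' in euv.
  have g01 : dY' (g 0) (g 1) = 0.
    have tau_uv : tau u - tau v != 0.
      rewrite /tau -mulrBl mulf_neq0 ?invr_eq0//; last by lra.
      by rewrite opprD addrACA subrr addr0 subr_eq0.
    by apply: (mulfI (_ : `|tau u - tau v| != 0)); rewrite ?normr_eq0// mulr0 -euv.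
  rewrite -(pd_congr Y'_pd _ (splitting_eq0 splitY lo).2) -!gtau lin'// g01.
  by rewrite mulr0.
have ZY' x y : dZ' x y = 0 -> dY' x y = 0.
  move=> xy; have e z : dZ' (mZ z o) o = 0 by exact: (mZP _ _).2.
  have ez z : dY' (mZ z o) o = 0.
    by rewrite -(pd_congl Y'_pd _ (splitting_eq0 splitY (l_beta _ (e z))).2) lY'.
  rewrite (@fiber_dist_level _ _ d dZ dZ' dY' dY x y (mZ x o) (mZ y o))//.
  - by rewrite (pd_congl Y'_pd _ (ez _)) pd_sym.
  - exact: splittingC.
  - by rewrite (pd_congl Z'_pd _ (e _)) pd_sym.
  - by rewrite pd_sym//; exact: (mZP _ _).1.
  - by rewrite pd_sym//; exact: (mZP _ _).1.
exists (fun x => beta (mY x o)) => [r|x y].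
  exists (l r); rewrite -[RHS]betal.
  have e : d (mY (l r) o) (l r) = 0.
    apply: (splitting_0 splitY); first exact: (mYP _ _).1.
    by rewrite (pd_congl Y'_pd _ (mYP _ _).2) pd_sym.
  have := (splitting_eq0 splitZ e).1; rewrite betaE => /normr0_eq0; lra.
rewrite -betaE; have e : dY' (mY x o) (mY y o) = 0.
  by rewrite (pd_congl Y'_pd _ (mYP _ _).2) (pd_congr Y'_pd _ (mYP _ _).2) pd_refl.
rewrite -[LHS](pd_congl Y_pd _ (mYP x o).1) -[LHS](pd_congr Y_pd _ (mYP y o).1).
apply: squaresI; try exact: pd_ge0.
by have := sqY (mY x o) (mY y o); rewrite sqZ e (incl _ _ e) expr0n/= !addr0.
Qed.

Section SubMetric.
Context {R : realType} {M : metricType R}.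

(* A fresh alias, because [set_type S] already carries the initial topology,
   without a distance. *)
Definition submetric (S : set M) : Type := set_type S.

Variable S : set M.
HB.instance Definition _ := Choice.copy (submetric S) (set_type S).

Definition submetric_val (x : submetric S) : M := set_val x.

Lemma submetric_valP (x : submetric S) : S (submetric_val x).
Proof. exact: set_valP. Qed.

Lemma submetric_val_inj : injective submetric_val.
Proof. by move=> x y; exact: val_inj. Qed.

Definition submetric_dist (x y : submetric S) : R :=
  mdist (submetric_val x) (submetric_val y).

Let dist_refl x : submetric_dist x x = 0. Proof. exact: mdistxx. Qed.
Let dist_eq0 x y : submetric_dist x y = 0 -> x = y.
Proof. by move=> /mdist_positivity /submetric_val_inj. Qed.
Let dist_sym x y : submetric_dist x y = submetric_dist y x.
Proof. exact: metric_sym. Qed.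
Let dist_triangle y x z : submetric_dist x z <= submetric_dist x y + submetric_dist y z.
Proof. exact: metric_triangle. Qed.

HB.instance Definition _ :=
  isMetric.Build R (submetric S) dist_refl dist_eq0 dist_sym dist_triangle.

Lemma submetric_mdist (x y : submetric S) :
  mdist x y = mdist (submetric_val x) (submetric_val y).
Proof. by []. Qed.

Definition submetric_pack (x : M) (Sx : S x) : submetric S := exist _ x (mem_set Sx).

Lemma submetric_packK x (Sx : S x) : submetric_val (submetric_pack Sx) = x.
Proof. by []. Qed.

End SubMetric.


Section Irreducible.
Context {R : realType}.

(** [irreducible] is about factors that are metric spaces, while a splitting only gives
    pseudo-distances on [T]. The factors are realised as the slices [S1] and [S2] of [Y] through a
    base point. *)
Lemma irreducible_pullback (Y : metricType R) (T : Type) (P : T -> Y) :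
  (forall y, exists x, P x = y) -> irreducible Y ->
  irreducible_pd (fun x x' => mdist (P x) (P x')).
Proof.
move=> P_surj irr d1 d2 spl.
have [s sK] := choice P_surj.
have [d1_pd d2_pd sq mix] := spl.
have [|neT] := pselect (exists x : T, True); last first.
  by left; move=> x; case: neT; exists x.
move=> [x0 _]; pose o := x0.
have P_eq0 x y : d1 x y = 0 -> d2 x y = 0 -> P x = P y.
  by move=> e1 e2; apply: mdist_positivity; exact: (splitting_0 spl).
have sP x : d1 (s (P x)) x = 0 /\ d2 (s (P x)) x = 0.
  by apply: (splitting_eq0 spl); rewrite sK mdistxx.
pose S1 := [set y : Y | d2 (s y) o = 0]; pose S2 := [set y : Y | d1 (s y) o = 0].
have [m mP] := splitting_fun spl.
have h1 y : S1 (P (m (s y) o)).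
  by rewrite /S1 /= (pd_congl d2_pd _ (sP _).2); exact: (mP _ _).2.
have h2 y : S2 (P (m o (s y))).
  by rewrite /S2 /= (pd_congl d1_pd _ (sP _).1); exact: (mP _ _).1.
pose phi (y : Y) : submetric S1 * submetric S2 := (submetric_pack (h1 y), submetric_pack (h2 y)).
have dist1 x y : mdist (P (m x o)) (P (m y o)) = d1 x y.
  apply: squaresI; [exact: mdist_ge0|exact: pd_ge0|].
  rewrite sq (pd_congl d1_pd _ (mP _ _).1) (pd_congr d1_pd _ (mP _ _).1).
  by rewrite (pd_congl d2_pd _ (mP _ _).2) (pd_congr d2_pd _ (mP _ _).2) pd_refl// expr0n addr0.
have dist2 x y : mdist (P (m o x)) (P (m o y)) = d2 x y.
  apply: squaresI; [exact: mdist_ge0|exact: pd_ge0|].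
  rewrite sq (pd_congl d1_pd _ (mP _ _).1) (pd_congr d1_pd _ (mP _ _).1).
  by rewrite (pd_congl d2_pd _ (mP _ _).2) (pd_congr d2_pd _ (mP _ _).2) pd_refl// expr0n add0r.
have phi_iso : isometry_onto (@pair_dist R (submetric S1) (submetric S2)) phi.
  split=> [x x'|[u v]].
    rewrite /pair_dist /phi /= !submetric_mdist !submetric_packK dist1 dist2.
    rewrite -sq !sK sqrtr_sqr ger0_norm//; exact: mdist_ge0.
  have [w [w1 w2]] := mix (s (submetric_val u)) (s (submetric_val v)).
  exists (P w); rewrite /phi; congr pair; apply: submetric_val_inj; rewrite submetric_packK.
    rewrite -[RHS]sK; apply: P_eq0.
      by rewrite (pd_congl d1_pd _ (mP _ _).1) (pd_congl d1_pd _ (sP _).1).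
    rewrite (pd_congl d2_pd _ (mP _ _).2) pd_sym//; exact: (submetric_valP u).
  rewrite -[RHS]sK; apply: P_eq0.
    rewrite (pd_congl d1_pd _ (mP _ _).1) pd_sym//; exact: (submetric_valP v).
  by rewrite (pd_congl d2_pd _ (mP _ _).2) (pd_congl d2_pd _ (sP _).2).
case: (irr _ _ phi phi_iso) => -[u hu]; [left|right]; move=> x y.
  have := hu (phi (P x)).1; rewrite -(hu (phi (P y)).1) => /(congr1 (@submetric_val R Y S1)).
  rewrite !submetric_packK => e.
  rewrite -(pd_congl d1_pd _ (sP x).1) -(pd_congr d1_pd _ (sP y).1) -dist1.
  by rewrite e mdistxx.
have := hu (phi (P x)).2; rewrite -(hu (phi (P y)).2) => /(congr1 (@submetric_val R Y S2)).
rewrite !submetric_packK => e.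
rewrite -(pd_congl d2_pd _ (sP x).2) -(pd_congr d2_pd _ (sP y).2) -dist2.
by rewrite e mdistxx.
Qed.

Lemma irreducible_of_pd (Y : metricType R) (T : Type) (P : T -> Y) :
  (forall y, exists x, P x = y) -> (exists y : Y, True) ->
  irreducible_pd (fun x x' => mdist (P x) (P x')) -> irreducible Y.
Proof.
move=> P_surj [y0 _] irr A B phi [iso surj].
have [s sK] := choice P_surj.
have sq x y : mdist x y ^+ 2 = mdist (phi x).1 (phi y).1 ^+ 2 + mdist (phi x).2 (phi y).2 ^+ 2.
  by rewrite -iso /pair_dist sqr_sqrtr// addr_ge0// sqr_ge0.
case: (irr (fun x y => mdist (phi (P x)).1 (phi (P y)).1)
           (fun x y => mdist (phi (P x)).2 (phi (P y)).2)).
- split.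
  + exact: (pd_pullback (fun x => (phi (P x)).1) (@pd_mdist R A)).
  + exact: (pd_pullback (fun x => (phi (P x)).2) (@pd_mdist R B)).
  + by move=> x y; exact: sq.
  move=> x y; have [w ew] := surj ((phi (P x)).1, (phi (P y)).2).
  by exists (s w); rewrite /corner sK ew /= !mdistxx.
- move=> h; left; exists (phi y0).1 => a.
  have [w ew] := surj (a, (phi y0).2).
  by have /mdist_positivity := h (s w) (s y0); rewrite !sK ew.
move=> h; right; exists (phi y0).2 => b.
have [w ew] := surj ((phi y0).1, b).
by have /mdist_positivity := h (s w) (s y0); rewrite !sK ew.
Qed.

Lemma isometric_line (Y : metricType R) (T : Type) (P : T -> Y) :
  (forall y, exists x, P x = y) ->
  line_pd (fun x x' => mdist (P x) (P x')) <-> isometric Y R^o.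
Proof.
move=> P_surj; have [s sK] := choice P_surj; split.
  move=> [beta surj betaE]; exists (beta \o s); split => /=.
    by move=> y y'; rewrite -[in RHS](sK y) -[in RHS](sK y') betaE distrC.
  move=> r; have [x <-] := surj r; exists (P x).
  have := betaE (s (P x)) x; rewrite sK mdistxx => /esym/normr0_eq0; lra.
move=> [f [iso surj]]; exists (f \o P) => /=.
  by move=> r; have [y <-] := surj r; exists (s y); rewrite sK.
by move=> x y; rewrite -iso distrC.
Qed.

End Irreducible.
(** * Uniqueness of decompositions *)

Definition decomposition {R : realType} {T : Type} {I : finType} (d : T -> T -> R)
    (D : I -> T -> T -> R) : Prop :=
  [/\ forall i, pseudo_distance (D i),
      forall x y, d x y ^+ 2 = \sum_i D i x y ^+ 2 &
      forall f : I -> T, exists w, forall i, D i w (f i) = 0].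

Section Decomposition.
Context {R : realType} {T : Type} {I : finType} (d : T -> T -> R) (D : I -> T -> T -> R).
Hypotheses (d_pd : pseudo_distance d) (dec : decomposition d D).

Lemma decomposition_eq0P x y : d x y = 0 <-> forall i, D i x y = 0.
Proof.
have [_ sq _] := dec; split.
  move=> e i; apply: sq_eq0; have := sq x y.
  rewrite e expr0n/= => /esym/eqP; rewrite psumr_eq0; last by move=> *; exact: sqr_ge0.
  by move=> /allP/(_ i); rewrite mem_index_enum => /(_ isT)/eqP.
move=> h; apply: sq_eq0; rewrite sq big1// => i _; by rewrite h expr0n.
Qed.

(** The complementary distance is [d] after resetting component [i] to that of [o], which erases the
    [i]-th summand. *)
Lemma decomposition_splitting (o : T) i : exists D', splitting d (D i) D' /\
  forall x y, D' x y = 0 <-> forall j, j != i -> D j x y = 0.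
Proof.
have [D_pd sq mix] := dec.
have [m mP] := choice (fun x => mix (fun j => if j == i then o else x)).
have mi x : D i (m x) o = 0 by have := mP x i; rewrite eqxx.
have mj x j : j != i -> D j (m x) x = 0.
  by move=> ji; have := mP x j; rewrite (negPf ji).
pose D' x y := d (m x) (m y).
have D'sq x y : D' x y ^+ 2 = \sum_(j | j != i) D j x y ^+ 2.
  rewrite /D' sq (bigD1 i)//= (pd_congl (D_pd i) _ (mi _)) (pd_congr (D_pd i) _ (mi _)).
  rewrite pd_refl// expr0n add0r; apply: eq_bigr => j ji.
  by rewrite (pd_congl (D_pd j) _ (mj _ _ ji)) (pd_congr (D_pd j) _ (mj _ _ ji)).
exists D'; split; last first.
  move=> x y; split=> [e j ji|h].
    apply: sq_eq0; have := D'sq x y; rewrite e expr0n/= => /esym/eqP.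
    rewrite psumr_eq0; last by move=> *; exact: sqr_ge0.
    by move=> /allP/(_ j); rewrite mem_index_enum ji => /(_ isT)/eqP.
  by apply: sq_eq0; rewrite D'sq big1// => j ji; rewrite h// expr0n.
split=> //; [exact: pd_pullback|by move=> x y; rewrite D'sq sq (bigD1 i)|].
move=> x y; have [w wP] := mix (fun j => if j == i then x else y).
exists w; split; first by have := wP i; rewrite eqxx.
apply: sq_eq0; rewrite D'sq big1// => j ji.
by have := wP j; rewrite (negPf ji) => ->; rewrite expr0n.
Qed.

Lemma decomposition_nontrivial i p q : D i p q != 0 ->
  exists p' q', D i p' q' != 0 /\ forall j, j != i -> D j p' q' = 0.
Proof.
move=> pq; have [D_pd _ mix] := dec.
have [w wP] := mix (fun j => if j == i then q else p).
exists p, w; split.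
  by have := wP i; rewrite eqxx => /(pd_congr (D_pd i)) ->.
by move=> j ji; have := wP j; rewrite (negPf ji) pd_sym.
Qed.

End Decomposition.

Section Uniqueness.
Context {R : realType} {T : Type} (d : T -> T -> R) (o : T).
Hypotheses (d_pd : pseudo_distance d) (d_geo : geodesic_pd d).

(** By [fiber_inclusion] the fibers of [D i] are trivial either for [E j] or for its complement; a
    [j] with [E j p q != 0] excludes the former. *)
Lemma fiber_in_fiber {I J : finType} (D : I -> T -> T -> R) (E : J -> T -> T -> R) i p q :
  decomposition d D -> decomposition d E ->
  irreducible_pd (D i) -> ~ line_pd (D i) ->
  D i p q != 0 -> (forall k, k != i -> D k p q = 0) ->
  exists j, [/\ ~ line_pd (E j), E j p q != 0 & forall x y,
    (forall k, k != i -> D k x y = 0) -> forall k, k != j -> E k x y = 0].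
Proof.
move=> decD decE irr nline pq pq0.
have [j pqj] : exists j, E j p q != 0.
  apply: contrapT => h; move/negP: pq; apply; apply/eqP.
  have /(decomposition_eq0P decD) -> // : d p q = 0.
  apply/(decomposition_eq0P decE) => j.
  by apply/eqP; apply: contra_notT h => ?; exists j.
have [D' [splitD D'P]] := decomposition_splitting d_pd decD o i.
have [E' [splitE E'P]] := decomposition_splitting d_pd decE o j.
have incl : forall x y, D' x y = 0 -> E' x y = 0.
  case: (fiber_inclusion d_pd splitD splitE d_geo o irr nline) => // h.
  by move: pqj; rewrite h ?eqxx//; apply/D'P.
exists j; split=> //.
  by move=> line; apply: nline; exact: line_inclusion d_pd splitD splitE d_geo incl pq line.
by move=> x y /D'P/incl/E'P.
Qed.

(** The inclusion is applied in both directions. The component reached on the way back separates [p]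
    from [q], which differ in component [i] only. *)
Lemma fiber_eq_fiber {I J : finType} (D : I -> T -> T -> R) (E : J -> T -> T -> R) i p q :
  decomposition d D -> decomposition d E ->
  (forall j, ~ line_pd (E j) -> irreducible_pd (E j)) ->
  irreducible_pd (D i) -> ~ line_pd (D i) -> D i p q != 0 ->
  exists j, ~ line_pd (E j) /\ forall x y,
    (forall k, k != i -> D k x y = 0) <-> (forall k, k != j -> E k x y = 0).
Proof.
move=> decD decE irrE irr nline /(decomposition_nontrivial decD)[{}p [{}q [pq pq0]]].
have [j [nlinej pqj incl]] := fiber_in_fiber decD decE irr nline pq pq0.
have [i' [_ pqi' incl']] := fiber_in_fiber decE decD (irrE j nlinej) nlinej pqj (incl _ _ pq0).
have ii' : i' = i.
  by apply/eqP; apply: contraNT pqi' => ii'; rewrite pq0.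
by exists j; split=> // x y; split; [exact: incl|rewrite -ii'; exact: incl'].
Qed.

End Uniqueness.

Section DeRham.
Context {R : realType} {X : metricType R}.

Lemma geodesic_space_pd : geodesic_space X -> geodesic_pd (fun x y : X => mdist x y).
Proof.
move=> geo x y; have [a [b [g [ab lin ga gb]]]] := geo x y.
have I t : 0 <= t <= 1 -> a + t * (b - a) \in `[a, b].
  by move=> /andP[t0 t1]; rewrite in_itv/=; apply/andP; split; nra.
exists (fun t => g (a + t * (b - a))); split.
- move=> s t Is It; rewrite !lin ?I ?in01_0 ?in01_1// -normrM.
  have -> : a + s * (b - a) - (a + t * (b - a)) = (s - t) * (b - a) by ring.
  have -> : a + 0 * (b - a) - (a + 1 * (b - a)) = - (b - a) by ring.
  by rewrite !normrM normrN.
- by rewrite mul0r addr0.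
- by rewrite mul1r addrC subrK.
Qed.

Lemma component_surj (n : nat) (Y : 'I_n -> metricType R) (phi : X -> forall i, Y i) (x0 : X) :
  (forall t : forall i, Y i, exists x, phi x = t) -> forall i (y : Y i), exists x, phi x i = y.
Proof.
move=> surj i y; have [x ex] := surj (dfwith (phi x0) i y).
by exists x; rewrite ex dfwithin.
Qed.

(** Cutting the Euclidean factor into coordinate lines gives all components the same shape, with
    [line_pd] marking the Euclidean ones. Decompositions can then be compared before anything is
    known about the dimensions of their Euclidean factors. *)
Lemma de_rham_factors (n : nat) (Y : 'I_n.+1 -> metricType R) (phi : X -> forall i, Y i) (x0 : X) :
  de_rham_decomposition phi ->
  exists (k : nat) (D : 'I_k + 'I_n -> X -> X -> R),
  [/\ decomposition (fun x y : X => mdist x y) D,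
      forall a, line_pd (D (inl a)),
      forall i, irreducible_pd (D (inr i)) /\ ~ line_pd (D (inr i)),
      forall i, exists p q, D (inr i) p q != 0 &
      forall i x x', fiber phi (lift ord0 i) x x' <->
        forall k, k != inr i -> D k x' x = 0].
Proof.
move=> [[iso surj] [k [g [g_iso g_surj]]] irr].
have comp := component_surj x0 surj.
pose D (e : 'I_k + 'I_n) (x x' : X) : R := match e with
  | inl a => `|g (phi x ord0) ord0 a - g (phi x' ord0) ord0 a|
  | inr i => mdist (phi x (lift ord0 i)) (phi x' (lift ord0 i)) end.
have D0 x x' : mdist (phi x ord0) (phi x' ord0) ^+ 2 = \sum_a D (inl a) x x' ^+ 2.
  rewrite -g_iso /euclidean_dist sqr_sqrtr; last first.
    by apply: sumr_ge0 => *; exact: sqr_ge0.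
  by apply: eq_bigr => a _; rewrite /D real_normK ?num_real.
have D_pd e : pseudo_distance (D e).
  case: e => [a|i]; last exact: (pd_pullback (fun x => phi x (lift ord0 i)) (@pd_mdist R (Y _))).
  split=> [x|x y|x y z] /=; [by rewrite subrr normr0|by rewrite distrC|exact: ler_distD].
have lift0_neq (i : 'I_n) : lift ord0 i != ord0 by rewrite eq_sym neq_lift.
have nz (i : 'I_n.+1) : i != ord0 -> exists j, i = lift ord0 j.
  by move=> i0; have := unlift_some (_ : ord0 != i); rewrite eq_sym => /(_ i0)[j -> _]; exists j.
have dec : decomposition (fun x y : X => mdist x y) D.
  split=> // [x y|f].
    rewrite -iso /prod_dist sqr_sqrtr; last by apply: sumr_ge0 => *; exact: sqr_ge0.
    by rewrite big_ord_recl big_sumType/= D0.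
  have [y0 ey0] := g_surj (\row_a g (phi (f (inl a)) ord0) ord0 a).
  have [x1 ex1] := comp ord0 y0.
  pose F i := if unlift ord0 i is Some j then f (inr j) else x1.
  have [w ew] := surj (fun i => phi (F i) i).
  exists w => -[a|i] /=; rewrite ew /F.
    by rewrite unlift_none ex1 ey0 mxE subrr normr0.
  by rewrite liftK mdistxx.
exists k, D; split=> //.
- move=> a; exists (fun x => g (phi x ord0) ord0 a) => // r.
  have [y0 ey0] := g_surj (const_mx r); have [x1 ex1] := comp ord0 y0.
  by exists x1; rewrite ex1 ey0 mxE.
- move=> i; have [irri nline _] := irr (lift ord0 i) (lift0_neq i).
  split; first exact: irreducible_pullback (comp _) irri.
  by move=> /(isometric_line (comp _)).
- move=> i; have [_ _ npt] := irr (lift ord0 i) (lift0_neq i).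
  apply: contrapT => h; apply: npt; exists (phi x0 (lift ord0 i)) => y.
  have [x <-] := comp _ y; apply: mdist_positivity.
  by apply/eqP; apply: contra_notT h => ?; exists x, x0.
move=> i x x'; split=> [fib [a|j]|h j ji].
- by move=> _; rewrite /D fib ?subrr ?normr0// eq_sym neq_lift.
- by move=> ji; rewrite /D fib ?mdistxx// (inj_eq lift_inj); apply: contraNneq ji => ->.
apply: mdist_positivity; have [e|/nz[j' e]] := eqVneq j ord0; subst j.
  by apply: sq_eq0; rewrite D0 big1// => a _; rewrite h// expr0n.
apply: (h (inr j')); apply: contraNneq ji => -[->]; exact: eqxx.
Qed.

Lemma de_rham_unique_leq (n m : nat) (Y : 'I_n.+1 -> metricType R) (phi : X -> forall i, Y i)
    (Z : 'I_m.+1 -> metricType R) (psi : X -> forall i, Z i) (x0 : X) :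
  geodesic_space X -> de_rham_decomposition phi -> de_rham_decomposition psi ->
  exists2 f : 'I_n -> 'I_m, injective f & forall x i,
    fiber phi (lift ord0 i) x = fiber psi (lift ord0 (f i)) x.
Proof.
move=> /geodesic_space_pd geo dphi dpsi.
have [k [D [decD lineD irrD ntD fibD]]] := de_rham_factors x0 dphi.
have [l [E [decE lineE irrE ntE fibE]]] := de_rham_factors x0 dpsi.
have key i : exists j, forall x, fiber phi (lift ord0 i) x = fiber psi (lift ord0 j) x.
  have [p [q pq]] := ntD i; have [irri nlinei] := irrD i.
  have irrE' j : ~ line_pd (E j) -> irreducible_pd (E j).
    by case: j => [a|j]; [case; exact: lineE|case: (irrE j)].
  have [j [nlinej jP]] := fiber_eq_fiber x0 (@pd_mdist R X) geo decD decE irrE' irri nlinei pq.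
  case: j nlinej jP => [a|j] nlinej jP; first by case: nlinej; exact: lineE.
  exists j => x; apply/seteqP; split => x'.
    by move=> /fibD/jP/fibE.
  by move=> /fibE/jP/fibD.
have [f fP] := choice key.
exists f => // i i' ff.
(* Two indices with the same image have equal fibers, whereas the points chosen here differ in
   component [i] only. *)
have [p [q pq]] := ntD i.
have [{}p [{}q [{}pq pq0]]] := decomposition_nontrivial decD pq.
apply/eqP; apply: contraNT pq => ii'; apply/eqP.
have : fiber phi (lift ord0 i) q p by apply/fibD.
rewrite fP ff -fP => /fibD; apply; apply: contraNneq ii' => -[->]; exact: eqxx.
Qed.

Lemma de_rham_unique (n : nat) (Y : 'I_n.+1 -> metricType R) (phi : X -> forall i, Y i)
    (m : nat) (Z : 'I_m.+1 -> metricType R) (psi : X -> forall i, Z i) (x0 : X) :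
  geodesic_space X -> de_rham_decomposition phi -> de_rham_decomposition psi ->
  exists (e : n = m) (s : {perm 'I_n.+1}), forall (x : X) (i : 'I_n.+1), i != ord0 ->
    fiber phi i x = fiber psi (cast_ord (congr1 S e) (s i)) x.
Proof.
move=> geo dphi dpsi.
have [f f_inj fP] := de_rham_unique_leq x0 geo dphi dpsi.
have [f' f'_inj _] := de_rham_unique_leq x0 geo dpsi dphi.
have e : n = m.
  have := leq_card f f_inj; have := leq_card f' f'_inj.
  by rewrite !card_ord => ? ?; apply/eqP; rewrite eqn_leq; apply/andP.
(* The permutation fixes 0, the index of the Euclidean factor. *)
subst m; exists erefl, (lift_perm ord0 ord0 (perm f_inj)) => x i i0.
have := unlift_some (_ : ord0 != i); rewrite eq_sym => /(_ i0)[j -> _].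
by rewrite cast_ord_id lift_perm_lift permE.
Qed.

End DeRham.
(** * Existence of decompositions *)

Section Fibers.
Context {R : realType} {X : metricType R} {I : finType} (D : I -> X -> X -> R) (o : X).
Hypothesis dec : decomposition (fun x y : X => mdist x y) D.

Let D_pd i : pseudo_distance (D i). Proof. by case: dec. Qed.

Definition fiber_set (S : {set I}) : set X := [set x | forall i, i \notin S -> D i x o = 0].

Lemma fiber_set_eq S x y : fiber_set S x -> fiber_set S y ->
  (forall i, i \in S -> D i x y = 0) -> x = y.
Proof.
move=> Sx Sy h; apply: mdist_positivity; apply/(decomposition_eq0P dec) => i.
have [/h//|iS] := boolP (i \in S).
by rewrite (pd_congl (D_pd i) _ (Sx i iS)) pd_sym// Sy.
Qed.

Lemma fiber_projection_exists (S : {set I}) : exists P : X -> submetric (fiber_set S),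
  [/\ forall y, P (submetric_val y) = y,
      forall x i, i \in S -> D i (submetric_val (P x)) x = 0 &
      forall x x', mdist (P x) (P x') ^+ 2 = \sum_(i in S) D i x x' ^+ 2].
Proof.
have [_ sq mix] := dec.
have [m mP] := choice (fun x => mix (fun i => if i \in S then x else o)).
have mS x : fiber_set S (m x).
  by move=> i iS; have := mP x i; rewrite (negPf iS).
have mE x i : i \in S -> D i (m x) x = 0 by move=> iS; have := mP x i; rewrite iS.
exists (fun x => submetric_pack (mS x)); split=> [y|x i|x x'].
- apply: submetric_val_inj; rewrite submetric_packK.
  by apply: (@fiber_set_eq S) => //; [exact: submetric_valP|exact: mE].
- exact: mE.
rewrite submetric_mdist !submetric_packK sq [RHS]big_mkcond; apply: eq_bigr => i _.
case: ifPn => iS.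
  by rewrite (pd_congl (D_pd i) _ (mE _ _ iS)) (pd_congr (D_pd i) _ (mE _ _ iS)).
rewrite (pd_congl (D_pd i) _ (mS _ _ iS)) (pd_congr (D_pd i) _ (mS _ _ iS)).
by rewrite pd_refl// expr0n.
Qed.

End Fibers.

Section Existence.
Context {R : realType} {X : metricType R}.

Definition nontrivial_decomposition (n : nat) : Prop :=
  exists (I : finType) (D : I -> X -> X -> R),
    [/\ #|I| = n, decomposition (fun x y : X => mdist x y) D &
        forall i, exists x y, D i x y != 0].

(** A starting point for the maximum: [X] as its own single factor, or no factor at all if [X] is a
    point. *)
Lemma nontrivial_decomposition_ex (o : X) : exists n, nontrivial_decomposition n.
Proof.
have [[x [y xy]]|h] := pselect (exists x y : X, mdist x y != 0).
  exists 1%N, 'I_1, (fun _ x y => mdist x y); split=> [||_]; first by rewrite card_ord.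
    split=> [_|a b|f]; [exact: pd_mdist|by rewrite big_ord1|].
    by exists (f ord0) => i; rewrite (ord1 i) mdistxx.
  by exists x, y.
have h0 (x y : X) : mdist x y = 0.
  by apply/eqP; apply: contra_notT h => ?; exists x, y.
exists 0%N, 'I_0, (fun _ _ _ => 0); split=> [||[]//]; first by rewrite card_ord.
split=> [[]//|x y|f]; first by rewrite big_ord0 h0 expr0n.
by exists o => -[].
Qed.

Lemma irreducible_of_maximal (I : finType) (D : I -> X -> X -> R) :
  decomposition (fun x y : X => mdist x y) D -> (forall i, exists x y, D i x y != 0) ->
  ~ nontrivial_decomposition #|I|.+1 -> forall i, irreducible_pd (D i).
Proof.
move=> dec nt nmax i d1 d2 spl; apply: contrapT => /not_orP[h1 h2]; apply: nmax.
have [D_pd sq mix] := dec; have [d1_pd d2_pd sq' mix'] := spl.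
pose E (e : 'I_1 + I) : X -> X -> R := match e with
  | inl _ => d2 | inr j => if j == i then d1 else D j end.
exists ('I_1 + I)%type, E; split.
- by rewrite card_sum card_ord.
- split.
  + by case=> [_|j] //=; case: ifP.
  + move=> x y; rewrite sq big_sumType/= big_ord1 (bigD1 i)//= sq' [in RHS](bigD1 i)//= eqxx.
    rewrite addrA [in RHS](addrC (d2 x y ^+ 2)); congr (_ + _).
    by apply: eq_bigr => j /negPf ->.
  + move=> f; have [u [u1 u2]] := mix' (f (inr i)) (f (inl ord0)).
    have [w wP] := mix (fun j => if j == i then u else f (inr j)).
    have wu : D i w u = 0 by have := wP i; rewrite eqxx.
    have [wu1 wu2] := splitting_eq0 spl wu.
    exists w => -[a|j] /=; first by rewrite (ord1 a) (pd_congl d2_pd _ wu2).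
    have [->|ji] := eqVneq j i; first by rewrite (pd_congl d1_pd _ wu1).
    by have := wP j; rewrite (negPf ji).
have nontriv (r : X -> X -> R) : ~ (forall x y, r x y = 0) -> exists x y, r x y != 0.
  move=> h; apply: contrapT => h'; apply: h => x y.
  by apply/eqP; apply: contra_notT h' => ?; exists x, y.
case=> [_|j] /=; first exact: nontriv.
by case: ifP => _; [exact: nontriv|exact: nt].
Qed.

(** The block [S ord0] gathers all lines and every other block is a single component; each factor is
    realised as the fiber through [o] spanned by its block. *)
Lemma de_rham_of_irreducible (o : X) (I : finType) (D : I -> X -> X -> R) :
  decomposition (fun x y : X => mdist x y) D -> (forall i, exists x y, D i x y != 0) ->
  (forall i, irreducible_pd (D i)) ->
  exists (n : nat) (Y : 'I_n.+1 -> metricType R) (phi : X -> forall i, Y i),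
    de_rham_decomposition phi.
Proof.
move=> dec nt irr; have [D_pd sq mix] := dec.
pose L := [set i | `[< line_pd (D i) >]]%SET.
pose p := #|~: L|%SET.
pose S (i : 'I_p.+1) : {set I} := if unlift ord0 i is Some j then [set enum_val j]%SET else L.
have S0 : S ord0 = L by rewrite /S unlift_none.
have Slift j : S (lift ord0 j) = [set enum_val j]%SET by rewrite /S liftK.
have nz (i : 'I_p.+1) : i = ord0 \/ exists j, i = lift ord0 j.
  by case: (unliftP ord0 i) => [j ->|->]; [right; exists j|left].
have S_cover e : exists i, e \in S i.
  have [eL|eL] := boolP (e \in L); first by exists ord0; rewrite S0.
  have eL' : e \in ~: L by rewrite inE.
  by exists (lift ord0 (enum_rank_in eL' e)); rewrite Slift enum_rankK_in// finset.set11.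
have S_uniq e i i' : e \in S i -> e \in S i' -> i = i'.
  have nL (j : 'I_p) : enum_val j \notin L.
    by have := @enum_valP I (mem (~: L)%SET) j; rewrite finset.in_setC.
  case: (nz i) => [->|[j ->]]; case: (nz i') => [->|[j' ->]]; rewrite ?S0 ?Slift//.
  - by move=> eL /set1P ee; have := nL j'; rewrite -ee eL.
  - by move=> /set1P ee eL; have := nL j; rewrite -ee eL.
  - by move=> /set1P -> /set1P/enum_val_inj ->.
have [P PP] : exists P : forall i, X -> submetric (fiber_set D o (S i)), forall i,
  [/\ forall y, P i (submetric_val y) = y,
      forall x e, e \in S i -> D e (submetric_val (P i x)) x = 0 &
      forall x x', mdist (P i x) (P i x') ^+ 2 = \sum_(e in S i) D e x x' ^+ 2].
  have H i := cid (fiber_projection_exists o dec (S i)).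
  by exists (fun i => sval (H i)) => i; exact: (svalP (H i)).
have [kap kapP] := choice S_cover.
have Pdist j x x' : mdist (P (lift ord0 j) x) (P (lift ord0 j) x') = D (enum_val j) x x'.
  have [_ _ h] := PP (lift ord0 j); apply: squaresI; [exact: mdist_ge0|exact: pd_ge0|].
  by rewrite h Slift big_set1.
have P_surj i y : exists x, P i x = y.
  by have [h _ _] := PP i; exists (submetric_val y).
exists p, (fun i => submetric (fiber_set D o (S i))), (fun x i => P i x); split.
- split=> [x x'|t].
    rewrite /prod_dist -[RHS]ger0_norm ?mdist_ge0// -[RHS]sqrtr_sqr; congr Num.sqrt.
    have [_ _ h0] := PP ord0.
    rewrite big_ord_recl h0 S0 sq [RHS](bigID (mem L))/=; congr (_ + _).
    under eq_bigr => j _ do rewrite Pdist.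
    rewrite (eq_bigl (fun e => e \in (~: L)%SET)); last first.
      by move=> e; rewrite finset.in_setC.
    by rewrite [RHS]big_enum_val.
  have [w wP] := mix (fun e => submetric_val (t (kap e))).
  exists w; apply: functional_extensionality_dep => i; apply: submetric_val_inj.
  apply: (fiber_set_eq dec (S := S i)); try exact: submetric_valP.
  move=> e eS; have [_ h _] := PP i.
  by rewrite (pd_congl (D_pd e) _ (h w e eS)) -(S_uniq _ _ _ (kapP e) eS).
- have [beta betaP] : exists beta : I -> X -> R, forall e, e \in L ->
      (forall r, exists x, beta e x = r) /\ forall x y, D e x y = `|beta e x - beta e y|.
    have H e : exists beta : X -> R, e \in L ->
        (forall r, exists x, beta x = r) /\ forall x y, D e x y = `|beta x - beta y|.
      have [eL|eL] := boolP (e \in L); last by exists (fun=> 0).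
      by move: (eL); rewrite inE => /asboolP[beta ? ?]; exists beta.
    by have [beta H'] := choice H; exists beta.
  exists #|L|%SET, (fun y => \row_a beta (enum_val a) (submetric_val y)); split.
    move=> y y'; rewrite -[RHS]ger0_norm ?mdist_ge0// -[RHS]sqrtr_sqr; congr Num.sqrt.
    have [h1 _ h3] := PP ord0.
    rewrite -[in RHS](h1 y) -[in RHS](h1 y') h3.
    rewrite [RHS](eq_bigl (fun e => e \in L)); last by move=> e; rewrite S0.
    rewrite [RHS]big_enum_val.
    apply: eq_bigr => a _; rewrite !mxE; have [_ ->] := betaP _ (enum_valP a).
    by rewrite real_normK ?num_real.
  move=> v.
  have H e : exists x, forall a : 'I_#|L|%SET, enum_val a = e -> beta e x = v ord0 a.
    have [[a ae]|h] := pselect (exists a : 'I_#|L|%SET, enum_val a = e).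
      have [sur _] := betaP _ (enum_valP a); have [x ex] := sur (v ord0 a).
      by exists x => a' a'e; rewrite -{1}ae ex; congr (v ord0 _); apply: enum_val_inj; rewrite ae.
    by exists o => a ae; case: h; exists a.
  have [f fP] := choice H; have [w wP] := mix f.
  exists (P ord0 w); apply/rowP => a; rewrite mxE -(fP _ a erefl).
  have [_ bE] := betaP _ (enum_valP a); have [_ h _] := PP ord0.
  have e : D (enum_val a) (submetric_val (P ord0 w)) (f (enum_val a)) = 0.
    rewrite (pd_congl (D_pd _) _ (h w (enum_val a) _)) ?wP//.
    have -> : (enum_val a \in S ord0) = (enum_val a \in L) by rewrite S0.
    exact: enum_valP.
  by move: e; rewrite bE => /normr0_eq0; lra.
move=> i; case: (nz i) => [->|[j ->] _]; first by rewrite eqxx.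
have DE : (fun x x' => mdist (P (lift ord0 j) x) (P (lift ord0 j) x')) = D (enum_val j).
  by apply: funext => x; apply: funext => x'; exact: Pdist.
split.
- apply: (irreducible_of_pd (P_surj (lift ord0 j))); first by exists (P (lift ord0 j) o).
  by rewrite DE; exact: irr.
- move=> /(isometric_line (P_surj _)); rewrite DE => line.
  have := @enum_valP I (mem (~: L)%SET) j; rewrite !inE => /negP; apply; exact/asboolP.
move=> [y0 y0P]; have [x [x']] := nt (enum_val j).
by rewrite -Pdist (y0P (P _ x)) (y0P (P _ x')) mdistxx eqxx.
Qed.

Lemma de_rham_exists (o : X) (N : nat) :
  (forall n, nontrivial_decomposition n -> (n <= N)%N) ->
  exists (n : nat) (Y : 'I_n.+1 -> metricType R) (phi : X -> forall i, Y i),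
    de_rham_decomposition phi.
Proof.
move=> bound.
have ex : exists n, `[< nontrivial_decomposition n >].
  by have [n] := nontrivial_decomposition_ex o; exists n; exact/asboolP.
have ub n : `[< nontrivial_decomposition n >] -> (n <= N)%N by move=> /asboolP/bound.
case: (ex_maxnP ex ub) => n /asboolP[I [D [In dec nt]]] nmax.
apply: (de_rham_of_irreducible o dec nt); apply: irreducible_of_maximal => //.
by rewrite In => /asboolP/nmax; rewrite ltnn.
Qed.

End Existence.
(** * Kuhn's lemma and the dimension of boxes *)

Lemma even_of_involution (T : finType) (A : {set T}) (g : T -> T) :
  (forall x, x \in A -> g x \in A) -> (forall x, x \in A -> g (g x) = x) ->
  (forall x, x \in A -> g x != x) -> ~~ odd #|A|.
Proof.
have [k] := ubnP #|A|; elim: k A => // k IH A Ak gA gg gne.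
have [->|[x xA]] := set_0Vmem A; first by rewrite cards0.
have gxA := gA x xA; have gx := gne x xA.
pose B := A :\ x :\ g x.
have cA : #|A| = #|B|.+2.
  by rewrite (cardsD1 x A) xA (cardsD1 (g x) (A :\ x)) !inE gxA gx.
have BA y : y \in B -> [/\ y \in A, y != x & y != g x].
  by rewrite !inE => /and3P[].
rewrite cA /= negbK; apply: IH; first by move: Ak; rewrite cA => /ltnW.
- move=> y /BA[yA yx ygx]; rewrite !inE gA// andbT; apply/andP; split.
    by apply: contraNneq yx => e; rewrite -(gg y yA) e gg.
  by apply: contraNneq ygx => e; rewrite -e gg.
- by move=> y /BA[yA _ _]; exact: gg.
- by move=> y /BA[yA _ _]; exact: gne.
Qed.

Section Labels.
Variables (n : nat) (f : 'I_n.+2 -> nat).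
Hypothesis f_le : forall k, (f k <= n.+1)%N.

Definition door (k : 'I_n.+2) : bool :=
  [forall l : 'I_n.+1, exists k', (k' != k) && (f k' == l)].

Definition full_labels : bool := [forall l : 'I_n.+2, exists k, f k == l].

(** In a full simplex the only door is opposite the vertex labelled [n.+1]. A simplex that has a
    door without being full repeats exactly one label, and its doors are opposite the two vertices
    carrying it. *)
Lemma odd_doors : odd #|[set k | door k]%SET| = full_labels.
Proof.
pose F k : 'I_n.+2 := @Ordinal n.+2 (f k) (f_le k).
have door_inj k : door k -> {in [set~ k]%SET &, injective F}.
  move=> /forallP dk; apply/imset_injP; rewrite eqn_leq leq_imset_card/=.
  have -> : #|[set~ k]%SET| = #|[set~ ord_max : 'I_n.+2]%SET| by rewrite !cardsC1.
  apply: subset_leq_card; apply/fintype.subsetP => l; rewrite !inE => lmax.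
  have [l' l'E] : exists l' : 'I_n.+1, l = lift ord_max l'.
    by case: (unliftP ord_max l) lmax => [l' ->|-> /eqP//]; exists l'.
  have /existsP[k' /andP[k'k /eqP fk']] := dk l'.
  apply/imsetP; exists k'; rewrite ?inE//; apply: val_inj => /=.
  by rewrite fk' l'E /= /bump leqNgt ltn_ord.
have full_inj : full_labels -> injective F.
  move=> /forallP fl; suff inj : {in [set: 'I_n.+2]%SET &, injective F}.
    by move=> k k'; apply: inj; rewrite inE.
  apply/imset_injP; rewrite eqn_leq leq_imset_card/=.
  apply: subset_leq_card; apply/fintype.subsetP => l _.
  have /existsP[k /eqP fk] := fl l.
  by apply/imsetP; exists k; rewrite ?inE//; apply: val_inj.
have doorE k : door k -> forall l, (l < n.+1)%N -> exists2 k', k' != k & f k' = l.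
  by move=> /forallP dk l ln; have /existsP[k' /andP[? /eqP ?]] := dk (Ordinal ln); exists k'.
have [D0|[k]] := set_0Vmem [set k | door k]%SET.
  rewrite D0 cards0 /=; apply/esym/negbTE/negP => fl.
  have /forallP/(_ ord_max)/existsP[k /eqP fk] := fl.
  suff : k \in [set k | door k]%SET by rewrite D0 inE.
  rewrite inE; apply/forallP => l.
  have /forallP/(_ (widen_ord (leqnSn _) l))/existsP[k' fk'] := fl.
  apply/existsP; exists k'; rewrite fk' andbT.
  by apply: contraTneq fk' => ->; rewrite fk /= gtn_eqF.
rewrite inE => dk; have [fk|fk] := eqVneq (f k) n.+1.
  have -> : [set k | door k]%SET = [set k]%SET.
    apply/setP => k'; rewrite !inE; apply/idP/eqP => [dk'|->//].
    apply/eqP; apply: contraT => k'k.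
    have : F k \in F @: [set~ k']%SET by apply: imset_f; rewrite !inE eq_sym.
    have /imset_injP/eqP ck' := door_inj _ dk'.
    have sub : [set~ ord_max : 'I_n.+2]%SET \subset F @: [set~ k']%SET.
      apply/fintype.subsetP => l; rewrite !inE => lmax.
      have ln : (l < n.+1)%N by rewrite ltn_neqAle -ltnS ltn_ord andbT; apply: contraNneq lmax => e; apply/eqP; exact: val_inj.
      have [j jk' fj] := doorE _ dk' _ ln.
      by apply/imsetP; exists j; rewrite ?inE//; apply: val_inj.
    have -> : F @: [set~ k']%SET = [set~ ord_max : 'I_n.+2]%SET.
      by apply/esym/eqP; rewrite eqEcard sub ck' !cardsC1 leqnn.
    by rewrite !inE => /negP[]; apply/eqP; apply: val_inj.
  rewrite cards1; apply/esym/forallP => l; apply/existsP.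
  have [ln|ln] := ltnP l n.+1; first by have [k' _ fk'] := doorE _ dk _ ln; exists k'; rewrite fk'.
  by exists k; rewrite fk eq_sym eqn_leq ln -ltnS ltn_ord.
have fk_lt : (f k < n.+1)%N by rewrite ltn_neqAle fk f_le.
have [k' k'k fk'] := doorE _ dk _ fk_lt.
have -> : [set k | door k]%SET = [set k; k']%SET.
  apply/setP => j; rewrite !inE; apply/idP/idP => [dj|/orP[/eqP->//|/eqP->]].
    apply: contraT; rewrite negb_or => /andP[jk jk'].
    suff /eqP : k' = k by rewrite (negPf k'k).
    by apply: (door_inj _ dj); rewrite ?inE 1?eq_sym//; apply: val_inj.
  apply/forallP => l; have [i ik fi] := doorE _ dk _ (ltn_ord l).
  apply/existsP; have [ik'|ik'] := eqVneq i k'; last by exists i; rewrite ik' fi /=.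
  by exists k; rewrite eq_sym k'k/= -fk' -ik' fi.
rewrite cards2 eq_sym k'k /=; apply/esym/negbTE/negP => /full_inj inj.
by move: k'k; rewrite (inj k' k) ?eqxx//; apply: val_inj.
Qed.

End Labels.

Section Simplices.
Variables (n K : nat).
Implicit Types (x : {ffun 'I_n -> 'I_K.+1}) (t : 'S_n).

(* The [k]-th vertex of the simplex of the Freudenthal triangulation with base
   point [x]: walking along the vertices, coordinate [i] is the one incremented
   at step [t i]. *)
Definition vertex x t (k : nat) : 'I_n -> nat := fun i => (x i + (t i < k))%N.

Lemma vertex_le x t k i : (vertex x t k i <= K.+1)%N.
Proof.
by rewrite /vertex; case: (t i < k)%N; rewrite ?addn1 ?addn0 ?ltn_ord// leqW// -ltnS ltn_ord.
Qed.

Definition simplex_full (lam : ('I_n -> nat) -> nat) x t : bool :=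
  [forall l : 'I_n.+1, exists k : 'I_n.+1, lam (vertex x t k) == l].

(* Boundary conditions of Kuhn's cubical Sperner lemma on the grid
   [{0, ..., K + 1}^n]. *)
Definition kuhn_labelling (lam : ('I_n -> nat) -> nat) : Prop :=
  forall v, (forall i, v i <= K.+1)%N ->
    [/\ (lam v <= n)%N, forall i, v i = 0%N -> (lam v <= i)%N &
        forall i, v i = K.+1 -> lam v != i].

Definition simplices_full (lam : ('I_n -> nat) -> nat) :
    {set {ffun 'I_n -> 'I_K.+1} * 'S_n} :=
  [set p | simplex_full lam p.1 p.2]%SET.

End Simplices.

Section KuhnStep.
Variables (n K : nat) (lam : ('I_n.+1 -> nat) -> nat).
Hypothesis lam_kuhn : kuhn_labelling K lam.

Local Notation simplex := ({ffun 'I_n.+1 -> 'I_K.+1} * 'S_n.+1)%type.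
Implicit Types (x : {ffun 'I_n.+1 -> 'I_K.+1}) (t : 'S_n.+1).

Let lab x t (k : 'I_n.+2) := lam (vertex x t k).

Let lab_le x t k : (lab x t k <= n.+1)%N.
Proof. by have [] := lam_kuhn (vertex_le x t k). Qed.

Let facet x t (k : 'I_n.+2) : Prop := forall l, (l < n.+1)%N ->
  exists k', [/\ (k' < n.+2)%N, k' != k :> nat & lam (vertex x t k') = l].

Let facetP x t k : reflect (facet x t k) (door (lab x t) k).
Proof.
apply: (iffP forallP) => [dk l ln|fk l].
  by have /existsP[k' /andP[k'k /eqP e]] := dk (Ordinal ln); exists k'.
have [k' [k'n k'k e]] := fk l (ltn_ord l).
by apply/existsP; exists (Ordinal k'n); rewrite /lab e eqxx andbT.
Qed.

(** Trading an end vertex for one beyond the other end turns the first step of the walk into the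
    last or conversely, a cyclic shift of the step order. *)
Let rot_up : 'S_n.+1 := perm (can_inj (@ordSK n.+1)).
Let rot_dn : 'S_n.+1 := perm (can_inj (@ord_predK n.+1)).

Let rot_upE r : rot_up r = ordS r. Proof. exact: permE. Qed.
Let rot_dnE r : rot_dn r = ord_pred r. Proof. exact: permE. Qed.

Let rot_upK : (rot_up * rot_dn = 1)%g.
Proof. by apply/permP => r; rewrite permM rot_upE rot_dnE ordSK perm1. Qed.
Let rot_dnK : (rot_dn * rot_up = 1)%g.
Proof. by apply/permP => r; rewrite permM rot_upE rot_dnE ord_predK perm1. Qed.

Let ordS_max : ordS (ord_max : 'I_n.+1) = ord0.
Proof. by apply: val_inj; rewrite /= modnn. Qed.
Let ord_pred_gt (r : 'I_n.+1) : r != ord0 -> ord_pred r = r.-1 :> nat.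
Proof.
move=> r0; have r_gt0 : (0 < r)%N.
  by rewrite lt0n; apply: contraNneq r0 => e; apply/eqP/val_inj.
rewrite /= -(prednK r_gt0) addSn /= modnDr modn_small//.
by rewrite prednK// ltnW.
Qed.
Let ord_pred_0 : ord_pred (ord0 : 'I_n.+1) = ord_max.
Proof. by apply: val_inj; rewrite /= modn_small. Qed.

(** [inord] gives the true successor only while it is at most [K], which [interior] provides. *)
Definition bump_up x i : {ffun 'I_n.+1 -> 'I_K.+1} :=
  [ffun j => if j == i then inord (x j).+1 else x j].
Definition bump_down x i : {ffun 'I_n.+1 -> 'I_K.+1} :=
  [ffun j => if j == i then inord (x j).-1 else x j].

Let first t := (t^-1)%g ord0.
Let last t := (t^-1)%g ord_max.

(** The facet opposite vertex [k] is shared with a second simplex of the grid. Only removing the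
    first or the last vertex can lead out of the grid, because it shifts the base point. *)
Definition interior (q : simplex * 'I_n.+2) : bool :=
  let: (x, t, k) := q in
  if k == ord0 then (x (first t) < K)%N
  else if k == ord_max then (0 < x (last t))%N else true.

(* The other simplex with the same facet opposite to vertex [k], paired with
   the index of its own opposite vertex. *)
Definition pivot (q : simplex * 'I_n.+2) : simplex * 'I_n.+2 :=
  let: (x, t, k) := q in
  if k == ord0 then (bump_up x (first t), (t * rot_dn)%g, ord_max)
  else if k == ord_max then (bump_down x (last t), (t * rot_up)%g, ord0)
  else (x, (t * tperm (inord k.-1) (inord k))%g, k).

Let firstE t : t (first t) = ord0. Proof. exact: permKV. Qed.
Let lastE t : t (last t) = ord_max. Proof. exact: permKV. Qed.

Let last_rot t : last (t * rot_dn)%g = first t.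
Proof. by apply: (@perm_inj _ (t * rot_dn)%g); rewrite lastE permM firstE rot_dnE ord_pred_0. Qed.
Let first_rot t : first (t * rot_up)%g = last t.
Proof. by apply: (@perm_inj _ (t * rot_up)%g); rewrite firstE permM lastE rot_upE ordS_max. Qed.

Let bump_upE x i : (x i < K)%N -> bump_up x i i = (x i).+1 :> nat.
Proof. by move=> h; rewrite ffunE eqxx inordK. Qed.
Let bump_downE x i : bump_down x i i = (x i).-1 :> nat.
Proof. by rewrite ffunE eqxx inordK// (leq_ltn_trans (leq_pred _)). Qed.
Let bump_upK x i : (x i < K)%N -> bump_down (bump_up x i) i = x.
Proof.
move=> h; apply/ffunP => j; have [->|ji] := eqVneq j i; last by rewrite !ffunE (negPf ji).
by apply: val_inj; rewrite /= bump_downE bump_upE.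
Qed.
Let bump_downK x i : (0 < x i)%N -> bump_up (bump_down x i) i = x.
Proof.
move=> h; apply/ffunP => j; have [->|ji] := eqVneq j i; last by rewrite !ffunE (negPf ji).
have h' : (bump_down x i i < K)%N by rewrite bump_downE -ltnS prednK.
by apply: val_inj; rewrite /= bump_upE// bump_downE prednK.
Qed.

Let vertex_up x t k : (x (first t) < K)%N -> (k < n.+1)%N ->
  vertex (bump_up x (first t)) (t * rot_dn)%g k = vertex x t k.+1.
Proof.
move=> h kn; apply: funext => i; rewrite /vertex permM rot_dnE.
have [->|i0] := eqVneq i (first t).
  rewrite bump_upE// firstE ord_pred_0 /= addn1.
  by rewrite [(n < k)%N]ltnNge -ltnS kn addn0.
rewrite ffunE (negPf i0) ord_pred_gt; last first.
  by apply: contraNneq i0 => e; apply/eqP/(@perm_inj _ t); rewrite firstE.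
have ti : (0 < t i)%N.
  rewrite lt0n; apply: contraNneq i0 => e; apply/eqP/(@perm_inj _ t).
  by rewrite firstE; exact: val_inj.
by rewrite -ltnS prednK.
Qed.

Let vertex_down x t k : (0 < x (last t))%N -> (k < n.+1)%N ->
  vertex (bump_down x (last t)) (t * rot_up)%g k.+1 = vertex x t k.
Proof.
move=> h kn; have e : (bump_down x (last t)) (first (t * rot_up)%g) = (x (last t)).-1 :> nat.
  by rewrite first_rot bump_downE.
rewrite -vertex_up//; last by rewrite e -ltnS prednK.
by rewrite first_rot bump_downK// -mulgA rot_upK mulg1.
Qed.

Let vertex_swap x t (k : 'I_n.+2) k' : k != ord0 -> k != ord_max -> k' != k :> nat ->
  vertex x (t * tperm (inord k.-1) (inord k))%g k' = vertex x t k'.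
Proof.
move=> k0 km k'k; apply: funext => i; rewrite /vertex permM; congr (_ + nat_of_bool _)%N.
have k_gt0 : (0 < k)%N by rewrite lt0n; apply: contraNneq k0 => e; apply/eqP/val_inj.
have kn : (k < n.+1)%N.
  by rewrite ltn_neqAle -ltnS ltn_ord andbT; apply: contraNneq km => e; apply/eqP/val_inj.
have e1 : (inord k.-1 : 'I_n.+1) = k.-1 :> nat by rewrite inordK// (leq_ltn_trans (leq_pred _)).
have e2 : (inord k : 'I_n.+1) = k :> nat by rewrite inordK.
have main : (k.-1 < k')%N = (k < k')%N.
  by rewrite -ltnS prednK// ltnS leq_eqVlt eq_sym (negPf k'k).
by case: tpermP => [->|->|//]; rewrite e1 e2 main.
Qed.

Let facet_pivot q : interior q -> facet q.1.1 q.1.2 q.2 ->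
  facet (pivot q).1.1 (pivot q).1.2 (pivot q).2.
Proof.
case: q => -[x t] k /=; have [->|k0] := eqVneq k ord0.
  move=> h fk l ln; have [k' [k'n k'0 e]] := fk l ln.
  have k'_gt0 : (0 < k')%N by rewrite lt0n.
  have k'n' : (k'.-1 < n.+1)%N by rewrite -ltnS prednK.
  exists k'.-1; split; first exact: ltnW.
    by rewrite /= ltn_eqF.
  by rewrite /= vertex_up// prednK.
have [->|km] := eqVneq k ord_max.
  move=> h fk l ln; have [k' [k'n k'm e]] := fk l ln.
  have k'n' : (k' < n.+1)%N by rewrite ltn_neqAle k'm -ltnS.
  by exists k'.+1; split=> //=; rewrite vertex_down.
move=> _ fk l ln; have [k' [k'n k'k e]] := fk l ln.
by exists k'; split=> //=; rewrite vertex_swap.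
Qed.

Let max0 : (ord_max == ord0 :> 'I_n.+2) = false. Proof. by []. Qed.

Let interior_pivot q : interior q -> interior (pivot q).
Proof.
case: q => -[x t] k /=; have [_|k0] := eqVneq k ord0.
  by move=> h; rewrite /interior max0 eqxx last_rot bump_upE.
have [_|km] := eqVneq k ord_max; last by rewrite /= (negPf k0) (negPf km).
by move=> h; rewrite /= first_rot bump_downE -ltnS prednK.
Qed.

Let pivotK q : interior q -> pivot (pivot q) = q.
Proof.
case: q => -[x t] k /=; have [->|k0] := eqVneq k ord0.
  by move=> h; rewrite /pivot max0 eqxx last_rot bump_upK// -mulgA rot_dnK mulg1.
have [->|km] := eqVneq k ord_max.
  by move=> h; rewrite /= first_rot bump_downK// -mulgA rot_upK mulg1.
by move=> _; rewrite /= (negPf k0) (negPf km) -mulgA tperm2 mulg1.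
Qed.

Let pivot_neq q : pivot q != q.
Proof.
case: q => -[x t] k /=; have [->|k0] := eqVneq k ord0; first by apply/eqP => -[].
have [->|km] := eqVneq k ord_max; first by apply/eqP => -[].
apply/eqP => -[/permP/(_ ((t^-1)%g (inord k)))]; rewrite permM permKV tpermR => /(congr1 val)/=.
have k_gt0 : (0 < k)%N by rewrite lt0n; apply: contraNneq k0 => e; apply/eqP/val_inj.
have kn : (k < n.+1)%N.
  by rewrite ltn_neqAle -ltnS ltn_ord andbT; apply: contraNneq km => e; apply/eqP/val_inj.
rewrite !inordK//; last by rewrite (leq_ltn_trans (leq_pred _)).
by move=> /eqP; rewrite ltn_eqF// prednK.
Qed.

Definition extend (v : 'I_n -> nat) : 'I_n.+1 -> nat := fun i =>
  if unlift ord_max i is Some j then v j else 0%N.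

Let extend_lift v j : extend v (lift ord_max j) = v j.
Proof. by rewrite /extend liftK. Qed.
Let extend_max v : extend v ord_max = 0%N.
Proof. by rewrite /extend unlift_none. Qed.

Lemma kuhn_labelling_extend : kuhn_labelling K (lam \o extend).
Proof.
move=> v vK; have [|l1 l2 l3] := @lam_kuhn (extend v).
  by move=> i; rewrite /extend; case: (unlift _ _).
split=> [|i vi|i vi] /=.
- by have := l2 ord_max; rewrite extend_max; exact.
- by have := l2 (lift ord_max i); rewrite extend_lift lift_max; exact.
- by have := l3 (lift ord_max i); rewrite extend_lift lift_max; exact.
Qed.

(** Doors have the parity of the full simplices, and [pivot] pairs off the interior ones. A face at
    height [K.+1] lacks the label of its coordinate and carries no door. On a face at height 0 no
    label exceeds the coordinate, so a door there forces the last coordinate, and it is a full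
    simplex of [lam \o extend]. *)
Lemma odd_simplices_step :
  odd #|simplices_full K lam| = odd #|simplices_full K (lam \o extend)|.
Proof.
pose P := [set q : simplex * 'I_n.+2 | door (lab q.1.1 q.1.2) q.2]%SET.
have -> : odd #|simplices_full K lam| = odd #|P|.
  have -> : #|P| = (\sum_(p : simplex) \sum_k nat_of_bool (door (lab p.1 p.2) k))%N.
    rewrite pair_bigA/= -sum1_card big_mkcond/=; apply: eq_bigr => q _.
    by rewrite inE; case: (door _ _).
  have -> : #|simplices_full K lam| = (\sum_(p : simplex) nat_of_bool (simplex_full lam p.1 p.2))%N.
    rewrite -sum1_card big_mkcond/=; apply: eq_bigr => p _.
    by rewrite inE; case: (simplex_full _ _ _).
  rewrite [LHS](big_morph odd oddD (erefl : odd 0 = false)).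
  rewrite [RHS](big_morph odd oddD (erefl : odd 0 = false)); apply: eq_bigr => p _.
  have -> : (\sum_k nat_of_bool (door (lab p.1 p.2) k) = #|[set k | door (lab p.1 p.2) k]%SET|)%N.
    by rewrite -sum1_card [RHS]big_mkcond; apply: eq_bigr => k _; rewrite inE; case: (door _ _).
  rewrite (odd_doors (lab_le p.1 p.2)); have -> : full_labels (lab p.1 p.2) = simplex_full lam p.1 p.2 by [].
  by case: (simplex_full _ _ _).
rewrite -(cardsID [set q | interior q]%SET P) oddD.
rewrite (negPf (@even_of_involution _ (P :&: [set q | interior q])%SET pivot _ _ _))/=; last first.
- by move=> q _; exact: pivot_neq.
- by move=> q; rewrite !inE => /andP[_]; exact: pivotK.
- move=> q; rewrite !inE => /andP[/facetP dq iq]; rewrite interior_pivot// andbT.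
  by apply/facetP; exact: facet_pivot.
pose ext (y : {ffun 'I_n -> 'I_K.+1}) : {ffun 'I_n.+1 -> 'I_K.+1} :=
  [ffun i => if unlift ord_max i is Some j then y j else ord0].
pose h (p : {ffun 'I_n -> 'I_K.+1} * 'S_n) : simplex * 'I_n.+2 :=
  (ext p.1, lift_perm ord_max ord_max p.2, ord_max).
have h_inj : injective h.
  move=> [y r] [y' r'] [/ffunP e1 /permP e2]; congr pair.
    by apply/ffunP => j; have := e1 (lift ord_max j); rewrite !ffunE liftK.
  apply/permP => j; have := e2 (lift ord_max j); rewrite !lift_perm_lift.
  exact: lift_inj.
have vert y r k : (k < n.+1)%N ->
    vertex (ext y) (lift_perm ord_max ord_max r) k = extend (vertex y r k).
  move=> kn; apply: funext => i; rewrite /vertex.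
  case: (unliftP ord_max i) => [j ->|->].
    by rewrite extend_lift lift_perm_lift ffunE liftK lift_max.
  by rewrite extend_max lift_perm_id ffunE unlift_none /= ltnNge -ltnS kn.
rewrite -(card_imset _ h_inj); congr (odd #|pred_of_set _|); apply/setP => q.
apply/idP/imsetP => [|[[y r]]].
  case: q => -[x t] k; rewrite !inE => /andP[ni /facetP fk].
  move: ni fk => /=; have [->|k0] := eqVneq k ord0.
    rewrite -leqNgt => xK fk.
    have [k' [k'n k'0 e]] := fk (first t) (ltn_ord _).
    have [_ _ /(_ (first t))] := lam_kuhn (vertex_le x t k').
    rewrite e eqxx => /(_ _)/negP h'; exfalso; apply: h' => //.
    rewrite /vertex firstE /= lt0n k'0 addn1; congr S.
    by apply/eqP; rewrite eqn_leq xK -ltnS ltn_ord.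
  have [->|//] := eqVneq k ord_max; rewrite -leqNgt leqn0 => /eqP xl fk.
  have lastm : last t = ord_max.
    have [k' [k'n k'm e]] := fk n (ltnSn _).
    have [_ /(_ (last t)) + _] := lam_kuhn (vertex_le x t k').
    rewrite e => /(_ _) nl; apply: val_inj; apply/eqP; rewrite eqn_leq /= -ltnS ltn_ord/=.
    apply: nl; rewrite /vertex xl lastE /= add0n; apply/eqP; rewrite eqb0 -leqNgt.
    by rewrite -ltnS ltn_neqAle k'm -ltnS.
  have tm : t ord_max = ord_max by rewrite -{1}lastm lastE.
  have [r rE] : exists r : 'S_n, t = lift_perm ord_max ord_max r.
    have tl j : exists j', t (lift ord_max j) = lift ord_max j'.
      case: (unliftP ord_max (t (lift ord_max j))) => [j' ->|e]; first by exists j'.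
      have := neq_lift ord_max j; rewrite eq_sym -(inj_eq (@perm_inj _ t)) e tm eqxx//.
    have [f fE] := choice tl.
    have f_inj : injective f.
      by move=> j j' e; apply: (@lift_inj _ ord_max); apply: (@perm_inj _ t); rewrite !fE e.
    exists (perm f_inj); apply/permP => i; case: (unliftP ord_max i) => [j ->|->].
      by rewrite lift_perm_lift permE fE.
    by rewrite lift_perm_id.
  pose y : {ffun 'I_n -> 'I_K.+1} := [ffun j => x (lift ord_max j)].
  have xE : x = ext y.
    apply/ffunP => i; rewrite ffunE; case: (unliftP ord_max i) => [j ->|->].
      by rewrite ffunE.
    by apply: val_inj; rewrite /= -xl lastm.
  exists (y, r); last by rewrite /h /= -xE -rE.
  rewrite inE /=; apply/forallP => l; have [k' [k'n k'm e]] := fk l (ltn_ord _).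
  have k'n' : (k' < n.+1)%N by rewrite ltn_neqAle k'm -ltnS.
  by apply/existsP; exists (Ordinal k'n'); rewrite /= -vert// -xE -rE e.
rewrite inE => /forallP full ->; rewrite !inE /= ; apply/andP; split.
  rewrite eqxx -leqNgt leqn0; have -> : last (lift_perm ord_max ord_max r) = ord_max.
    by apply: (@perm_inj _ (lift_perm ord_max ord_max r)); rewrite lastE lift_perm_id.
  by rewrite ffunE unlift_none.
apply/facetP => l ln; have /existsP[k /eqP e] := full (Ordinal ln).
exists k; split; [exact: (ltnW (ltn_ord k))|by rewrite /= ltn_eqF|by rewrite vert].
Qed.

End KuhnStep.

Lemma kuhn_odd (n K : nat) (lam : ('I_n -> nat) -> nat) :
  kuhn_labelling K lam -> odd #|simplices_full K lam|.
Proof.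
elim: n lam => [|n IH] lam lamK.
  have -> : simplices_full K lam = [set: _]%SET.
    apply/setP => p; rewrite !inE; apply/forallP => l; apply/existsP; exists ord0.
    have [le _ _] := lamK _ (vertex_le p.1 p.2 (ord0 : 'I_1)).
    by move: le; rewrite leqn0 (ord1 l).
  by rewrite cardsT card_prod card_ffun !card_ord expn0 card_Sn.
rewrite odd_simplices_step//; apply: IH; exact: kuhn_labelling_extend.
Qed.

Lemma kuhn (n K : nat) (lam : ('I_n -> nat) -> nat) : kuhn_labelling K lam ->
  exists (x : {ffun 'I_n -> 'I_K.+1}) (t : 'S_n), simplex_full lam x t.
Proof.
move=> /kuhn_odd; have [->|[[x t]]] := set_0Vmem (simplices_full K lam).
  by rewrite cards0.
by rewrite inE => full _; exists x, t.
Qed.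
Lemma positive_lower_bound {R : realType} (I : finType) (f : I -> R) :
  (forall i, 0 < f i) -> exists2 e, 0 < e & forall i, e <= f i.
Proof.
move=> f0; pose s := 1 + \sum_i (f i)^-1.
have fi i : 0 <= (f i)^-1 by rewrite invr_ge0 ltW.
have s0 : 0 < s by rewrite ltr_pwDl// sumr_ge0.
exists s^-1 => [|i]; first by rewrite invr_gt0.
rewrite -[f i]invrK lef_pV2 ?posrE ?invr_gt0// /s (bigD1 i)//= addrCA lerDl.
by rewrite addr_ge0// sumr_ge0.
Qed.

(** * Covering dimension of a box *)

Section BoxDimension.
Context {R : realType} {A : metricType R} (n : nat).
Variables (c : 'rV[R]_n -> A) (coord : 'I_n -> A -> R) (l : 'I_n -> R).

Definition unit_box : set 'rV[R]_n := [set v | forall i, 0 <= v ord0 i <= 1].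

Hypothesis l_gt0 : forall i, 0 < l i.
Hypothesis coord_lip : forall i a b, `|coord i a - coord i b| * l i <= mdist a b.
Hypothesis coordK : forall v i, unit_box v -> coord i (c v) = v ord0 i.
Hypothesis c_cont : forall v, unit_box v -> forall r : R, 0 < r ->
  exists2 e : R, 0 < e & forall w, unit_box w ->
    (forall i, `|v ord0 i - w ord0 i| < e) -> mdist (c v) (c w) < r.

(** The constants make the two ranges overlap around [1 / 2] while keeping each set off one of the
    two faces in every coordinate. *)
Definition corner_set (S : {set 'I_n}) : set A :=
  [set a | forall i, if i \in S then coord i a < 2 / 3 else 1 / 3 < coord i a].

Lemma corner_set_open S : open (corner_set S).
Proof.
rewrite openE => a Ua.
pose m i := (if i \in S then 2 / 3 - coord i a else coord i a - 1 / 3) * l i.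
have m0 i : 0 < m i.
  by rewrite /m mulr_gt0//; have := Ua i; case: ifP => _ h; lra.
have [e e0 em] := positive_lower_bound m0.
apply/nbhs_ballP; exists e => //= b; rewrite ballEmdist/= => abe i.
have ei := le_lt_trans (coord_lip i a b) (lt_le_trans abe (em i)).
rewrite /m ltr_pM2r// in ei; have := Ua i; move: ei.
by rewrite ltr_norml; case: ifP => _ /andP[h1 h2] h3; lra.
Qed.

Lemma corner_set_cover : \bigcup_S corner_set S = setT.
Proof.
apply/seteqP; split=> // a _; exists [set i | coord i a <= 1 / 2]%SET => // i.
by rewrite inE; case: ifPn => h; [|rewrite -ltNge in h]; lra.
Qed.

Lemma unit_box_compact : compact unit_box.
Proof.
have -> : unit_box = [set v : 'rV[R]_n | forall i, `[0 : R, 1]%classic (v ord0 i)].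
  by apply/seteqP; split=> v /= h i; have := h i; rewrite in_itv.
apply: (@rV_compact R n (fun=> `[0 : R, 1]%classic)) => _; exact: segment_compact.
Qed.

Lemma lebesgue_number (q : nat) (V : 'I_q -> set A) :
  (forall j, open (V j)) -> \bigcup_j V j = setT ->
  exists K : nat, forall v, unit_box v -> exists j, forall w, unit_box w ->
    (forall i, `|v ord0 i - w ord0 i| <= K.+1%:R^-1) -> V j (c w).
Proof.
move=> Vo Vc.
pose P (K : nat) (v : 'rV[R]_n) := unit_box v -> exists j, forall w, unit_box w ->
    (forall i, `|v ord0 i - w ord0 i| <= K.+1%:R^-1) -> V j (c w).
have /compact_near_coveringP near := unit_box_compact.
have [|K _ HK] := near nat \oo P _; last by exists K => v bv; exact: (HK K (leqnn K) v bv bv).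
  move=> v bv; have : [set: A] (c v) by [].
  rewrite -Vc => -[j _ Vj]; have := Vo j; rewrite openE => /(_ _ Vj).
  move=> /nbhs_ballP[r /= r0 rV].
  have [e e0 He] := c_cont bv r0.
  have e2 : 0 < e / 2 by rewrite divr_gt0.
  exists ([set v' | ball v (e / 2) v'], [set K | K.+1%:R^-1 < e / 2]) => /=.
    by split; [exact: nbhsx_ballx|exact: near_infty_natSinv_lt (PosNum e2)].
  move=> [v' K] /= [[_ vv'] Ke] _; exists j => w bw v'w; apply: rV.
  rewrite ballEmdist/=; apply: He => // i.
  have := vv' ord0 i; rewrite /ball /= => h1; have h2 := v'w i.
  apply: (le_lt_trans (ler_distD (v' ord0 i) _ _)); rewrite (splitr e).
  by apply: ltr_leD => //; exact: le_trans h2 (ltW Ke).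
Qed.

(** No member of a refinement of the corner cover meets two opposite faces. Each grid point is
    labelled through a member containing its neighbourhood; the [n.+1] labels of a full simplex then
    come from distinct members that share its base vertex. *)
Lemma box_covering_dim k : covering_dim_le A k -> (n <= k)%N.
Proof.
have faces : ((1 < 2 / 3 :> R) = false) * ((1 / 3 < 0 :> R) = false).
  by split; apply/negbTE; rewrite -leNgt; lra.
move=> /(_ #|{set 'I_n}| (fun a => corner_set (enum_val a))) [||q [V [Vo Vc VU Vord]]].
- by move=> a; exact: corner_set_open.
- rewrite -corner_set_cover; apply/seteqP; split=> a [S _ h].
    by exists (enum_val S).
  by exists (enum_rank S) => //; rewrite enum_rankK.
have [K HK] := lebesgue_number Vo Vc.
(* [minn] keeps [pt v] in the box for every [v], so that [jj] can be chosen on all of them. *)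
pose pt (v : 'I_n -> nat) : 'rV[R]_n := \row_i ((minn (v i) K.+1)%:R / K.+1%:R).
have K0 : 0 < K.+1%:R :> R by rewrite ltr0n.
have pt_box v : unit_box (pt v).
  move=> i; rewrite mxE divr_ge0// ler_pdivrMr// mul1r ler_nat; exact: geq_minr.
have [jj jjP] := choice (fun v => HK (pt v) (pt_box v)).
pose meets j i := `[< exists w, [/\ unit_box w, w ord0 i = 0 & V j (c w)] >].
(* [mu j] is the first coordinate whose zero face is met by [V j]. *)
pose mu j := find (meets j) (enum 'I_n).
have mu_le j : (mu j <= n)%N.
  by rewrite -[X in (_ <= X)%N](size_enum_ord n) find_size.
have mu_meets j (i : 'I_n) : mu j = i -> meets j i.
  move=> e; have : has (meets j) (enum 'I_n) by rewrite has_find size_enum_ord -/(mu j) e.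
  by move=> /(nth_find i); rewrite -/(mu j) e nth_ord_enum.
have meets_mu j (i : 'I_n) : meets j i -> (mu j <= i)%N.
  move=> mji; rewrite leqNgt; apply/negP => /(before_find i).
  by rewrite nth_ord_enum mji.
have V_pt v : V (jj v) (c (pt v)).
  by apply: jjP => // i; rewrite subrr normr0 invr_ge0 ltW.
have lamK : kuhn_labelling K (mu \o jj).
  move=> v vK; split=> [|i vi|i vi] /=; first exact: mu_le.
    apply: meets_mu; apply/asboolP; exists (pt v); split=> //.
    by rewrite mxE vi min0n mul0r.
  apply/eqP => /mu_meets/asboolP[w [bw wi Vw]].
  have [a Va] := VU (jj v).
  have := Va _ Vw i; have := Va _ (V_pt v) i; rewrite !coordK// wi mxE vi minnn divff ?gt_eqF//.
  by case: ifP => _; rewrite ?faces.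
have [x [t full]] := kuhn lamK.
pose J := [set jj (vertex x t k') | k' : 'I_n.+1]%SET.
suff nJ : (n.+1 <= #|J|)%N.
  rewrite -ltnS (leq_trans nJ)//; apply: Vord; exists (c (pt (vertex x t 0))).
  move=> j /imsetP[k' _ ->]; apply: jjP => // i; rewrite !mxE -mulrBl normrM.
  rewrite [X in _ * X]gtr0_norm ?invr_gt0// ler_piMl// ?invr_ge0//.
  have /minn_idPl -> := vertex_le x t k' i; have /minn_idPl -> := vertex_le x t 0 i.
  rewrite /vertex ltn0 addn0 natrD [X in X - _]addrC addrK.
  by case: (_ < _)%N; rewrite ?normr1 ?normr0.
have sub : [set: 'I_n.+1]%SET \subset [set inord (mu j) | j in J]%SET.
  apply/fintype.subsetP => m _; have /forallP/(_ m)/existsP[k' /eqP /= e] := full.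
  by apply/imsetP; exists (jj (vertex x t k')); [exact: imset_f|rewrite e inord_val].
have := subset_leq_card sub; rewrite cardsT card_ord => /leq_trans; apply.
exact: leq_imset_card.
Qed.

End BoxDimension.

(** * Euclidean boxes and the affine rank *)

Section EuclideanNorm.
Context {R : realType} (n : nat).

(* A fresh alias, because the library puts the sup norm on row vectors. *)
Definition eucl : Type := 'rV[R]_n.
HB.instance Definition _ := GRing.Lmodule.on eucl.

Definition eucl_norm (v : eucl) : R := Num.sqrt (\sum_i v ord0 i ^+ 2).

Let sumsq_ge0 (v : eucl) : 0 <= \sum_i v ord0 i ^+ 2.
Proof. by apply: sumr_ge0 => i _; exact: sqr_ge0. Qed.

Let eucl_norm_sq (v : eucl) : eucl_norm v ^+ 2 = \sum_i v ord0 i ^+ 2.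
Proof. by rewrite sqr_sqrtr ?sumsq_ge0. Qed.

Let eucl_norm_eq0 (v : eucl) : eucl_norm v = 0 -> v = 0.
Proof.
move=> v0; have := eucl_norm_sq v; rewrite v0 expr0n/= => /esym/eqP.
rewrite psumr_eq0; last by move=> *; exact: sqr_ge0.
move=> /allP h; apply/rowP => i; rewrite mxE; apply: sq_eq0.
by have := h i; rewrite mem_index_enum => /(_ isT)/eqP.
Qed.

Let eucl_normZ (a : R) (v : eucl) : eucl_norm (a *: v) = `|a| * eucl_norm v.
Proof.
apply: squaresI; rewrite ?mulr_ge0 ?sqrtr_ge0//.
rewrite exprMn !eucl_norm_sq real_normK ?num_real// mulr_sumr.
by apply: eq_bigr => i _; rewrite mxE exprMn.
Qed.

Let eucl_normD (v w : eucl) : eucl_norm (v + w) <= eucl_norm v + eucl_norm w.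
Proof.
pose x := eucl_norm v; pose y := eucl_norm w.
have x0 : 0 <= x by exact: sqrtr_ge0.
have y0 : 0 <= y by exact: sqrtr_ge0.
pose s := \sum_i v ord0 i * w ord0 i.
have sE : eucl_norm (v + w) ^+ 2 = x ^+ 2 + 2 * s + y ^+ 2.
  rewrite !eucl_norm_sq /s mulr_sumr -!big_split/=; apply: eq_bigr => i _.
  by rewrite mxE; ring.
have cs : s <= x * y.
  have [xy0|xy0] := eqVneq (x * y) 0.
    rewrite xy0 /s; move/eqP: xy0; rewrite mulf_eq0 => /orP[] /eqP/eucl_norm_eq0 ->.
      by rewrite big1// => i _; rewrite mxE mul0r.
    by rewrite big1// => i _; rewrite mxE mulr0.
  have xy : 0 < x * y by rewrite lt_neqAle eq_sym xy0 mulr_ge0.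
  have : 0 <= \sum_i (y * v ord0 i - x * w ord0 i) ^+ 2.
    by apply: sumr_ge0 => i _; exact: sqr_ge0.
  have -> : \sum_i (y * v ord0 i - x * w ord0 i) ^+ 2 = 2 * (x * y) * (x * y - s).
    transitivity (y ^+ 2 * (\sum_i v ord0 i ^+ 2) - 2 * (x * y) * s +
      x ^+ 2 * (\sum_i w ord0 i ^+ 2)).
      by rewrite /s !mulr_sumr -sumrB -big_split/=; apply: eq_bigr => i _; ring.
    by rewrite -!eucl_norm_sq -/x -/y; ring.
  by rewrite pmulr_rge0 ?subr_ge0// mulr_gt0.
rewrite -ler_sqr ?nnegrE ?sqrtr_ge0 ?addr_ge0// sE -/x -/y.
by rewrite sqrrD; lra.
Qed.

HB.instance Definition _ :=
  Lmodule_isNormed.Build R eucl eucl_normD eucl_normZ eucl_norm_eq0.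

Lemma eucl_normE (v : eucl) : `|v| = Num.sqrt (\sum_i v ord0 i ^+ 2).
Proof. by []. Qed.

End EuclideanNorm.

Section RankBound.
Context {R : realType} {X : metricType R}.

Lemma nontrivial_decomposition_ord (n : nat) :
  nontrivial_decomposition (X := X) n ->
  exists D : 'I_n -> X -> X -> R, decomposition (fun x y : X => mdist x y) D /\
    forall i, exists x y, D i x y != 0.
Proof.
move=> [I [D [In [D_pd sq mix] nt]]]; subst n.
exists (fun a => D (enum_val a)); split; last by move=> a; exact: nt.
split=> // [x y|f].
  rewrite sq [RHS](reindex (@enum_rank I)) /=; last exact/onW_bij/enum_rank_bij.
  by apply: eq_bigr => i _; rewrite enum_rankK.
have [w wP] := mix (fun i => f (enum_rank i)).
by exists w => a; have := wP (enum_val a); rewrite enum_valK.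
Qed.

Section Box.
Variables (n : nat) (D : 'I_n -> X -> X -> R).
Hypothesis X_geo : geodesic_pd (fun x y : X => mdist x y).
Hypothesis dec : decomposition (fun x y : X => mdist x y) D.
Hypothesis nt : forall i, exists x y, D i x y != 0.

Let D_pd i : pseudo_distance (D i). Proof. by case: dec. Qed.

Lemma component_linear i (g : R -> X) :
  linear_curve (fun x y : X => mdist x y) g -> linear_curve (D i) g.
Proof.
move=> lin; have [D' [spl _]] := decomposition_splitting (@pd_mdist R X) dec (g 0) i.
exact: (splitting_linear spl lin).1.
Qed.

Lemma component_le i x y : D i x y <= mdist x y.
Proof.
have [_ sq _] := dec.
rewrite -ler_sqr ?nnegrE ?mdist_ge0 ?pd_ge0// sq (bigD1 i)//= lerDl.
by apply: sumr_ge0 => *; exact: sqr_ge0.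
Qed.

(* The product of one segment in each factor is isometric to a Euclidean box. *)
Lemma decomposition_affine_rank : (n%:R%:E <= affine_rank X)%E.
Proof.
have [_ sq mix] := dec.
have H i : exists g : R -> X, linear_curve (D i) g /\ 0 < D i (g 0) (g 1).
  have [x [y xy]] := nt i; have [g [lin g0 g1]] := X_geo x y.
  exists g; split; first exact: component_linear.
  by rewrite g0 g1 lt_neqAle eq_sym xy pd_ge0.
have [g gP] := choice H.
pose l i := D i (g i 0) (g i 1).
have l_gt0 i : 0 < l i by case: (gP i).
(* Clamping makes the parametrisation total without changing it on the box. *)
pose clamp (v : 'rV[R]_n) i : R := Num.max 0 (Num.min 1 (v ord0 i)).
have clampI v i : 0 <= clamp v i <= 1.
  by rewrite /clamp le_max lexx/= ge_max ler01 ge_min lexx.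
have clampE v i : unit_box v -> clamp v i = v ord0 i.
  by move=> /(_ i)/andP[v0 v1]; rewrite /clamp (min_idPr v1) (max_idPr v0).
have [b bP] := choice (fun v : 'rV[R]_n => mix (fun i => g i (clamp v i))).
pose S : set X := [set b v | v in @unit_box R n].
have clamp_box v : unit_box (\row_i clamp v i) by move=> i; rewrite mxE.
have bS v : S (b (\row_i clamp v i)) by exists (\row_i clamp v i).
pose c v : submetric S := submetric_pack (bS v).
have cE v : unit_box v -> submetric_val (c v) = b v.
  move=> bv; rewrite submetric_packK; congr b; apply/rowP => i.
  by rewrite mxE clampE.
have Db i v w : unit_box v -> unit_box w -> D i (b v) (b w) = `|v ord0 i - w ord0 i| * l i.
  move=> bv bw; rewrite (pd_congl (D_pd i) _ (bP v i)) (pd_congr (D_pd i) _ (bP w i)).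
  by rewrite (gP i).1// !clampE.
have D0 i v : unit_box v -> D i (b v) (g i 0) = v ord0 i * l i.
  move=> bv; rewrite (pd_congl (D_pd i) _ (bP v i)) (gP i).1 ?in01_0// clampE//.
  by rewrite subr0 ger0_norm//; have /andP[] := bv i.
(* A coordinate is the normalised distance to the starting end of the [i]-th segment. *)
pose coord i (a : submetric S) := D i (submetric_val a) (g i 0) / l i.
have coordK v i : unit_box v -> coord i (c v) = v ord0 i.
  by move=> bv; rewrite /coord cE// D0// mulfK// gt_eqF.
have cS (a : submetric S) : exists2 v, unit_box v & a = c v.
  have [v bv e] := submetric_valP a; exists v => //.
  by apply: submetric_val_inj; rewrite cE.
have dist_c v w : unit_box v -> unit_box w ->
    mdist (c v) (c w) ^+ 2 = \sum_i (v ord0 i * l i - w ord0 i * l i) ^+ 2.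
  move=> bv bw; rewrite submetric_mdist !cE// sq; apply: eq_bigr => i _.
  by rewrite Db// exprMn real_normK ?num_real//; ring.
apply: (@le_trans _ _ (topological_dim (submetric S))).
  apply: le_ereal_inf_tmp => _ [k kdim <-]; rewrite lee_fin ler_nat.
  apply: (@box_covering_dim R (submetric S) n c coord l l_gt0 _ _ _ k) => //.
    move=> i a a'; rewrite /coord -mulrBl normrM [X in _ * X * _]gtr0_norm ?invr_gt0//.
    rewrite mulfVK ?gt_eqF//; apply: le_trans (component_le i _ _).
    have h1 := pd_triangle (D_pd i) (submetric_val a') (submetric_val a) (g i 0).
    have h2 := pd_triangle (D_pd i) (submetric_val a) (submetric_val a') (g i 0).
    by rewrite (pd_sym (D_pd i) (submetric_val a') (submetric_val a)) in h2; rewrite ler_norml; apply/andP; split; lra.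
  (* Coordinates closer than [r / s] give a squared distance of at most [(r / s) ^+ 2 * (s - 1)],
     which is below [r ^+ 2]. *)
  move=> v bv r r0; pose s := 1 + \sum_i l i ^+ 2.
  have s1 : 1 <= s by rewrite lerDl sumr_ge0// => *; exact: sqr_ge0.
  have s0 : 0 < s by lra.
  exists (r / s) => [|w bw vw]; first by rewrite divr_gt0.
  rewrite -ltr_sqr ?nnegrE ?mdist_ge0 ?(ltW r0)// dist_c//.
  have le : \sum_i (v ord0 i * l i - w ord0 i * l i) ^+ 2 <= (r / s) ^+ 2 * (s - 1).
    rewrite /s addrAC subrr add0r mulr_sumr; apply: ler_sum => i _.
    rewrite -mulrBl exprMn; apply: ler_wpM2r; first exact: sqr_ge0.
    rewrite -(real_normK (num_real (v ord0 i - _))) ler_sqr ?nnegrE ?divr_ge0// ltW//.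
  apply: (le_lt_trans le).
  have -> : (r / s) ^+ 2 * (s - 1) = r ^+ 2 * ((s - 1) / s ^+ 2) by field; lra.
  rewrite gtr_pMr ?exprn_gt0// ltr_pdivrMr ?exprn_gt0// mul1r.
  by rewrite expr2; nra.
apply: ereal_sup_ubound; exists (submetric S); split=> //.
- by exists (c 0).
- pose f (a : submetric S) : eucl n := \row_i (coord i a * l i).
  have fc v : unit_box v -> f (c v) = \row_i (v ord0 i * l i).
    by move=> bv; apply/rowP => i; rewrite !mxE coordK.
  exists (eucl n), [set f a | a in setT], f; split=> //.
    move=> x y lam /set_mem[a _ <-] /set_mem[a' _ <-]; apply/mem_set.
    have [v bv ->] := cS a; have [w bw ->] := cS a'.
    pose p : R := lam%:num.
    have p01 : 0 <= p <= 1 by rewrite /p; apply/andP; split.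
    pose u : 'rV[R]_n := \row_i (p * v ord0 i + (1 - p) * w ord0 i).
    have bu : unit_box u.
      by move=> i; rewrite mxE; have := bv i; have := bw i; move=> *; nra.
    exists (c u) => //; rewrite !fc//.
    transitivity (p *: (\row_i (v ord0 i * l i)) + (1 - p) *: (\row_i (w ord0 i * l i)) : 'rV[R]_n) => //.
    by apply/rowP => i; rewrite !mxE; ring.
  move=> a a'; have [v bv ->] := cS a; have [w bw ->] := cS a'.
  rewrite !fc// eucl_normE -[RHS]ger0_norm ?mdist_ge0// -sqrtr_sqr dist_c//.
  by congr Num.sqrt; apply: eq_bigr => i _; rewrite !mxE.
- by exists (@submetric_val R X S) => x y.
Qed.

End Box.

Lemma nontrivial_decomposition_bound (n : nat) : geodesic_space X ->
  affine_rank X \is a fin_num -> nontrivial_decomposition (X := X) n ->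
  (n <= Num.bound (fine (affine_rank X)))%N.
Proof.
move=> /geodesic_space_pd geo fin /nontrivial_decomposition_ord[D [dec nt]].
have := decomposition_affine_rank geo dec nt.
rewrite -(fineK fin) lee_fin => le.
have r0 : 0 <= fine (affine_rank X) by apply: le_trans le.
by rewrite -(ler_nat R) (le_trans le)// ltW// archi_boundP.
Qed.

End RankBound.

Theorem theorem1p1 (R : realType) (X : metricType R)
  (X_nonempty : [set: X] !=set0)
  (X_geodesic : geodesic_space X)
  (X_rank : affine_rank X \is a fin_num) :
  (exists (n : nat) (Y : 'I_n.+1 -> metricType R) (phi : X -> forall i, Y i),
     de_rham_decomposition phi) /\
  (forall (n : nat) (Y : 'I_n.+1 -> metricType R) (phi : X -> forall i, Y i)
          (m : nat) (Z : 'I_m.+1 -> metricType R) (psi : X -> forall i, Z i),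
     de_rham_decomposition phi -> de_rham_decomposition psi ->
     exists (e : n = m) (s : {perm 'I_n.+1}),
       forall (x : X) (i : 'I_n.+1), i != ord0 ->
         fiber phi i x = fiber psi (cast_ord (congr1 S e) (s i)) x).
Proof.
have [x0 _] := X_nonempty; split.
  by apply: (de_rham_exists x0) => n; exact: nontrivial_decomposition_bound.
by move=> n Y phi m Z psi; exact: de_rham_unique.
Qed.
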